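(* For any constant $k\geq3$, the decision problem $k$-SHARP-ATTRACTOR $=\{\langle T,p\rangle : \text{string } T \text{ has a } k\text{-sharp attractor of size}\leq p\}$ is NP-complete.
   Context: A $k$-sharp attractor of a string $S\in\Sigma^n$ is a set $\Gamma\subseteq[1..n]$ such that every substring $S[i..j]$ with $j-i+1=k$ has an occurrence $S[i'..j']=S[i..j]$ with $j''\in[i'..j']$ for some $j''\in\Gamma$ (i.e., it covers all substrings of length exactly $k$). The alphabet is part of the input (not bounded). *)

(* Defs.v *)
From mathcomp Require Import all_boot all_algebra.

Set Implicit Arguments.
Unset Strict Implicit.
Unset Printing Implicit Defensive.

(* Deterministic multi-tape Turing machines.  The tapes are two-way infinite.
   A cell contains [None] (the blank) or [Some g] with [g] in the finite work
   alphabet, in which the input and output alphabets are embedded. *)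

Variant move := MoveLeft | Stay | MoveRight.

Record turing_machine (A B : finType) := TuringMachine {
  tm_state : finType;
  tm_sym : finType;
  tm_tape : finType;
  tm_in : tm_tape;
  tm_out : tm_tape;
  tm_of_input : A -> tm_sym;
  tm_of_output : B -> tm_sym;
  tm_of_input_inj : injective tm_of_input;
  tm_of_output_inj : injective tm_of_output;
  tm_start : tm_state;
  tm_halt : pred tm_state;
  tm_delta : tm_state -> {ffun tm_tape -> option tm_sym} ->
    tm_state * {ffun tm_tape -> option tm_sym * move} }.

(* [Tape l c r]: [c] is the scanned cell, [l] the cells to its left (nearest
   first), [r] those to its right; all cells beyond [l] and [r] are blank. *)
Record tape (G : Type) := Tape {
  tape_left : seq (option G);
  tape_cur : option G;
  tape_right : seq (option G) }.

Definition tape_move (G : Type) (m : move) (t : tape G) : tape G :=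
  let: Tape l c r := t in
  match m with
  | MoveLeft => Tape (behead l) (head None l) (c :: r)
  | Stay => t
  | MoveRight => Tape (c :: l) (head None r) (behead r)
  end.

Definition tape_write (G : Type) (c : option G) (t : tape G) : tape G :=
  Tape (tape_left t) c (tape_right t).

(* The head scans the first letter of the word (a blank if it is empty). *)
Definition tape_of_word (G : Type) (w : seq G) : tape G :=
  Tape [::] (ohead w) (map Some (behead w)).

Fixpoint nonblank_prefix (G : Type) (s : seq (option G)) : seq G :=
  if s is Some g :: s' then g :: nonblank_prefix s' else [::].

(* The longest blank-free word starting at the head and going right. *)
Definition word_of_tape (G : Type) (t : tape G) : seq G :=
  nonblank_prefix (tape_cur t :: tape_right t).

Section Run.
Variables (A B : finType) (M : turing_machine A B).

Record config := Config {
  cfg_state : tm_state M;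
  cfg_tapes : tm_tape M -> tape (tm_sym M) }.

Definition init_config (x : seq A) : config :=
  Config (tm_start M)
    (fun i => tape_of_word
                (if i == tm_in M then map (@tm_of_input _ _ M) x else [::])).

(* Halting configurations are fixed points. *)
Definition step (c : config) : config :=
  if tm_halt (cfg_state c) then c else
  let: (q, act) :=
    tm_delta (cfg_state c) [ffun i => tape_cur (cfg_tapes c i)] in
  Config q (fun i => tape_move (act i).2 (tape_write (act i).1 (cfg_tapes c i))).

Definition outputs_within (x : seq A) (y : seq B) (t : nat) : Prop :=
  let c := iter t step (init_config x) in
  tm_halt (cfg_state c) /\
  word_of_tape (cfg_tapes c (tm_out M)) = map (@tm_of_output _ _ M) y.

End Run.

Definition polytime (A B : finType) (f : seq A -> seq B) : Prop :=
  exists (M : turing_machine A B) (p : {poly nat}),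
    forall x : seq A, outputs_within M x (f x) p.[size x]%R.

Definition polytime_pred (A : finType) (chi : seq A -> bool) : Prop :=
  polytime (fun x => [:: chi x]).

Definition language (A : finType) := seq A -> Prop.

(* The verifier reads the instance [x] followed by the certificate [u]; the
   two are written in disjoint alphabets, so the pair is encoded unambiguously. *)
Definition in_NP (A : finType) (L : language A) : Prop :=
  exists (p : {poly nat}) (V : seq (A + bool)%type -> bool),
    polytime_pred V /\
    forall x : seq A, L x <->
      exists u : seq bool,
        size u <= p.[size x]%R /\ V (map inl x ++ map inr u).

Definition karp_reducible (A B : finType) (L : language A) (L' : language B)
  : Prop :=
  exists f : seq A -> seq B, polytime f /\ forall x, L x <-> L' (f x).

Definition NP_hard (B : finType) (L' : language B) : Prop :=
  forall (A : finType) (L : language A), in_NP L -> karp_reducible L L'.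

Definition NP_complete (B : finType) (L : language B) : Prop :=
  in_NP L /\ NP_hard L.

(* Positions are numbered from 0; [substring S i j] is S[i..j], both ends
   included. *)
Definition substring (Sigma : Type) (S : seq Sigma) (i j : nat) : seq Sigma :=
  drop i (take j.+1 S).

Definition sharp_attractor (k : nat) (Sigma : Type) (S : seq Sigma)
    (Gamma : {set 'I_(size S)}) : Prop :=
  forall i j : nat, i <= j < size S -> j - i + 1 = k ->
    exists i' j' : nat,
      [/\ i' <= j' < size S,
          substring S i' j' = substring S i j &
          exists2 g : 'I_(size S), g \in Gamma & i' <= g <= j'].

(* Binary digits, least significant first, without leading zeros. *)
Definition binary (n : nat) : seq bool :=
  [seq odd (n %/ 2 ^ e) | e <- iota 0 (up_log 2 n.+1)].

(* The letters are natural numbers, so the alphabet is unbounded.  [None] ends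
   each number; the numbers are p, then the letters of T. *)
Definition encode (T : seq nat) (p : nat) : seq (option bool) :=
  flatten [seq rcons (map Some (binary n)) None | n <- p :: T].

Definition k_sharp_attractor (k : nat) : language (option bool) :=
  fun w => exists (T : seq nat) (p : nat),
    w = encode T p /\
    exists Gamma : {set 'I_(size T)},
      sharp_attractor k Gamma /\ #|Gamma| <= p.

(* Main.v *)
(* Hardness.  The computation of a polynomial-time verifier, with its heads kept
   fixed and the certificate guessed in the first row, is a tiling of a row of cells
   wound helically on a cylinder: cell [c] constrains only [c + 1] and [c + w].

   Tilings become systems of blocks.  A block is a list of words with levels in
   [0, k - 1); a choice skips exactly one word per level, at increasing positions,
   and every word must have an occurrence that is not skipped.  Skipping the word
   of a colour in the group of a cell makes the choice in each adjacent link block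
   forced, one port after the other; two active ports of a forbidden pair
   of colours would need their skips in the wrong order.

   A block becomes a string of words of length [k] separated by private letters
   (occurring once), an entry of level [j] being shifted by [j + 1] modulo [k].
   With the smallest budget compatible with the private windows, an attractor has
   one position per [k] letters whose phase must advance by [k - 1] along a
   block, and each advance by one past column [j + 1] misses exactly one window: a
   word of level [j].

   Membership.  The certificate is the attractor as a bit mask, which a stack program
   checks window by window; the reduction is printed by another stack program. *)

Require Import Defs.
From mathcomp Require Import all_boot all_algebra.
From mathcomp Require Import zify.

Set Implicit Arguments.
Unset Strict Implicit.
Unset Printing Implicit Defensive.


(** * Stack programs *)

(** The bound [3 <= k] enters because a block has [k - 1] levels and two are needed: the order
    between two skips is the only constraint a block can express. All else is reduced to it and to
    the covering condition. A word with exactly two occurrences is an implication: if one is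
    skipped, the other is not. A chain of such words carries the colour picked in the group of a
    cell through all the blocks where that colour meets a candidate of a neighbour, and each of
    these blocks is an order test for one pair of candidates. On the string side the obstacle is
    that an attractor is an arbitrary set of positions: the budget must leave it no freedom but the
    choice of the unhit windows, and the unbounded alphabet supplies the private letters that force
    this. On the machine side the reduction and the verifier must be actual Turing machines. Hence
    the instance is uniform: up to the cell number and the circumference, the blocks of a cell
    depend only on its kind, so the printer needs finitely many constant texts and a few unary
    counters. The helix spares the instance any treatment of row ends, and padding gives all cells
    of the row the same ports. *)

Section StackPrograms.

Variables (G : finType) (m : nat).

Let acts := {ffun 'I_m -> option G * move}.
Let reads := {ffun 'I_m -> option G}.
Let tapes := 'I_m -> tape G.

(* A machine fragment: [None] as next state is the exit. *)
Record frag := Frag {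
  fst_ : finType;
  fentry : fst_;
  fdelta : fst_ -> reads -> option fst_ * acts }.

Definition apply_acts (act : acts) (tau : tapes) : tapes :=
  fun i => tape_move (act i).2 (tape_write (act i).1 (tau i)).

Definition scan (tau : tapes) : reads := [ffun i => tape_cur (tau i)].

Inductive reach (F : frag) : fst_ F -> tapes -> nat -> tapes -> Prop :=
| reach_exit s tau act : fdelta s (scan tau) = (None, act) ->
    reach s tau 1 (apply_acts act tau)
| reach_step s tau s' act t tau' : fdelta s (scan tau) = (Some s', act) ->
    reach s' (apply_acts act tau) t tau' -> reach s tau t.+1 tau'.

Definition store := seq (seq G).
Notation "S `_ i" := (nth [::] S i) : seq_scope.

(* Stack [i] is the blank-free word read from the head of tape [i] rightwards,
   with its top under the head. *)
Definition holds (tau : tapes) (S : store) :=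
  forall i : 'I_m, word_of_tape (tau i) = (S`_i)%SEQ.

Definition runs (F : frag) (S S' : store) (t : nat) :=
  forall tau, holds tau S ->
    exists tau' t', [/\ t' <= t, reach (fentry F) tau t' tau' & holds tau' S'].

Lemma runs_le F S S' t t' : runs F S S' t -> t <= t' -> runs F S S' t'.
Proof.
move=> H le tau /H [tau' [t0 [le0 r h]]]; exists tau', t0; split=> //.
exact: leq_trans le0 le.
Qed.

Definition keep (v : reads) : acts := [ffun i => (v i, Stay)].

Lemma apply_keep tau i : apply_acts (keep (scan tau)) tau i = tau i.
Proof. by rewrite /apply_acts !ffunE /=; case: (tau i). Qed.

Definition readn (v : reads) (i : nat) : option G :=
  if insub i is Some o then v o else None.

Lemma readn_top tau S i :
  i < m -> holds tau S -> readn (scan tau) i = ohead (S`_i)%SEQ.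
Proof.
move=> im h; rewrite /readn insubT ffunE -(h (Sub i im)) /word_of_tape /=.
by case: (tape_cur _).
Qed.

(** A machine writes before it moves, so a push takes two steps. The cell to the left of the top is
    overwritten, hence garbage there is harmless. *)
Definition push (i : nat) (a : G) : frag :=
  @Frag bool true (fun s v =>
    if s then (Some false,
      [ffun j : 'I_m => (v j, if j == i :> nat then MoveLeft else Stay)])
    else (None,
      [ffun j : 'I_m => (if j == i :> nat then Some a else v j, Stay)])).

Lemma runs_push i a S :
  runs (push i a) S (set_nth [::] S i (a :: S`_i)%SEQ) 2.
Proof.
move=> tau h; eexists; exists 2; split=> //.
  apply: reach_step; first by []; apply: reach_exit; by [].
move=> j; rewrite nth_set_nth /= -(h j) /apply_acts /= !ffunE /=.
have [ji|nji] := eqVneq (val j) i; last by case: (tau j).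
by rewrite -ji -(h j); case: (tau j).
Qed.

(** On an empty stack the head must not move: [holds] says nothing about the cells beyond the first
    blank, and a move could expose them. *)
Definition pop (i : nat) : frag :=
  @Frag unit tt (fun _ v => (None,
    [ffun j : 'I_m => if (j == i :> nat) && (v j != None) then
       (None, MoveRight) else (v j, Stay)])).

Lemma runs_pop i S : runs (pop i) S (set_nth [::] S i (behead S`_i)%SEQ) 1.
Proof.
move=> tau h; eexists; exists 1; split=> //; first exact: reach_exit.
move=> j; rewrite nth_set_nth /= /apply_acts !ffunE.
case: eqP => [<-|_] /=; last by rewrite -(h j); case: (tau j).
by rewrite -(h j); case: (tau j) => l [c|] [|[d|] r].
Qed.

Definition skip : frag := @Frag unit tt (fun _ v => (None, keep v)).

Lemma runs_skip S : runs skip S S 1.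
Proof.
move=> tau h; exists (apply_acts (keep (scan tau)) tau), 1.
split=> //; first exact: reach_exit.
by move=> j; rewrite apply_keep.
Qed.

Definition seqf (F1 F2 : frag) : frag :=
  @Frag (fst_ F1 + fst_ F2)%type (inl (fentry F1)) (fun s v =>
    match s with
    | inl s1 => let: (o, act) := fdelta s1 v in
        (Some (if o is Some s' then inl s' else inr (fentry F2)), act)
    | inr s2 => let: (o, act) := fdelta s2 v in (omap inr o, act)
    end).

Lemma runs_seq F1 F2 S1 S2 S3 t1 t2 :
  runs F1 S1 S2 t1 -> runs F2 S2 S3 t2 -> runs (seqf F1 F2) S1 S3 (t1 + t2).
Proof.
move=> H1 H2 tau /H1 [tau1 [t1' [le1 r1 /H2 [tau2 [t2' [le2 r2 h2]]]]]].
exists tau2, (t1' + t2'); split=> //; first exact: leq_add.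
change (fentry (seqf F1 F2)) with (inl (fst_ F2) (fentry F1)).
elim: r1 r2 => [s ta act E r2|s ta s' act t ta' E r IH r2].
- rewrite add1n; apply: (@reach_step (seqf F1 F2) _ _ (inr (fentry F2))); first by rewrite /= E.
  elim: r2 => [s0 ta0 act0 E0|s0 ta0 s' act0 t ta' E0 r IH].
    by apply: reach_exit; rewrite /= E0.
  by apply: reach_step IH; rewrite /= E0.
- by rewrite addSn; apply: reach_step (IH r2); rewrite /= E.
Qed.

Definition casef (i : nat) (f : option G -> frag) : frag :=
  @Frag (option {g : option G & fst_ (f g)}) None (fun s v =>
    match s with
    | None => (Some (Some (Tagged (fun g => fst_ (f g))
                (fentry (f (readn v i))))), keep v)
    | Some u => let: (o, act) := fdelta (tagged u) v in
        (omap (fun s' => Some (Tagged (fun g => fst_ (f g)) s')) o, act)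
    end).

(** Tapes are functions, and a step that keeps every cell returns them only up to pointwise
    equality, so runs have to be transported along it. *)
Lemma reach_ext F (s : fst_ F) tau1 t tau1' : reach s tau1 t tau1' ->
  forall tau2, tau1 =1 tau2 -> exists2 tau2', reach s tau2 t tau2' & tau1' =1 tau2'.
Proof.
have scanE ta tb : ta =1 tb -> scan ta = scan tb.
  by move=> e; apply/ffunP => i; rewrite !ffunE e.
have applyE act ta tb : ta =1 tb -> apply_acts act ta =1 apply_acts act tb.
  by move=> e i; rewrite /apply_acts e.
elim=> {s tau1 t tau1'} [s ta act E tb e|s ta s' act t ta' E r IH tb e].
  exists (apply_acts act tb); last exact: applyE.
  by apply: reach_exit; rewrite -(scanE _ _ e).
have [tb' r' e'] := IH _ (applyE act _ _ e).
by exists tb' => //; apply: reach_step r'; rewrite -(scanE _ _ e).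
Qed.

Lemma runs_keep F (s s' : fst_ F) S S' t :
    (forall tau, holds tau S -> fdelta s (scan tau) = (Some s', keep (scan tau))) ->
    (forall tau, holds tau S ->
      exists tau' t', [/\ t' <= t, reach s' tau t' tau' & holds tau' S']) ->
  forall tau, holds tau S ->
    exists tau' t', [/\ t' <= t.+1, reach s tau t' tau' & holds tau' S'].
Proof.
move=> E H tau h.
have [tau' [t' [le r h']]] := H _ h.
have [tau2 r2 e2] := reach_ext r (fun i => esym (apply_keep tau i)).
exists tau2, t'.+1; split=> //; first exact: reach_step (E _ h) r2.
by move=> i; rewrite -e2.
Qed.

Lemma runs_case i f S S' t : i < m ->
  runs (f (ohead S`_i)%SEQ) S S' t -> runs (casef i f) S S' t.+1.
Proof.
move=> im H; apply: (@runs_keep (casef i f) None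
   (Some (Tagged (fun g => fst_ (f g)) (fentry (f (ohead S`_i)%SEQ))))).
  by move=> tau h /=; rewrite (readn_top im h).
move=> tau /H [tau' [t' [le r h']]]; exists tau', t'; split=> //.
elim: r => [s ta act E|s ta s' act t0 ta' E r IH].
  by apply: reach_exit; rewrite /= E.
by apply: reach_step IH; rewrite /= E.
Qed.

Definition whilef (i : nat) (b : pred (option G)) (F : frag) : frag :=
  @Frag (option (fst_ F)) None (fun s v =>
    match s with
    | None => (if b (readn v i) then Some (Some (fentry F)) else None, keep v)
    (* The exit [None] of the body becomes [Some None], which is the test state of the loop. *)
    | Some s1 => let: (o, act) := fdelta s1 v in (Some o, act)
    end).

Lemma runs_while_end i (b : pred (option G)) F S : i < m -> ~~ b (ohead S`_i)%SEQ ->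
  runs (whilef i b F) S S 1.
Proof.
move=> im nb tau h; exists (apply_acts (keep (scan tau)) tau), 1; split=> //.
  by apply: reach_exit => /=; rewrite (readn_top im h) (negbTE nb).
by move=> j; rewrite apply_keep.
Qed.

Lemma runs_while_step i (b : pred (option G)) F S1 S2 S3 t1 t2 : i < m -> b (ohead S1`_i)%SEQ ->
  runs F S1 S2 t1 -> runs (whilef i b F) S2 S3 t2 ->
  runs (whilef i b F) S1 S3 (t1 + t2).+1.
Proof.
move=> im bi H1 H2; apply: (@runs_keep (whilef i b F) None (Some (fentry F))).
  by move=> tau h /=; rewrite (readn_top im h) bi.
move=> tau /H1 [tau1 [t1' [le1 r1 /H2 [tau2 [t2' [le2 r2 h2]]]]]].
exists tau2, (t1' + t2'); split=> //; first exact: leq_add.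
elim: r1 r2 => [s ta act E r2|s ta s' act t ta' E r IH r2].
  by rewrite add1n; apply: reach_step r2; rewrite /= E.
by rewrite addSn; apply: reach_step (IH r2); rewrite /= E.
Qed.

End StackPrograms.

Arguments push {G m}.
Arguments pop {G m}.
Arguments skip {G m}.
Arguments casef {G m}.
Arguments whilef {G m}.

Section Compile.

Variables (A B G : finType) (m : nat) (ia : A -> G) (ib : B -> G).
Hypotheses (ia_inj : injective ia) (ib_inj : injective ib).
Variables (tin tout : 'I_m) (F : frag G m).

Definition tm_of_frag : turing_machine A B :=
  @TuringMachine A B (option (fst_ F)) G 'I_m tin tout ia ib ia_inj ib_inj
    (Some (fentry F)) (fun s => s == None)
    (fun s v => if s is Some s1 then fdelta s1 v else (None, keep v)).

Lemma reach_iter (s : fst_ F) tau t tau' : reach s tau t tau' ->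
  iter t (@step A B tm_of_frag) (@Config _ _ tm_of_frag (Some s) tau)
  = @Config _ _ tm_of_frag None tau'.
Proof.
elim=> {s tau t tau'} [s ta act E|s ta s' act t ta' E r IH].
  by rewrite /= /step /= -/(scan ta) E.
by rewrite iterSr {2}/step /= -/(scan ta) E.
Qed.

Lemma halted_iter n tau :
  iter n (@step A B tm_of_frag) (@Config _ _ tm_of_frag None tau)
  = @Config _ _ tm_of_frag None tau.
Proof. by elim: n => //= n ->. Qed.

(** [polytime] looks at one exact time; since halting configurations are fixed points, an upper
    bound on the running time is enough. *)
Lemma polytime_of_frag (f : seq A -> seq B) (p : {poly nat}) :
    (forall x, exists (S S' : store G) t,
       [/\ forall i : 'I_m, nth [::] S i = if i == tin then map ia x else [::],
           runs F S S' t, t <= p.[size x]%R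
         & nth [::] S' tout = map ib (f x)]) ->
  polytime f.
Proof.
move=> H; exists tm_of_frag, p => x.
have [S [S' [t [hS hr le hout]]]] := H x.
have h0 : holds (fun i => tape_of_word (if i == tin then map ia x else [::])) S.
  move=> i; rewrite hS; case: (i == tin) => //.
  case: x {H hS le hout} => //= a x; rewrite /word_of_tape /=; congr (_ :: _).
  by elim: x => //= b x ->.
have [tau' [t' [le' r h]]] := hr _ h0.
have E : iter p.[size x]%R (@step A B tm_of_frag) (@init_config A B tm_of_frag x)
  = @Config _ _ tm_of_frag None tau'.
  have -> : p.[size x]%R = (p.[size x]%R - t') + t' by lia.
  by rewrite iterD (reach_iter r) halted_iter.
by rewrite /outputs_within E /=; split=> //; rewrite h hout.
Qed.

End Compile.


Ltac stacks :=
  repeat (rewrite ?nth_set_nth /=;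
    match goal with |- context [@eq_op _ ?a ?b] =>
      case: (@eqP _ a b) => ?; [try (exfalso; congruence)|]; subst end);
  rewrite ?nth_set_nth /=; try done; try (exfalso; congruence).

(** * A library of stack programs *)

Section Library.

Variables (G : finType) (m : nat).
Notation store := (seq (seq G)).
Notation "S `_ i" := (nth [::] S i) : seq_scope.
Notation "F1 ;; F2" := (seqf F1 F2) (at level 65, right associativity).
Implicit Types (S : store) (i j k t u : nat).

(** Updates with [set_nth] may leave trailing empty stacks and nested terms, so stores are compared
    stack by stack. *)
Lemma runs_nth (F : frag G m) S1 S2 S1' S2' t :
    (forall x, (S1`_x)%SEQ = (S2`_x)%SEQ) ->
    (forall x, (S1'`_x)%SEQ = (S2'`_x)%SEQ) ->
  runs F S1 S1' t -> runs F S2 S2' t.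
Proof.
move=> e e' H tau h; have [|tau' [t' [le r h']]] := H tau.
  by move=> i; rewrite h e.
by exists tau', t'; split=> // i; rewrite h' e'.
Qed.

Lemma runs_to (F : frag G m) S S1 S2 t t' :
    runs F S S1 t -> (forall x, (S1`_x)%SEQ = (S2`_x)%SEQ) -> t <= t' ->
  runs F S S2 t'.
Proof. by move=> H e le; apply: runs_le le; apply: runs_nth H. Qed.

Definition forf i (f : G -> frag G m) : frag G m :=
  whilef i isSome (casef i (fun o => if o is Some g then pop i ;; f g else skip)).

(** [Inv d r] is the store once the letters [d] are consumed and [r] remain. The 3 extra steps per
    letter are the loop test, the branching and the [pop]. *)
Lemma runs_for i f (Inv : seq G -> seq G -> store) l tb : i < m ->
    (forall d r, l = d ++ r -> ((Inv d r)`_i)%SEQ = r) ->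
    (forall d g r, l = d ++ g :: r ->
      runs (f g) (set_nth [::] (Inv d (g :: r)) i r) (Inv (rcons d g) r) tb) ->
  runs (forf i f) (Inv [::] l) (Inv l [::]) (size l * (tb + 3) + 1).
Proof.
move=> im Ii H.
suff: forall d r, l = d ++ r ->
    runs (forf i f) (Inv d r) (Inv l [::]) (size r * (tb + 3) + 1).
  by move=> /(_ [::] l erefl).
move=> d r; elim: r d => [|g r IH] d E.
  rewrite E cats0 in Ii *; apply: runs_while_end => //.
  by rewrite Ii // cats0.
have Eg := Ii _ _ E.
apply: (@runs_le _ _ _ _ _ ((1 + tb).+1 + (size r * (tb + 3) + 1)).+1); last first.
  by rewrite /=; nia.
apply: (runs_while_step (S2 := Inv (rcons d g) r)) => //; first by rewrite Eg.
- apply: runs_case => //; rewrite Eg /=; apply: runs_seq (H _ _ _ E).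
  by apply: runs_to; [exact: runs_pop| |exact: leqnn] => x; rewrite Eg.
- by apply: IH; rewrite cat_rcons.
Qed.

Lemma runs_for_store i (f : G -> frag G m) S (St : seq G -> store) tb : i < m ->
    (forall x, S`_x = if x == i then S`_i else (St [::])`_x)%SEQ ->
    (forall d g r, (S`_i)%SEQ = d ++ g :: r ->
       runs (f g) (set_nth [::] (St d) i r) (set_nth [::] (St (rcons d g)) i r) tb) ->
  runs (forf i f) S (set_nth [::] (St (S`_i)%SEQ) i [::])
    (size (S`_i)%SEQ * (tb + 3) + 1).
Proof.
move=> im E H.
pose Inv d r := set_nth [::] (St d) i r.
have H1 d r : (S`_i)%SEQ = d ++ r -> ((Inv d r)`_i)%SEQ = r.
  by rewrite nth_set_nth /= eqxx.
have H2 d g r : (S`_i)%SEQ = d ++ g :: r ->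
    runs (f g) (set_nth [::] (Inv d (g :: r)) i r) (Inv (rcons d g) r) tb.
  move=> /H; apply: runs_nth => x //.
  by rewrite !nth_set_nth /= !nth_set_nth /=; case: eqP.
apply: runs_nth (runs_for im H1 H2) => x //.
by rewrite nth_set_nth /= [RHS]E; case: eqP.
Qed.

Definition mov i j : frag G m := forf i (push j).

Lemma runs_mov i j S : i < m -> i <> j ->
  runs (mov i j) S
    (set_nth [::] (set_nth [::] S j (rev (S`_i)%SEQ ++ (S`_j)%SEQ)) i [::])
    (5 * size (S`_i)%SEQ + 1).
Proof.
move=> im ij; rewrite mulnC.
apply: (@runs_for_store i _ S (fun d => set_nth [::] S j (rev d ++ (S`_j)%SEQ)) 2) => //.
  by move=> x; stacks.
move=> d g r e; apply: runs_to; [exact: runs_push| |exact: leqnn] => x.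
by rewrite rev_rcons; stacks.
Qed.

(** The detour through [t] reverses twice, so both stacks end in the original order. *)
Definition copyf (f : G -> G) i j t : frag G m :=
  mov i t ;; forf t (fun g => push i g ;; push j (f g)).

Lemma runs_copyf f i j t S : i < m -> j < m -> t < m -> uniq [:: i; j; t] ->
  (S`_t)%SEQ = [::] ->
  runs (copyf f i j t) S (set_nth [::] S j (map f (S`_i)%SEQ ++ (S`_j)%SEQ))
    (12 * size (S`_i)%SEQ + 2).
Proof.
move=> im jm tm; rewrite /= !inE andbT negb_or.
case/andP=> /andP[/eqP ij /eqP it] /eqP jt t0.
set l := (S`_i)%SEQ.
pose S1 := set_nth [::] (set_nth [::] S t (rev l)) i [::].
have l1 : (S1`_t)%SEQ = rev l by rewrite /S1; stacks.
apply: (@runs_le _ _ _ _ _ ((5 * size l + 1) + (size (rev l) * (4 + 3) + 1))); last first.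
  by rewrite size_rev; lia.
apply: (@runs_seq _ _ _ _ _ S1).
  by have := @runs_mov i t S im it; rewrite t0 cats0.
pose St d := set_nth [::] (set_nth [::] S i (rev d)) j (map f (rev d) ++ (S`_j)%SEQ).
have H1 x : (S1`_x = if x == t then S1`_t else (St [::])`_x)%SEQ.
  by rewrite /S1 /St; stacks.
have H2 d g r : (S1`_t)%SEQ = d ++ g :: r ->
    runs (push i g ;; push j (f g) : frag G m) (set_nth [::] (St d) t r)
      (set_nth [::] (St (rcons d g)) t r) 4.
  move=> _; apply: (@runs_seq _ _ _ _ _ _ _ 2 2); first exact: runs_push.
  apply: (runs_to (@runs_push _ _ _ _ _)) => // x.
  by rewrite /St !rev_rcons; stacks.
have := runs_for_store tm H1 H2; rewrite l1 => H.
by apply: runs_nth H => x //; rewrite /St revK; stacks.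
Qed.

Definition copy := copyf id.

Lemma runs_copy i j t S : i < m -> j < m -> t < m -> uniq [:: i; j; t] ->
  (S`_t)%SEQ = [::] ->
  runs (copy i j t) S (set_nth [::] S j ((S`_i)%SEQ ++ (S`_j)%SEQ))
    (12 * size (S`_i)%SEQ + 2).
Proof. by move=> im jm tm U t0; have := runs_copyf id im jm tm U t0; rewrite map_id. Qed.

(* A number [n] is held in unary, as [nseq n one]. *)
Variable one : G.

Definition mulf i j k t : frag G m := forf i (fun _ => copy j k t).

Lemma runs_mul i j k t S b : i < m -> j < m -> k < m -> t < m ->
    uniq [:: i; j; k; t] -> (S`_j)%SEQ = nseq b one -> (S`_t)%SEQ = [::] ->
  runs (mulf i j k t) S
    (set_nth [::] (set_nth [::] S k
       (nseq (size (S`_i)%SEQ * b) one ++ (S`_k)%SEQ)) i [::])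
    (size (S`_i)%SEQ * (12 * b + 5) + 1).
Proof.
move=> im jm km tm U Sj St0.
have Ujkt : uniq [:: j; k; t] by case/andP: U.
move: U; rewrite /= !inE !andbT !negb_or.
case/and3P=> /and3P[/eqP ij /eqP ik /eqP it] /andP[/eqP jk /eqP jt] /eqP kt.
pose St (d : seq G) := set_nth [::] S k (nseq (size d * b) one ++ (S`_k)%SEQ).
have H1 x : (S`_x = if x == i then S`_i else (St [::])`_x)%SEQ.
  by rewrite /St; stacks.
apply: runs_le (runs_for_store (St := St) (tb := 12 * b + 2) im H1 _) _; last by lia.
move=> d g r _.
have E1 : nth [::] (set_nth [::] (St d) i r) j = nseq b one by rewrite /St; stacks.
have E2 : nth [::] (set_nth [::] (St d) i r) t = [::] by rewrite /St; stacks.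
have := runs_copy jm km tm Ujkt E2; rewrite E1 size_nseq => H.
apply: (runs_to H) => // x; rewrite /St size_rcons mulSn.
rewrite nseqD.
by stacks; rewrite catA.
Qed.

Definition repf (n : nat) (F : frag G m) : frag G m := iter n (seqf F) skip.

Lemma runs_pushes i a n S :
  runs (repf n (push i a)) S (set_nth [::] S i (nseq n a ++ (S`_i)%SEQ)) (2 * n + 1).
Proof.
elim: n S => [|n IH] S /=.
  by apply: (runs_to (@runs_skip _ _ _)) => // x; stacks.
apply: (@runs_le _ _ _ _ _ (2 + (2 * n + 1))); last by lia.
apply: runs_seq; first exact: runs_push.
apply: (runs_to (IH _)) => // x; stacks.
by rewrite -cat1s catA -[[:: a]]/(nseq 1 a) -nseqD addn1.
Qed.

Fixpoint hornerf (s : seq nat) k j t u : frag G m :=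
  if s is c :: s' then
    hornerf s' k j t u ;; mov k u ;; mulf u j k t ;; repf c (push k one)
  else skip.

(** The running time follows the recursion of the program instead of a closed form, because only its
    being a polynomial in [b] matters. *)
Fixpoint hornert (s : seq nat) (b : nat) : nat :=
  if s is c :: s' then
    hornert s' b + (5 * horner_rec s' b + 1
      + (horner_rec s' b * (12 * b + 5) + 1 + (2 * c + 1)))
  else 1.

Lemma runs_horner s k j t u S b : k < m -> j < m -> t < m -> u < m ->
    uniq [:: k; j; t; u] -> (S`_j)%SEQ = nseq b one ->
    (S`_k)%SEQ = [::] -> (S`_t)%SEQ = [::] -> (S`_u)%SEQ = [::] ->
  runs (hornerf s k j t u) S (set_nth [::] S k (nseq (horner_rec s b) one))
    (hornert s b).
Proof.
move=> km jm tm um U Sj Sk St Su; elim: s => [|c s IH] /=.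
  by apply: (runs_to (@runs_skip _ _ _)) => // x; stacks.
move: (U); rewrite /= !inE !andbT !negb_or.
case/and3P=> /and3P[/eqP kj /eqP kt /eqP ku] /andP[/eqP jt /eqP ju] /eqP tu.
set v := horner_rec s b in IH *.
apply: runs_seq IH _.
have := @runs_mov k u (set_nth [::] S k (nseq v one)) km ku.
rewrite !nth_set_nth /= eqxx size_nseq; set S1 := set_nth _ _ k [::] => Hmov.
apply: runs_seq Hmov _.
have E1 : nth [::] S1 j = nseq b one by rewrite /S1; stacks.
have E2 : nth [::] S1 t = [::] by rewrite /S1; stacks.
have E3 : nth [::] S1 u = nseq v one.
  by rewrite /S1 rev_nseq; stacks; rewrite Su cats0.
have U' : uniq [:: u; j; k; t].
  by rewrite /= !inE !negb_or !andbT; apply/andP; split; [|apply/andP; split];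
     rewrite ?andbA; do ?[apply/andP; split]; apply/eqP; congruence.
have := runs_mul um jm km tm U' E1 E2; rewrite E3 size_nseq => H.
apply: runs_seq H _.
apply: (runs_to (@runs_pushes _ _ _ _)) => // x.
rewrite /S1 rev_nseq; stacks.
by rewrite cats0 -nseqD addnC.
Qed.


Variable bt : bool -> G.
Hypothesis bt_inj : injective bt.

(** One program for both directions: [x = true] adds one, [x = false] subtracts one. A run of digits
    [x] is flipped and parked in [t], and the first other digit absorbs the carry. [e] handles its
    absence: a new leading digit for the increment, a failure mark for the decrement. *)
Definition carryf (x : bool) i t (e : frag G m) : frag G m :=
  whilef i (fun o => o == Some (bt x)) (pop i ;; push t (bt (~~ x))) ;;
  casef i (fun o => if o is Some _ then pop i ;; push i (bt x) else e) ;;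
  mov t i.

Fixpoint carry (x : bool) (e b : seq bool) : seq bool :=
  if b is y :: b' then if y == x then ~~ x :: carry x e b' else x :: b' else e.

Lemma carry_all x e b : all (pred1 x) b -> carry x e b = nseq (size b) (~~ x) ++ e.
Proof. by elim: b => //= y b IH /andP[-> /IH ->]. Qed.

Lemma carry_split x b : ~~ all (pred1 x) b ->
  exists n b', [/\ b = nseq n x ++ ~~ x :: b', n < size b
    & forall e, carry x e b = nseq n (~~ x) ++ x :: b'].
Proof.
elim: b => //= y b IH; rewrite negb_and.
case: (eqVneq y x) => [-> /= /IH [n [b' [-> lt E]]]|yx _].
  by exists n.+1, b'; split=> //= e; rewrite E.
by exists 0, b; split=> //; congr (_ :: _); case: (y) (x) yx => [] [].
Qed.

Lemma runs_carry_loop x i t S n r : i < m -> i <> t ->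
    (S`_i)%SEQ = map bt (nseq n x ++ r) -> ohead r != Some x ->
  runs (whilef i (fun o => o == Some (bt x)) (pop i ;; push t (bt (~~ x))) : frag G m) S
    (set_nth [::] (set_nth [::] S t (nseq n (bt (~~ x)) ++ (S`_t)%SEQ)) i (map bt r))
    (4 * n + 1).
Proof.
move=> im it; elim: n S => [|n IH] S Si nr.
  apply: runs_to; first apply: runs_while_end => //; rewrite ?Si /=.
  - case: r nr {Si} => //= y r; apply: contra => /eqP [] /bt_inj ->.
    by rewrite eqxx.
  - by move=> y; stacks.
  - by [].
apply: (@runs_le _ _ _ _ _ ((1 + 2) + (4 * n + 1)).+1); last by lia.
apply: runs_while_step => //; first by rewrite Si.
  apply: runs_seq; [exact: runs_pop|exact: runs_push].
rewrite Si /=; set S1 := set_nth _ (set_nth _ _ _ _) t _.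
have E1 : (S1`_i)%SEQ = map bt (nseq n x ++ r) by rewrite /S1; stacks.
apply: (runs_to (IH _ E1 nr)) => // y; rewrite /S1; stacks.
by rewrite -cat1s catA -[[:: _]]/(nseq 1 _) -nseqD addn1.
Qed.

Lemma runs_carry_some x i t e S b : i < m -> t < m -> i <> t ->
    (S`_i)%SEQ = map bt b -> (S`_t)%SEQ = [::] -> ~~ all (pred1 x) b ->
  runs (carryf x i t e) S (set_nth [::] S i (map bt (carry x [::] b)))
    (9 * size b + 10).
Proof.
move=> im tm it Si St nall; have [n [b' [E lt ->]]] := carry_split nall.
have ti : t <> i by congruence.
have nr : ohead (~~ x :: b') != Some x by case: (x).
rewrite E in Si; have := runs_carry_loop im it Si nr.
rewrite St cats0; set S1 := set_nth _ (set_nth _ _ _ _) i _ => H1.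
apply: (@runs_le _ _ _ _ _ ((4 * n + 1) + ((1 + 2).+1 + (5 * n + 1)))); last by move: (size b) lt => sb lt; lia.
apply: (runs_seq H1); apply: runs_seq.
  apply: runs_case => //; rewrite /S1 nth_set_nth /= eqxx.
  apply: runs_seq; [exact: runs_pop|exact: runs_push].
set S2 := set_nth _ (set_nth _ _ _ _) i _.
have E2 : (S2`_t)%SEQ = nseq n (bt (~~ x)) by rewrite /S2 /S1; stacks.
have := @runs_mov t i S2 tm ti; rewrite E2 size_nseq => H.
apply: (runs_to H) => // y; rewrite rev_nseq /S2 /S1; stacks.
by rewrite map_cat map_nseq.
Qed.

Lemma runs_carry_none x i t j a S b : i < m -> t < m -> i <> t -> j <> t ->
    (S`_i)%SEQ = map bt b -> (S`_t)%SEQ = [::] -> all (pred1 x) b ->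
  runs (carryf x i t (push j a)) S
    (let S1 := set_nth [::] S i [::] in
     let S2 := set_nth [::] S1 j (a :: (S1`_j)%SEQ) in
     set_nth [::] S2 i (nseq (size b) (bt (~~ x)) ++ (S2`_i)%SEQ))
    (9 * size b + 10).
Proof.
move=> im tm it jt Si St hall; have ti : t <> i by congruence.
have nr : ohead (Nil bool) != Some x by [].
have E : b = nseq (size b) x.
  by elim: b hall {Si} => //= y b IH /andP[/eqP-> /IH <-].
rewrite E -[nseq _ _]cats0 in Si; have := runs_carry_loop im it Si nr.
rewrite St cats0; set S1 := set_nth _ (set_nth _ _ _ _) i _ => H1.
apply: (@runs_le _ _ _ _ _ ((4 * size b + 1) + (2.+1 + (5 * size b + 1)))); last by lia.
apply: (runs_seq H1); apply: runs_seq.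
  apply: runs_case => //; rewrite /S1 nth_set_nth /= eqxx; exact: runs_push.
set S2 := set_nth _ _ j _.
have E2 : (S2`_t)%SEQ = nseq (size b) (bt (~~ x)) by rewrite /S2 /S1; stacks.
have := @runs_mov t i S2 tm ti; rewrite E2 size_nseq => H.
by apply: (runs_to H) => // y; rewrite rev_nseq /S2 /S1; stacks.
Qed.

Definition incf i t : frag G m := carryf true i t (push i (bt true)).
Definition incb := carry true [:: true].

Lemma runs_inc i t S b : i < m -> t < m -> i <> t ->
    (S`_i)%SEQ = map bt b -> (S`_t)%SEQ = [::] ->
  runs (incf i t) S (set_nth [::] S i (map bt (incb b))) (9 * size b + 10).
Proof.
move=> im tm it Si St; case: (boolP (all (pred1 true) b)) => [al|nal]; last first.
  apply: (runs_to (runs_carry_some _ _ _ _ Si St nal)) => // y; rewrite /incb.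
  by have [n [b' [_ _ E]]] := carry_split nal; rewrite !E.
apply: (runs_to (runs_carry_none _ _ _ _ _ Si St al)) => // y /=.
by rewrite /incb carry_all // map_cat map_nseq /=; stacks.
Qed.

(** The number of digits never changes: leading zeros stay, and zero becomes all ones while the mark
    on [j] records the underflow. *)
Definition decf i t j : frag G m := carryf false i t (push j one).
Definition decb := carry false [::].

Lemma runs_dec i t j S b : i < m -> t < m -> i <> t -> j <> t -> i <> j ->
    (S`_i)%SEQ = map bt b -> (S`_t)%SEQ = [::] ->
  runs (decf i t j) S
    (set_nth [::] (set_nth [::] S j (nseq (all (pred1 false) b) one ++ (S`_j)%SEQ))
       i (map bt (decb b))) (9 * size b + 10).
Proof.
move=> im tm it jt ij Si St.
case: (boolP (all (pred1 false) b)) => [al|nal]; last first.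
  apply: (runs_to (runs_carry_some _ _ _ _ Si St nal)) => // y; rewrite /decb.
  by have [n [b' [_ _ E]]] := carry_split nal; rewrite !E; stacks.
apply: (runs_to (runs_carry_none _ _ _ _ _ Si St al)) => // y /=.
by rewrite /decb carry_all // map_cat map_nseq /=; stacks.
Qed.

End Library.

Arguments forf {G m}.
Arguments mov {G m}.
Arguments copyf {G m}.
Arguments copy {G m}.
Arguments mulf {G m}.
Arguments repf {G m}.
Arguments hornerf {G m}.
Arguments incf {G m}.
Arguments decf {G m}.

(** * Functions given by polynomials *)

Definition ispoly (f : nat -> nat) := exists p : {poly nat}, forall n, f n = p.[n]%R.

Lemma ispoly_const c : ispoly (fun _ => c).
Proof. by exists (c%:P)%R => n; rewrite hornerC. Qed.

Lemma ispoly_id : ispoly id.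
Proof. by exists 'X%R => n; rewrite hornerX. Qed.

Lemma ispoly_add f g : ispoly f -> ispoly g -> ispoly (fun n => f n + g n).
Proof. by case=> p Hp [q Hq]; exists (p + q)%R => n; rewrite hornerD Hp Hq. Qed.

Lemma ispoly_mul f g : ispoly f -> ispoly g -> ispoly (fun n => f n * g n).
Proof. by case=> p Hp [q Hq]; exists (p * q)%R => n; rewrite hornerM Hp Hq. Qed.

Lemma ispoly_horner (p : {poly nat}) f : ispoly f -> ispoly (fun n => p.[f n]%R).
Proof. by case=> q Hq; exists (p \Po q)%R => n; rewrite horner_comp Hq. Qed.

Lemma ispoly_succ f : ispoly f -> ispoly (fun n => (f n).+1).
Proof.
move=> H; have [p Hp] := ispoly_add (ispoly_const 1) H.
by exists p => n; rewrite -Hp.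
Qed.

Lemma ispoly_hornert s f : ispoly f -> ispoly (fun n => hornert s (f n)).
Proof.
have rec s' g : ispoly g -> ispoly (fun n => horner_rec s' (g n)).
  move=> Hg; elim: s' => [|c s' IH] /=; first exact: ispoly_const.
  exact: ispoly_add (ispoly_mul IH Hg) (ispoly_const c).
move=> Hf; elim: s => [|c s IH] /=; first exact: ispoly_const.
by do ![apply: ispoly_add|apply: ispoly_mul|apply: rec|exact: ispoly_const].
Qed.

Lemma horner_leq (p : {poly nat}) a b : a <= b -> p.[a]%R <= p.[b]%R.
Proof.
move=> ab; rewrite /horner; elim: (polyseq p) => //= c s IH.
by apply: leq_add => //; apply: leq_mul.
Qed.


(** * Canonical binary words *)

Fixpoint bval (b : seq bool) : nat := if b is x :: b' then x + (bval b').*2 else 0.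

(** No leading zero. The default [true] makes the empty word, which is the code of 0, canonical. *)
Definition canonical (b : seq bool) := last true b.

Lemma canonical_cons x b : canonical (x :: b) -> canonical b.
Proof. by rewrite /canonical /=; case: b. Qed.

Lemma bval_lt b : bval b < 2 ^ size b.
Proof. by elim: b => // x b IH /=; rewrite expnS; case: x; lia. Qed.

Lemma bval_ge b : b != [::] -> canonical b -> 2 ^ (size b).-1 <= bval b.
Proof.
elim: b => // x [|y b] IH _ cb; first by rewrite /canonical /= in cb; rewrite cb.
have := IH isT (canonical_cons cb); rewrite [bval (x :: _)]/= -/(bval (y :: b)).
by rewrite [size (x :: _)]/= [size (y :: b)]/= expnS /=; lia.
Qed.

Lemma bval_bit b e : odd (bval b %/ 2 ^ e) = nth false b e.
Proof.
elim: b e => [|x b IH] [|e] /=; rewrite ?expn0 ?divn1 ?div0n //.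
  by rewrite oddD odd_double addbF; case: x.
by rewrite expnS divnMA -IH divn2 halfD odd_double andbF add0n doubleK; case: x.
Qed.

Lemma binary_bval b : canonical b -> binary (bval b) = b.
Proof.
move=> cb; have sz : up_log 2 (bval b).+1 = size b.
  case: (altP (b =P [::])) => [->//|nb].
  apply/eqP; rewrite eqn_leq up_log_min ?bval_lt //=.
  have lt : 2 ^ (size b).-1 < (bval b).+1 by rewrite ltnS bval_ge.
  have le := up_logP (bval b).+1 (isT : 1 < 2).
  have := leq_trans lt le; rewrite ltn_exp2l //.
  by case: (b) nb => // x b' _ /=.
rewrite /binary sz; apply: (@eq_from_nth _ false); first by rewrite size_map size_iota.
move=> e; rewrite size_map size_iota => le.
by rewrite (nth_map 0) ?size_iota // nth_iota // bval_bit.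
Qed.

Lemma bval_binary n : bval (binary n) = n.
Proof.
rewrite /binary; have := up_logP n.+1 (isT : 1 < 2).
move: (up_log 2 n.+1) => l; rewrite ltnNge; elim: l n => [|l IH] n; first by case: n.
rewrite /= expn0 divn1 -/(iota 1 l) (iotaDl 1 0) -map_comp => H.
rewrite -[RHS]odd_double_half; congr (_ + _.*2); rewrite -[RHS]IH.
  by congr bval; apply: eq_map => e /=; rewrite add1n expnS divnMA divn2.
by rewrite expnS in H; lia.
Qed.

Lemma canonical_binary n : canonical (binary n).
Proof.
have := bval_binary n; set b := binary n => E.
have [->//|nb] := eqVneq b [::].
have sz : size b = up_log 2 n.+1 by rewrite size_map size_iota.
have n0 : 0 < n by rewrite lt0n; apply: contra nb; rewrite /b => /eqP->.
have /andP[lt _] := up_log_bounds (isT : 1 < 2) (n0 : 1 < n.+1).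
rewrite -sz -E in lt.
case/lastP: b nb {E sz} lt => // b x _; rewrite size_rcons /canonical last_rcons /= ltnS.
case: x => //; suff -> : bval (rcons b false) = bval b by have := bval_lt b; lia.
by elim: b => //= y b ->.
Qed.

Lemma bval_carry_inc b : bval (carry true [:: true] b) = (bval b).+1.
Proof. by elim: b => // [[] b IH] //=; rewrite IH; lia. Qed.

Lemma binary_succ n : binary n.+1 = incb (binary n).
Proof.
rewrite -[in LHS](bval_binary n) -bval_carry_inc binary_bval //.
elim: (binary n) (canonical_binary n) => // x b IH /[dup] cb /canonical_cons /IH.
rewrite /canonical; case: x cb => [_|/canonical_cons //] /=.
by case: b {IH} => [|[] b].
Qed.

Lemma bval_eq0 b : (bval b == 0) = all (pred1 false) b.
Proof. by elim: b => // [[] b IH] //=; rewrite -IH; lia. Qed.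

Lemma bval_dec b : bval (decb b) = (bval b).-1 \/ bval b = 0.
Proof.
case: (altP (bval b =P 0)) => [|n0]; [by right|left; move: n0].
elim: b => // [[] b IH] //= nz; rewrite -/(decb b) IH; lia.
Qed.

(** * The code of a list of numbers, and its local characterization *)

Definition enc (ns : seq nat) : seq (option bool) :=
  flatten [seq rcons (map Some (binary n)) None | n <- ns].

Lemma encodeE T p : encode T p = enc (p :: T). Proof. by []. Qed.

Lemma enc_cons n ns : enc (n :: ns) = map Some (binary n) ++ None :: enc ns.
Proof. by rewrite /enc /= cat_rcons. Qed.

(** Only neighbouring symbols are inspected, so that a machine can check this while moving the word
    from one stack to another. *)
Fixpoint wellformed (w : seq (option bool)) : bool :=
  if w is g :: w' then
    wellformed w' && match w' with
      | [::] => g == None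
      | None :: _ => g != Some false
      | _ => true
      end
  else true.

Lemma wellformed_cons g w : wellformed (g :: w) =
  wellformed w && match w with
      | [::] => g == None
      | None :: _ => g != Some false
      | _ => true
      end.
Proof. by []. Qed.

Lemma wellformed_enc ns : wellformed (enc ns).
Proof.
elim: ns => // n ns IH; rewrite enc_cons.
have := canonical_binary n; elim: (binary n) => [_|x b IHb cb].
  by rewrite cat0s wellformed_cons IH; case: (enc ns) => // [[]].
rewrite cat_cons wellformed_cons (IHb (canonical_cons cb)).
by case: b cb {IHb} => //=; case: (x).
Qed.

(** The first number is kept as a list of digits, so that one more digit in front is an induction
    step. *)
Lemma wellformedP w : wellformed w -> w = [::] \/
  exists b ns, canonical b /\ w = map Some b ++ None :: enc ns.
Proof.
elim: w => [|g w IH]; [by left|rewrite wellformed_cons => /andP[/IH {}IH H]; right].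
case: IH H => [-> /eqP ->|[b [ns [cb E]]] H]; first by exists [::], [::].
case: g H => [x|] H; last first.
  by exists [::], (bval b :: ns); rewrite E enc_cons binary_bval.
exists (x :: b), ns; rewrite E; split=> //.
by move: H cb; rewrite E /canonical; case: b {E} => //=; case: x.
Qed.

Lemma wellformed_encode w : wellformed w && (w != [::]) <->
  exists T p, w = encode T p.
Proof.
split=> [/andP[/wellformedP [->//|[b [ns [cb ->]]]] _]|[T [p ->]]].
  by exists ns, (bval b); rewrite encodeE enc_cons binary_bval.
by rewrite encodeE wellformed_enc enc_cons; case: (binary p).
Qed.

Lemma map_Some_None_inj b b' (w w' : seq (option bool)) :
  map Some b ++ None :: w = map Some b' ++ None :: w' -> b = b' /\ w = w'.
Proof.
elim: b b' => [|x b IH] [|y b'] //=; first by case.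
by case=> -> /IH [-> ->].
Qed.

Lemma encode_inj T p T' p' : encode T p = encode T' p' -> T = T' /\ p = p'.
Proof.
have binj : injective binary by apply: can_inj bval_binary.
have encI ns ns' : enc ns = enc ns' -> ns = ns'.
  elim: ns ns' => [|n ns IH] [|n' ns'] //; rewrite ?enc_cons; try by case: (binary _).
  by case/map_Some_None_inj => /binj -> /IH ->.
by move=> /encI [-> ->].
Qed.

(** * Attractors as masks *)

(** Beyond the end of the mask the default [false] applies, so a certificate of any length is a
    mask. *)
Definition hit (k : nat) (m : seq bool) (i : nat) :=
  exists2 j, i <= j < i + k & nth false m j.

Definition mask_attractor (T : Type) (k : nat) (S : seq T) (m : seq bool) :=
  forall i, i + k <= size S -> exists i',
    [/\ i' + k <= size S, take k (drop i' S) = take k (drop i S) & hit k m i'].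

Lemma substringE (T : Type) (S : seq T) i k :
  0 < k -> substring S i (i + k).-1 = take k (drop i S).
Proof.
move=> k0; rewrite /substring take_drop.
by have -> : (i + k).-1.+1 = k + i by lia.
Qed.

Lemma sharp_attractor_mask (T : eqType) k (S : seq T) (p : nat) : 0 < k ->
  (exists Gamma : {set 'I_(size S)}, sharp_attractor k Gamma /\ #|Gamma| <= p) <->
  (exists m, [/\ size m <= size S, count id m <= p & mask_attractor k S m]).
Proof.
move=> k0; split=> [[Gamma [HG le]]|[m [szm le H]]].
- pose m := [seq i \in Gamma | i <- enum 'I_(size S)].
  have szm : size m = size S by rewrite size_map size_enum_ord.
  have mE (i : 'I_(size S)) : nth false m i = (i \in Gamma).
    by rewrite (nth_map i) ?size_enum_ord // nth_ord_enum.
  exists m; split; first by rewrite szm.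
    by rewrite count_map -sum1_count big_enum_cond /= sum1_card.
  move=> i ik; have [||i' [j' [/andP[ij' j'S] E [g gG /andP[ig gj]]]]] :=
    HG i (i + k).-1; [lia|lia|].
  have ik' : j' = (i' + k).-1.
    have := congr1 size E; rewrite substringE // size_takel ?size_drop; last by lia.
    by rewrite size_takel //; lia.
  exists i'; split; first by lia.
    by rewrite -!substringE // -E ik'.
  by exists g; [lia|rewrite mE].
- pose Gamma := [set i : 'I_(size S) | nth false m i].
  exists Gamma; split.
    move=> i j /andP[ij jS] jk; have := H i; case; first by lia.
    move=> i' [i'k E [g gi gm]]; exists i', (i' + k).-1; split; first by lia.
      have -> : j = (i + k).-1 by lia.
      by rewrite !substringE.
    have gS : g < size S by lia.
    by exists (Ordinal gS); [rewrite inE|rewrite /=; lia].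
  apply: leq_trans le; rewrite -sum1dep_card -sum1_count (big_nth false).
  rewrite -(big_mkord (fun i => nth false m i) (fun _ => 1)).
  rewrite (big_cat_nat (leq0n _) szm) /= [X in _ + X]big_nat_cond.
  rewrite [X in _ + X]big_pred0 ?addn0 // => i.
  by case: (leqP (size m) i) => //= mi; rewrite nth_default // andbF.
Qed.


(** * Blocks *)

Section Concat.

Variables (X : Type) (x0 : X) (F : nat -> nat -> X) (len : nat -> nat).

Definition concat r := flatten (mkseq (fun b => mkseq (F b) (len b)) r).
Definition offset b := \sum_(i < b) len i.

Lemma offsetS b : offset b.+1 = offset b + len b.
Proof. by rewrite /offset big_ord_recr. Qed.

Lemma concatS r : concat r.+1 = concat r ++ mkseq (F r) (len r).
Proof. by rewrite /concat mkseqS -cats1 flatten_cat /= cats0. Qed.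

Lemma size_concat r : size (concat r) = offset r.
Proof.
elim: r => [|r IH]; first by rewrite /offset big_ord0.
by rewrite concatS size_cat size_mkseq IH offsetS.
Qed.

Lemma nth_concat rest r b y : b < r -> y < len b ->
  nth x0 (concat r ++ rest) (offset b + y) = F b y.
Proof.
elim: r rest => // r IH rest; rewrite concatS -catA ltnS leq_eqVlt.
case/predU1P => [->|br] yl; last exact: IH.
rewrite nth_cat size_concat ifF; last by apply/negbTE; rewrite -leqNgt leq_addr.
by rewrite addKn nth_cat size_mkseq yl nth_mkseq.
Qed.

Lemma nth_concat_rest rest r y :
  nth x0 (concat r ++ rest) (offset r + y) = nth x0 rest y.
Proof.
rewrite nth_cat size_concat ifF ?addKn //.
by apply/negbTE; rewrite -leqNgt leq_addr.
Qed.

Lemma offset_locate r i : i < offset r ->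
  exists b y, [/\ b < r, y < len b & i = offset b + y].
Proof.
elim: r => [|r IH]; first by rewrite /offset big_ord0.
rewrite offsetS => ir; case: (ltnP i (offset r)) => [/IH [b [y [br yl ->]]]|le].
  by exists b, y; split=> //; apply: ltnW.
by exists r, (i - offset r); split; lia.
Qed.

Lemma offset_leq b b' : b <= b' -> offset b <= offset b'.
Proof.
move/subnKC <-; elim: (b' - b) => [|d IH]; first by rewrite addn0.
by rewrite addnS offsetS (leq_trans IH) ?leq_addr.
Qed.

End Concat.

Lemma row_inj k i i' x x' : x < k -> x' < k ->
  k * i + x = k * i' + x' -> i = i' /\ x = x'.
Proof.
move=> xk xk' E; have k0 : 0 < k by lia.
have := congr1 (divn^~ k) E; have := congr1 (modn^~ k) E.
by rewrite /= ![k * _]mulnC !modnMDl !divnMDl // !modn_small // !divn_small // !addn0.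
Qed.

Section PrefixCount.

Variable m : seq bool.

Definition pcount a := count id (take a m).

Lemma pcountS a : pcount a.+1 = pcount a + nth false m a.
Proof.
rewrite /pcount; case: (ltnP a (size m)) => am.
  by rewrite (take_nth false am) -cats1 count_cat /= addn0.
by rewrite nth_default // !take_oversize ?addn0 // ltnW.
Qed.

Lemma pcount_leq a a' : a <= a' -> pcount a <= pcount a'.
Proof.
move/subnKC <-; elim: (a' - a) => [|d IH]; first by rewrite addn0.
by rewrite addnS pcountS (leq_trans IH) ?leq_addr.
Qed.

Lemma pcount_max a : pcount a <= count id m.
Proof. by rewrite -[in leqRHS](cat_take_drop a m) count_cat leq_addr. Qed.

Lemma hitP k i : hit k m i <-> pcount i < pcount (i + k).
Proof.
elim: k => [|k IH]; first by rewrite addn0 ltnn; split=> // [[j]]; lia.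
rewrite addnS pcountS; split=> [[j ij jm]|].
  have [jk|jk] := ltnP j (i + k).
    have /IH : hit k m i by exists j => //; lia.
    by lia.
  have E : j = i + k by lia.
  have := pcount_leq (leq_addr k i).
  by rewrite -E jm; lia.
case: (boolP (nth false m (i + k))) => [mik _|_]; first by exists (i + k) => //; lia.
by rewrite addn0 => /IH [j ij jm]; exists j => //; lia.
Qed.

End PrefixCount.

Section Blocks.

Variables (k : nat) (k_gt1 : 1 < k) (W : eqType).

(* A block lists pairs (level, word).  In the string an entry of level [j] becomes
   a segment of length [2 * k]: [j + 1] private letters, the [k] letters of
   its word, then [k - 1 - j] private letters; the whole block is followed by
   [k - 1] further private letters.  Private letters are the tokens [None]. *)
Definition block := seq (nat * W).
Definition token := option (W * nat).

Definition block_token (ws : block) (y : nat) : token :=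
  if onth ws (y %/ (2 * k)) is Some (j, w) then
    if j < y %% (2 * k) <= j + k then Some (w, y %% (2 * k) - j.+1) else None
  else None.

Definition block_len (ws : block) := k * (2 * size ws) + k.-1.

Definition block_tokens ws := mkseq (block_token ws) (block_len ws).

Definition tokens (bs : seq block) : seq token :=
  nseq k.-1 None ++ flatten (map block_tokens bs) ++ nseq k None.

(** Two hits for each entry, whose segment has length [2 * k], and one for the final run of private
    letters. *)
Definition budget (bs : seq block) := (\sum_(ws <- bs) 2 * size ws).+1.

Definition levels_ok (ws : block) := all (fun e => e.1 < k.-1) ws.

Definition choice_ok (sigma : nat -> nat) (ws : block) := forall j, j < k.-1 ->
  (exists w, onth ws (sigma j) = Some (j, w)) /\
  (j.+1 < k.-1 -> sigma j < sigma j.+1).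

Definition choices_cover (bs : seq block) (sigma : nat -> nat -> nat) :=
  forall b t j w, onth (nth [::] bs b) t = Some (j, w) ->
    exists b' t' j',
      onth (nth [::] bs b') t' = Some (j', w) /\ sigma b' j' <> t'.

(** A private letter equals only itself at its own position. The analysis of windows uses nothing
    else about the letters, so their numbering can wait. *)
Definition realizes (Sigma : Type) (x0 : Sigma) (T : seq Sigma) (ts : seq token) :=
  size T = size ts /\ forall i j, i < size ts -> j < size ts ->
    (nth x0 T i = nth x0 T j <->
     i = j \/ (nth None ts i = nth None ts j /\ nth None ts i <> None)).

(** A word is as long as a window and has private letters on both sides, so a window without private
    letters is exactly an occurrence of a word. The position [k * (2 * size ws)] is the first
    private letter behind the entries. *)
Lemma block_token_private ws y : levels_ok ws ->
  (exists d, d < k /\ y + d <= k * (2 * size ws) /\ block_token ws (y + d) = None)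
  \/ k * (2 * size ws) < y
  \/ exists t j w, onth ws t = Some (j, w) /\ y = k * (2 * t) + j.+1.
Proof.
move=> lok; have [le|] := leqP y (k * (2 * size ws)); last by right; left.
have k2 : 0 < 2 * k by lia.
have [E|yl] := eqVneq y (k * (2 * size ws)).
  left; exists 0; rewrite addn0 le; split; first by lia.
  split=> //; rewrite /block_token E mulnCA mulnA mulKn //.
  by rewrite onth_default.
have tl : y %/ (2 * k) < size ws by rewrite ltn_divLR //; lia.
set t := y %/ (2 * k) in tl *; set x := y %% (2 * k).
have Ey : y = t * (2 * k) + x := divn_eq y (2 * k).
have xl : x < 2 * k by rewrite ltn_mod.
case Eo : (onth ws t) => [[j w]|]; last first.
  by have := onthTE ws t; rewrite Eo tl.
have jk : j < k.-1.
  by have /(all_nthP (j, w)) /(_ t tl) := lok; rewrite (onth_nth _ _ _ _ Eo).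
have at_ d : x + d < 2 * k -> block_token ws (y + d) =
   if j < x + d <= j + k then Some (w, x + d - j.+1) else None.
  move=> xd; rewrite /block_token Ey -addnA divnMDl // modnMDl.
  by rewrite divn_small // modn_small // addn0 Eo.
have [xj|xj] := leqP x j.
  left; exists 0; split; [lia|split; [lia|]]; rewrite at_ addn0 // ifF //.
  by apply/negbTE/negP; lia.
have [Ex|xj1] := eqVneq x j.+1.
  by right; right; exists t, j, w; rewrite Ey Ex; split=> //; lia.
(* A window that starts inside the word, after its first letter, reaches the private letter in place
   [j + k + 1] of the segment; [j < k - 1] ensures that this place exists. *)
left; exists (if x <= j + k then (j + k).+1 - x else 0).
split; first by case: ifP; lia.
split; first by case: ifP; nia.
by case: (leqP x (j + k)) => xk; rewrite at_ ?addn0; try lia; rewrite ifF //; apply/negbTE/negP; lia.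
Qed.

Lemma block_token_word ws t j w d : j < k.-1 -> onth ws t = Some (j, w) -> d < k ->
  block_token ws (k * (2 * t) + j.+1 + d) = Some (w, d).
Proof.
move=> jk Eo dk; rewrite /block_token.
have -> : k * (2 * t) + j.+1 + d = t * (2 * k) + (j.+1 + d) by lia.
have k2 : 0 < 2 * k by lia.
have lt : j.+1 + d < 2 * k by lia.
rewrite divnMDl // modnMDl divn_small // modn_small // addn0 Eo ifT; last by lia.
by rewrite addKn.
Qed.


Section Tokens.

Variable bs : seq block.
Hypothesis bs_ok : all levels_ok bs.

(* The leading private letters count as an empty block number 0. *)
Let blk b := nth [::] ([::] :: bs) b.
Let r := (size bs).+1.
Let len b := block_len (blk b).
Let off := offset len.
Let rows b := 2 * size (blk b).

Lemma tokensE :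
  tokens bs = concat (fun b => block_token (blk b)) len r ++ nseq k None.
Proof.
rewrite /tokens catA; congr (_ ++ _).
have -> : nseq k.-1 None = block_tokens [::].
  rewrite /block_tokens /block_len /= !muln0 add0n.
  apply: (@eq_from_nth _ None); first by rewrite size_mkseq size_nseq.
  move=> i; rewrite size_nseq => ik.
  by rewrite nth_nseq ik nth_mkseq // /block_token onth0n.
rewrite -[_ ++ _]/(flatten (map block_tokens ([::] :: bs))); congr flatten.
rewrite -[in LHS](mkseq_nth [::] ([::] :: bs)) /mkseq -map_comp.
by apply: eq_map => b.
Qed.

Let t := tokens bs.

Lemma size_tokens : size t = off r + k.
Proof. by rewrite /t tokensE size_cat size_concat size_nseq. Qed.

Lemma blk_ok b : levels_ok (blk b).
Proof.
case: b => [//|b]; have [bl|bl] := ltnP b (size bs); last by rewrite /blk /= nth_default.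
by move/(all_nthP [::]): bs_ok => /(_ b bl).
Qed.

Lemma offS b : off b.+1 = off b + k * rows b + k.-1.
Proof. by rewrite /off offsetS addnA. Qed.

Lemma nth_tokens b y : b < r -> y < len b ->
  nth None t (off b + y) = block_token (blk b) y.
Proof. by move=> br yl; rewrite /t tokensE (nth_concat _ _ _ br yl). Qed.

Lemma nth_tokens_off b : b <= r -> nth None t (off b) = None.
Proof.
rewrite leq_eqVlt => /predU1P [->|br].
  rewrite /t tokensE -[off r]addn0 nth_concat_rest.
  by case: (k).
have kl : 0 < len b by rewrite /len /block_len; lia.
rewrite -[off b]addn0 nth_tokens // /block_token div0n mod0n.
by case: (onth _ _) => [[j w]|].
Qed.

Lemma nth_tokens_le b y : b < r -> y <= len b ->
  nth None t (off b + y) = if y < len b then block_token (blk b) y else None.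
Proof.
move=> br; rewrite leq_eqVlt => /predU1P [->|yl]; last by rewrite yl nth_tokens.
by rewrite ltnn -[_ + _](offsetS len) nth_tokens_off.
Qed.

Lemma off_leq b b' : b <= b' -> off b <= off b'.
Proof. exact: offset_leq. Qed.

Definition private a := exists d, d < k /\ nth None t (a + d) = None.

Lemma private_or_word b y : b < r -> y <= len b ->
  private (off b + y) \/
  exists i j w, onth (blk b) i = Some (j, w) /\ y = k * (2 * i) + j.+1.
Proof.
move=> br yl; case: (block_token_private y (blk_ok b)) => [[d [dk [le E]]]|[lt|]].
- left; exists d; split=> //; rewrite -addnA nth_tokens ?E //.
  by rewrite /len /block_len; lia.
- left; exists 0; rewrite addn0; split; first by lia.
  rewrite nth_tokens_le //; case: ifP => // _; rewrite /block_token onth_default //.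
  by rewrite leq_divRL; lia.
- by right.
Qed.

Lemma word_tokens b i j w d : onth (blk b) i = Some (j, w) -> d < k ->
  [/\ b < r, j < k.-1, k * (2 * i) + j.+1 + k <= len b
    & nth None t (off b + (k * (2 * i) + j.+1) + d) = Some (w, d)].
Proof.
move=> Eo dk; have il : i < size (blk b) by rewrite -onthTE Eo.
have jk : j < k.-1.
  by have /(all_nthP (j, w)) /(_ i il) := blk_ok b; rewrite (onth_nth _ _ _ _ Eo).
have br : b < r.
  rewrite ltnNge; apply/negP => rb; move: il.
  by rewrite /blk nth_default //=.
have le : k * (2 * i) + j.+1 + k <= len b by rewrite /len /block_len; nia.
by split=> //; rewrite -addnA nth_tokens ?(block_token_word jk Eo) //; lia.
Qed.

Variables (Sigma : eqType) (x0 : Sigma) (T : seq Sigma).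
Hypothesis real_T : realizes x0 T t.

Lemma private_window a a' : private a -> a + k <= size T -> a' + k <= size T ->
  take k (drop a' T) = take k (drop a T) -> a' = a.
Proof.
have [szT eqT] := real_T; rewrite szT => - [d [dk E]] ak a'k /(congr1 (nth x0 ^~ d)).
rewrite /= !nth_take // !nth_drop => /eqT.
by case; [lia|lia|lia|case=> E' []; rewrite E' E].
Qed.

(** An occurrence of a word contains no private letter, hence it starts where some entry puts a
    word. *)
Lemma word_window a b' y' b i j w :
    b' < r -> y' < len b' -> a = off b' + y' -> onth (blk b) i = Some (j, w) ->
    take k (drop a T) = take k (drop (off b + (k * (2 * i) + j.+1)) T) ->
  exists i' j', onth (blk b') i' = Some (j', w) /\ y' = k * (2 * i') + j'.+1.
Proof.
move=> b'r y'l -> Eo Ew; have [szT eqT] := real_T; rewrite size_tokens in szT eqT.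
have tok d : d < k -> nth None t (off b' + y' + d) = Some (w, d).
  move=> dk; have [br jk le E] := word_tokens Eo dk.
  have /eqT : nth x0 T (off b' + y' + d) =
      nth x0 T (off b + (k * (2 * i) + j.+1) + d).
    by move/(congr1 (nth x0 ^~ d)): Ew; rewrite /= !nth_take // !nth_drop.
  have := off_leq br; have := off_leq b'r; rewrite /off !offsetS -/off -/(len _) => h1 h2.
  by case; [lia|lia|move=> ->|case=> ->].
case: (private_or_word b'r (ltnW y'l)) => [[d [dk]]|[i' [j' [w' [Eo' Ey]]]]].
  by rewrite tok.
exists i', j'; split=> //; have k0 : 0 < k by lia.
have [_ _ _] := word_tokens Eo' k0; rewrite -Ey tok //.
by case=> ->.
Qed.

(** * From attractors to choices *)

Section Soundness.

Variable m : seq bool.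
Hypotheses (m_count : count id m <= budget bs) (m_attr : mask_attractor k T m).
Let c := pcount m.
Let M := offset rows.

Lemma M_S b : M b.+1 = M b + rows b.
Proof. exact: offsetS. Qed.

Lemma M_leq b b' : b <= b' -> M b <= M b'.
Proof. exact: offset_leq. Qed.

Lemma budgetE : budget bs = (M r).+1.
Proof.
rewrite /budget /M /offset /r big_ord_recl /= {1}/rows /= (big_nth [::]) big_mkord.
by congr _.+1.
Qed.

Lemma private_hit a : private a -> a + k <= size T -> c a < c (a + k).
Proof.
move=> pa ak; have [a' [a'k E /hitP h]] := m_attr ak.
by rewrite -(private_window pa ak a'k E).
Qed.

(** Words start in the columns 1 to [k - 1], so a window in column 0 is private and must itself be
    hit. *)
Lemma row_hit b i : b < r -> i <= rows b ->
  c (off b + k * i) < c (off b + k * i.+1).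
Proof.
move=> br ib; have il : k * i <= len b by rewrite /len /block_len -/(rows b); nia.
rewrite mulnS addnCA [k + _]addnC; apply: private_hit.
  case: (private_or_word br il) => // [[i' [j [w [Eo Ey]]]]].
  have [_ jk _ _] := word_tokens Eo (ltnW k_gt1).
  by case: (@row_inj k i (2 * i') 0 j.+1) => //; lia.
rewrite real_T.1 size_tokens; have := off_leq br; rewrite offS; nia.
Qed.

Lemma rows_hit b i i' : b < r -> i <= i' -> i' <= (rows b).+1 ->
  c (off b + k * i) + (i' - i) <= c (off b + k * i').
Proof.
move=> br; elim: i' => [|i' IH] le1 le2; first by rewrite (_ : i = 0) ?addn0 //; lia.
have [E|ii'] := eqVneq i i'.+1; first by rewrite E subnn addn0.
by have := IH _ _; have := row_hit br le2; lia.
Qed.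

Lemma count_lower b : b <= r -> M b <= c (off b).
Proof.
elim: b => [|b IH] br; first by rewrite /M /offset big_ord0.
have := IH (ltnW br); have := @rows_hit b 0 (rows b) br isT (leqnSn _).
rewrite muln0 addn0 subn0 M_S offS.
have := pcount_leq m (leq_addr k.-1 (off b + k * rows b)); rewrite -/c; lia.
Qed.

(** This is what the [k - 1] closing letters are for: the last window of column 0 ends with the
    first letter of the next block. *)
Lemma off_succ b : off b + k * (rows b).+1 = (off b.+1).+1.
Proof. rewrite offS; nia. Qed.

Lemma count_lower1 b : b < r -> M b.+1 < c (off b.+1).+1.
Proof.
move=> br; have := count_lower (ltnW br).
have := @rows_hit b 0 (rows b).+1 br isT (leqnn _).
rewrite muln0 addn0 subn0 M_S off_succ; lia.
Qed.

(** Downwards from the last block: after the first letter of a block, the windows in its rows 1 to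
    [rows b] are disjoint and still need [rows b] hits. *)
Lemma count_upper1 b : b <= r -> c (off b).+1 + (M r - M b) <= budget bs.
Proof.
move=> br; have [n E] : exists n, r = b + n by exists (r - b); lia.
elim: n b br E => [|n IH] b br E.
  rewrite addn0 in E; rewrite -E subnn addn0.
  exact: leq_trans (pcount_max m _) m_count.
have br' : b < r by lia.
have := IH b.+1 br'; rewrite M_S.
have := @rows_hit b 1 (rows b).+1 br' isT (leqnn _).
rewrite off_succ muln1 subn1 /=.
have := pcount_leq m (_ : (off b).+1 <= off b + k); rewrite -/c.
have := M_leq br'; rewrite M_S; lia.
Qed.

(** A further hit before [off b] would leave too few for the disjoint private windows from there on;
    behind the last block this is the final run of private letters. *)
Lemma count_off b : b <= r -> c (off b) = M b.
Proof.
move=> br; have := count_lower br.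
have: c (off b) < M b + 1 + 0.
  move: br; rewrite leq_eqVlt => /predU1P [->|br].
    have := @private_hit (off r); rewrite real_T.1 size_tokens leqnn => /(_ _ isT).
    have := leq_trans (pcount_max m (off r + k)) m_count; rewrite budgetE -/c.
    suff H : private (off r) by move=> h /(_ H); lia.
    by exists 0; rewrite addn0 nth_tokens_off //; split=> //; lia.
  have := @rows_hit b 0 (rows b).+1 br isT (leqnn _); rewrite off_succ muln0 addn0.
  have := count_upper1 br; rewrite budgetE M_S; have := count_lower (leqnn r).
  have := M_leq br; rewrite M_S; lia.
lia.
Qed.

Section Block.

Variable b : nat.
Hypotheses (b_gt0 : 0 < b) (br : b < r).

(* The windows at the multiples of [k] are private, so each contains a hit, and the
   budget leaves no slack: [c] is known exactly at the ends of the blocks.  In the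
   column [x] the excess over [M b + i] is 1 in row 0 and 0 in the last row, and
   the window where it drops for the last time contains no hit. *)
Definition above x i := M b + i < c (off b + k * i + x).

Definition last_above x : 'I_(rows b).+1 :=
  [arg max_(i > ord0 : 'I_(rows b).+1 | above x i) (i : nat)].

Lemma last_aboveP x : 0 < x < k ->
  [/\ above x (last_above x), last_above x < rows b
    & forall i, i <= rows b -> last_above x < i -> ~~ above x i].
Proof.
move=> /andP[x0_ xk].
have P0 : above x (ord0 : 'I_(rows b).+1).
  (* By [count_lower1] for the preceding block, the excess in row 0 is present right after the first
     letter. The leading private letters are the preceding block of the first real one. *)
  rewrite /above /= muln0 !addn0; case: b b_gt0 br => // b' _ b'r.
  have := count_lower1 (ltnW b'r); have := pcount_leq m (_ : (off b'.+1).+1 <= off b'.+1 + x).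
  by rewrite -/c; lia.
rewrite /last_above; case: arg_maxnP => // i Pi maxi; split=> //.
- rewrite ltn_neqAle -ltnS ltn_ord andbT; apply/negP => /eqP E.
  move: Pi; rewrite /above E; have := pcount_leq m (_ : off b + k * rows b + x <= off b.+1).
  by rewrite -/c count_off // M_S offS; lia.
- move=> i' i'b ii'; apply/negP => Pi'.
  by have := maxi (Ordinal (i'b : i' < (rows b).+1)) Pi'; rewrite /=; lia.
Qed.

(** The count exceeds [M b + i] in the last such row, and does not exceed [M b + i + 1] one row
    below, so it is the same at both ends of the window. *)
Lemma last_above_unhit x : 0 < x < k ->
  c (off b + k * last_above x + x) = c (off b + k * last_above x + x + k).
Proof.
move=> xk; have [P lt H] := last_aboveP xk.
have := H _ lt (leqnn _); rewrite /above -leqNgt mulnS.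
have E : off b + k * last_above x + x + k = off b + (k + k * last_above x) + x by lia.
have := pcount_leq m (leq_addr k (off b + k * last_above x + x)).
rewrite -/c E; move: P; rewrite /above; lia.
Qed.

Definition chosen j := (last_above j.+1)./2.

(** An unhit window is not private, so it is a word. Its column gives the level, and its row is even
    because entry [t] occupies the rows [2 * t] and [2 * t + 1]. *)
Lemma chosenP j : j < k.-1 ->
  (exists w, onth (blk b) (chosen j) = Some (j, w)) /\
  last_above j.+1 = 2 * chosen j :> nat.
Proof.
move=> jk; have xk : 0 < j.+1 < k by lia.
have [P lt H] := last_aboveP xk; have U := last_above_unhit xk.
set i := last_above _ in P lt H U; have yl : k * i + j.+1 <= len b.
  by rewrite /len /block_len -/(rows b); nia.
case: (private_or_word br yl) => [pr|[i' [j' [w [Eo Ey]]]]].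
  have := private_hit pr; rewrite addnA -U ltnn => H0; suff : false by []; apply: H0.
  by rewrite real_T.1 size_tokens; have := off_leq br; rewrite offS; nia.
have [_ j'k _ _] := word_tokens Eo (ltnW k_gt1).
have [||ii' [jj']] := row_inj _ _ Ey; [lia|lia|].
have ci : chosen j = i' by rewrite /chosen -/i ii' mul2n doubleK.
by rewrite ci; split=> //; exists w; rewrite jj'.
Qed.

Lemma chosen_unhit j : j < k.-1 ->
  ~ hit k m (off b + (k * (2 * chosen j) + j.+1)).
Proof.
move=> jk /hitP; have [_ <-] := chosenP jk.
by rewrite addnA -/c -last_above_unhit ?ltnn //; lia.
Qed.

Lemma chosen_ok : choice_ok chosen (blk b).
Proof.
move=> j jk; have [[w Ew] Ej] := chosenP jk; split; first by exists w.
move=> jk1; have [[w' Ew'] Ej1] := chosenP jk1.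
(* [above] is monotone in the column, being a lower bound on a prefix count. Strictness comes later:
   one entry cannot have two levels. *)
have le : last_above j.+1 <= last_above j.+2.
  rewrite leqNgt; apply/negP => lt; have xk : 0 < j.+2 < k by lia.
  have [_ _ /(_ _ _ lt)] := last_aboveP xk.
  have xk' : 0 < j.+1 < k by lia.
  have [P lt' _] := last_aboveP xk'; move/(_ (ltnW lt')) => /negP; apply.
  apply: leq_trans P _; apply: pcount_leq; lia.
have : chosen j <> chosen j.+1.
  by move=> E; move: Ew'; rewrite -E Ew => - [/eqP]; rewrite eqn_leq ltnn andbF.
lia.
Qed.

End Block.

Lemma attractor_choices : exists sigma,
  (forall b, b < size bs -> choice_ok (sigma b) (nth [::] bs b)) /\
  choices_cover bs sigma.
Proof.
exists (fun b => chosen b.+1); split; first by move=> b br; apply: chosen_ok.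
move=> b i j w Eo; have Eo' : onth (blk b.+1) i = Some (j, w) by [].
have k0 := ltnW k_gt1.
have [br jk le _] := word_tokens Eo' k0.
have [|a' [a'k Ew h]] := @m_attr (off b.+1 + (k * (2 * i) + j.+1)).
  by rewrite real_T.1 size_tokens; have := off_leq br; rewrite /off offsetS -/(len _); lia.
have a'r : a' <= off r by move: a'k; rewrite real_T.1 size_tokens; lia.
move: a'r; rewrite leq_eqVlt => /predU1P [E|/offset_locate [b' [y' [b'r y'l Ea']]]].
  have [_ _ _ tw] := word_tokens Eo' k0; rewrite addn0 in tw.
  have pr : private a' by exists 0; rewrite addn0 E nth_tokens_off.
  have ak : off b.+1 + (k * (2 * i) + j.+1) + k <= size T.
    by rewrite real_T.1 size_tokens; have := off_leq br; rewrite /off offsetS -/(len _); lia.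
  have Ea := private_window pr a'k ak (esym Ew).
  by move: tw; rewrite Ea E nth_tokens_off.
have [i' [j' [Eo1 Ey]]] := word_window b'r y'l Ea' Eo' Ew.
case: b' b'r y'l Ea' Eo1 => [|b'] b'r y'l Ea' Eo1; first by rewrite /blk /= onth0n in Eo1.
exists b', i', j'; split=> // E; have [_ j'k _ _] := word_tokens Eo1 k0.
by have := chosen_unhit (b := b'.+1) isT b'r j'k; rewrite E -Ey; case; rewrite -Ea'.
Qed.

End Soundness.

(** * From choices to attractors *)

Section Completeness.

Variable sigma : nat -> nat -> nat.
Hypothesis sigma_ok : forall b, b < size bs -> choice_ok (sigma b) (nth [::] bs b).
Hypothesis sigma_cover : choices_cover bs sigma.

(* Row [i] of a block is hit at column [phase i]: the phase advances by one
   exactly at the chosen words, which are the only windows missed. *)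
Definition phase b i := count (fun j => 2 * sigma b j < i) (iota 0 k.-1).

Definition mark b y :=
  if b is b'.+1 then y %% k == phase b' (y %/ k) else false.

Definition mask := concat mark len r ++ true :: nseq k.-1 false.

Lemma phase_lt b i : phase b i < k.
Proof. by have := count_size (fun j => 2 * sigma b j < i) (iota 0 k.-1); rewrite size_iota /phase; lia. Qed.

Lemma phase0 b : phase b 0 = 0.
Proof. by rewrite /phase (eq_count (a2 := pred0)) ?count_pred0. Qed.

Lemma choice_lt b j : b < size bs -> j < k.-1 -> sigma b j < size (blk b.+1).
Proof. by move=> bl jk; have [[w E] _] := sigma_ok bl jk; rewrite -onthTE /= E. Qed.

Lemma phase_rows b : b < size bs -> phase b (rows b.+1) = k.-1.
Proof.
move=> bl; rewrite -[RHS](size_iota 0) -[RHS]count_predT /phase.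
apply: eq_in_count => j; rewrite mem_iota add0n => /andP[_ jk].
by rewrite [RHS]/= /rows; have := choice_lt bl jk; lia.
Qed.

Lemma choice_mono b j j' : b < size bs -> j < j' -> j' < k.-1 ->
  sigma b j < sigma b j'.
Proof.
move=> bl; elim: j' => // j' IH; rewrite ltnS leq_eqVlt => /predU1P[->|jj'] jk.
  by have [_ ->] := sigma_ok bl (ltnW jk).
have [_ /(_ jk) lt] := sigma_ok bl (ltnW jk).
exact: ltn_trans (IH jj' (ltnW jk)) lt.
Qed.

Lemma phase_at b j : b < size bs -> j < k.-1 ->
  phase b (2 * sigma b j) = j /\ phase b (2 * sigma b j).+1 = j.+1.
Proof.
move=> bl jk.
have E i : i <= k.-1 -> count (fun j' => j' < i) (iota 0 k.-1) = i.
  move=> ik; rewrite -(subnKC ik) iotaD count_cat add0n.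
  rewrite (_ : count _ (iota i _) = 0) ?addn0; last first.
    by apply/eqP; rewrite -leqn0 leqNgt -has_count; apply/hasPn => x; rewrite mem_iota; lia.
  rewrite -[RHS](size_iota 0) -[RHS]count_predT; apply: eq_in_count => x.
  by rewrite mem_iota => /andP[_].
split; [rewrite -[RHS]E ?(ltnW jk) //|rewrite -[RHS]E //];
  apply: eq_in_count => j'; rewrite mem_iota add0n => /andP[_ j'k];
  have := @choice_mono b j j' bl; have := @choice_mono b j' j bl;
  by case: (ltngtP j j') => [jj' _ /(_ isT j'k)|jj' /(_ isT jk) + _|<- _ _] /=; lia.
Qed.

Lemma phase_step b i : phase b i < phase b i.+1 -> exists2 j, j < k.-1 & 2 * sigma b j = i.
Proof.
rewrite /phase; elim: (k.-1) => // n IH.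
rewrite -(addn1 n) iotaD !count_cat add0n /= !addn0.
case: (eqVneq (2 * sigma b n) i) => [<- _|ne]; first by exists n => //; lia.
have -> : (2 * sigma b n < i.+1) = (2 * sigma b n < i) by rewrite ltnS [RHS]ltn_neqAle ne.
by rewrite ltn_add2r => /IH [j jn E]; exists j => //; lia.
Qed.

Lemma mask_mark b i : b < size bs -> i <= rows b.+1 ->
  nth false mask (off b.+1 + (k * i + phase b i)).
Proof.
move=> bl ib; have pl := phase_lt b i.
have le : k * i + phase b i <= len b.+1.
  rewrite /len /block_len -/(rows _); move: ib; rewrite leq_eqVlt.
  by case/predU1P => [->|lt]; [rewrite phase_rows|nia].
have mark_at y : y < len b.+1 -> nth false mask (off b.+1 + y) = mark b.+1 y.
  by move=> yl; rewrite /mask (nth_concat _ _ _ _ yl).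
(* In the last row the phase is [k - 1], and this position is already the first letter of the next
   block, or the extra [true] in [mask]. Consecutive blocks share this mark, which is why it is paid
   for only once. *)
move: le; rewrite leq_eqVlt => /predU1P [E|lt].
  rewrite E -[_ + _](offsetS len).
  move: bl; rewrite leq_eqVlt => /predU1P [Er|bl'].
    by rewrite Er -[offset _ _]addn0 /mask nth_concat_rest.
  rewrite -[offset _ _]addn0 /mask nth_concat //=; last by rewrite /len /block_len; lia.
  by rewrite mod0n div0n phase0.
rewrite mark_at //= mulnC modnMDl divnMDl; last by lia.
by rewrite modn_small // divn_small // addn0.
Qed.

(** A window from row [i] and column [x] contains the mark of row [i] if [x <= phase b i], and that
    of row [i + 1] if [phase b i.+1 < x]. It misses both only where the phase advances past [x],
    which is at a chosen word. *)
Lemma window_hit a : a + k <= size T -> hit k mask a \/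
  exists b j, [/\ b < size bs, j < k.-1 &
    a = off b.+1 + (k * (2 * sigma b j) + j.+1)].
Proof.
rewrite real_T.1 size_tokens leq_add2r leq_eqVlt => /predU1P [->|].
  left; exists (off r); first by lia.
  by rewrite -[off r]addn0 /mask nth_concat_rest.
case/offset_locate => [[|b] [y [br yl ->]]].
  left; exists (off 1); rewrite /off offsetS.
    by move: yl; rewrite /len /block_len /= /offset big_ord0; lia.
  have [bs0|bs0] := posnP (size bs).
    by rewrite -offsetS -[offset _ _]addn0 /mask /r bs0 nth_concat_rest.
  have := mask_mark bs0 (leq0n _); rewrite muln0 phase0 !addn0 /off.
  by rewrite -offsetS.
have bl : b < size bs by [].
rewrite -/off; set i := y %/ k; set x := y %% k; have k0 : 0 < k by lia.
have Ey : y = k * i + x by rewrite mulnC; exact: divn_eq.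
have xk : x < k by rewrite ltn_mod.
have il : i <= rows b.+1.
  by move: yl; rewrite /len /block_len -/(rows _) Ey; nia.
have [xp|px] := leqP x (phase b i).
  left; exists (off b.+1 + (k * i + phase b i)); last exact: mask_mark.
  by have := phase_lt b i; rewrite Ey; lia.
have il' : i < rows b.+1.
  rewrite ltn_neqAle il andbT; apply/eqP => E; move: px.
  by rewrite E phase_rows //; lia.
have [px'|xp'] := ltnP (phase b i.+1) x.
  left; exists (off b.+1 + (k * i.+1 + phase b i.+1)); last exact: mask_mark.
  by rewrite Ey mulnS; lia.
right; have [j jk Ej] := phase_step (leq_trans px xp').
have [p1 p2] := phase_at bl jk; exists b, j; split=> //.
by rewrite Ey Ej; congr (_ + (_ + _)); rewrite Ej in p1 p2; lia.
Qed.

Lemma mask_is_attractor : mask_attractor k T mask.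
Proof.
move=> a ak; case: (window_hit ak) => [h|[b [j [bl jk Ea]]]]; first by exists a.
have [[w Ew] _] := sigma_ok bl jk; have k0 : 0 < k by lia.
have [b' [i' [j' [Eo' ne]]]] := sigma_cover Ew.
have Ew1 : onth (blk b.+1) (sigma b j) = Some (j, w) := Ew.
have Eo1 : onth (blk b'.+1) i' = Some (j', w) := Eo'.
have [b'r j'k le' _] := word_tokens Eo1 k0.
set a' := off b'.+1 + (k * (2 * i') + j'.+1).
have a'k : a' + k <= size T.
  by rewrite real_T.1 size_tokens /a'; have := off_leq b'r; rewrite /off offsetS -/(len _); lia.
exists a'; split=> //.
- apply: (@eq_from_nth _ x0); rewrite !size_takel ?size_drop; try lia.
  move=> d dk; rewrite !nth_take // !nth_drop.
  have [_ _ _ t1] := word_tokens Ew1 dk; have [_ _ _ t2] := word_tokens Eo1 dk.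
  have [szT eqT] := real_T; apply/eqT; rewrite -?szT; try lia.
  by right; rewrite t2 Ea t1.
- case: (window_hit a'k) => // [[b2 [j2 [b2l j2k]]]].
  have [[w2 Ew2] _] := sigma_ok b2l j2k.
  have Ew2' : onth (blk b2.+1) (sigma b2 j2) = Some (j2, w2) := Ew2.
  have [b2r _ le2 _] := word_tokens Ew2' k0; rewrite /a' => E.
  have Eb : b' = b2.
    have h1 : b' < b2 -> False.
      move=> lt; have := off_leq (lt : b'.+2 <= b2.+1).
      by rewrite /off offsetS -/(len _) -/off; lia.
    have h2 : b2 < b' -> False.
      move=> lt; have := off_leq (lt : b2.+2 <= b'.+1).
      by rewrite /off offsetS -/(len _) -/off; lia.
    by lia.
  move: E; rewrite Eb => /addnI /row_inj [||E1 [E2]]; [lia|lia|].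
  by case: ne; rewrite Eb E2; lia.
Qed.

Lemma count_mkseq_row (f : nat -> bool) n :
    (forall i, i < n -> exists p, forall x, x < k -> f (k * i + x) = (x == p)) ->
  count id (mkseq f (k * n)) <= n.
Proof.
elim: n => [|n IH] H; first by rewrite muln0.
have [p Hp] := H n (ltnSn n).
rewrite mulnSr /mkseq iotaD map_cat count_cat -addn1 leq_add //.
  by apply: IH => i il; apply: H; apply: ltnW.
rewrite add0n count_map -[k * n]addn0 iotaDl count_map.
rewrite (eq_in_count (a2 := pred1 p)) => [|x].
  by rewrite count_uniq_mem ?iota_uniq //; case: (_ \in _).
by rewrite mem_iota => /andP[_ xk] /=; apply: Hp.
Qed.

Lemma count_mask : count id mask <= budget bs.
Proof.
have nseqF n : count id (nseq n false) = 0 by elim: n.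
rewrite budgetE /mask count_cat /= nseqF addn0 addn1 ltnS.
have : r <= r by []; elim: {-2}r => [|b IH] br; first by rewrite /concat.
rewrite concatS count_cat /= offsetS leq_add ?IH ?(ltnW br) //.
rewrite /len /block_len -/(rows b) /mkseq iotaD map_cat count_cat add0n.
(* The [k - 1] closing letters carry no mark: the phase there is [k - 1], and their columns are
   smaller. *)
rewrite (_ : count id [seq _ | _ <- iota (k * rows b) _] = 0) ?addn0; last first.
  apply/eqP; rewrite -leqn0 leqNgt -has_count; apply/hasPn => x /mapP [y].
  rewrite mem_iota => yl ->; case: b br yl {IH} => //= b br yl.
  have -> : y = rows b.+1 * k + (y - k * rows b.+1) by lia.
  have yk : y - k * rows b.+1 < k by lia.
  rewrite modnMDl divnMDl; last by lia.
  rewrite modn_small // divn_small // addn0 phase_rows //.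
  by apply/negP; lia.
apply: count_mkseq_row => i ib; case: b br ib {IH} => [|b] br ib.
  by exists k => x xk /=; apply/esym/negbTE; lia.
exists (phase b i) => x xk /=; rewrite mulnC modnMDl divnMDl; last by lia.
by rewrite modn_small // divn_small // addn0.
Qed.

Lemma size_mask : size mask = size T.
Proof.
rewrite real_T.1 size_tokens size_cat size_concat /= size_nseq prednK //.
exact: ltnW.
Qed.

End Completeness.

Theorem block_attractor :
  (exists m, [/\ size m <= size T, count id m <= budget bs & mask_attractor k T m]) <->
  (exists sigma, (forall b, b < size bs -> choice_ok (sigma b) (nth [::] bs b)) /\
     choices_cover bs sigma).
Proof.
split=> [[m [_ mc ma]]|[sigma [ok cov]]]; first exact: attractor_choices mc ma.
exists (mask sigma); rewrite size_mask; split=> //; first exact: count_mask.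
exact: mask_is_attractor.
Qed.

End Tokens.

End Blocks.


(** * Helical tilings *)

(** From here on a block is addressed by a label that says what it stands for, instead of by its
    place in the list. *)
Lemma labelled_choices (k : nat) (W L : eqType) (blk : L -> block W) (ls : seq L) :
  uniq ls ->
  (exists sigma, (forall b, b < size (map blk ls) ->
       choice_ok k (sigma b) (nth [::] (map blk ls) b)) /\
     choices_cover (map blk ls) sigma) <->
  (exists sigma : L -> nat -> nat,
     {in ls, forall l, choice_ok k (sigma l) (blk l)} /\
     forall l t j w, l \in ls -> onth (blk l) t = Some (j, w) ->
       exists l' t' j', [/\ l' \in ls, onth (blk l') t' = Some (j', w)
                          & sigma l' j' <> t']).
Proof.
case: ls => [|l0 ls'] U; first by split=> _; [exists (fun _ => id)|exists (fun _ => id)];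
  split=> // b t j w; rewrite /= nth_nil onth0n.
set ls := l0 :: ls' in U *.
have blkE b : b < size ls -> nth [::] (map blk ls) b = blk (nth l0 ls b).
  by move=> bl; rewrite (nth_map l0).
split=> [[sigma [ok cov]]|[sigma [ok cov]]].
- exists (fun l => sigma (index l ls)).
  have at_ l : l \in ls -> nth [::] (map blk ls) (index l ls) = blk l.
    by move=> ll; rewrite blkE ?index_mem // nth_index.
  split=> [l ll|l t j w ll Eo].
    by rewrite -at_ //; apply: ok; rewrite size_map index_mem.
  rewrite -at_ // in Eo; have [b' [t' [j' [Eo' ne]]]] := cov _ _ _ _ Eo.
  have bl : b' < size ls.
    by rewrite ltnNge; apply/negP => le; rewrite nth_default ?size_map ?onth0n in Eo'.
  exists (nth l0 ls b'), t', j'; rewrite mem_nth // index_uniq //; split=> //.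
  by rewrite -blkE.
- exists (fun b => sigma (nth l0 ls b)); split=> [b|b t j w Eo].
    by rewrite size_map => bl; rewrite blkE //; apply: ok; rewrite mem_nth.
  have bl : b < size ls.
    by rewrite ltnNge; apply/negP => le; rewrite nth_default ?size_map ?onth0n in Eo.
  rewrite blkE // in Eo; have [l' [t' [j' [ll Eo' ne]]]] := cov _ _ _ _ (mem_nth _ bl) Eo.
  exists (index l' ls), t', j'.
  by rewrite blkE ?index_mem // nth_index.
Qed.

Section Tiling.

Variables (C Z : finType) (c0 : C) (allowed : Z -> pred C) (R : bool -> rel C).

Definition shift (w : nat) (d : bool) := if d then w else 1.

(* A row of length [size z] wound on a cylinder of circumference [w]. *)
Definition tileable (z : seq Z) (w : nat) := exists col : nat -> C,
  (forall c x, onth z c = Some x -> allowed x (col c)) /\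
  (forall d c, c + shift w d < size z -> R d (col c) (col (c + shift w d))).

(* [inr false] and [inr true] are the padding cells before and after the row. *)
Definition kind : finType := (Z + bool)%type.

Definition padded (z : seq Z) (w : nat) : seq kind :=
  nseq w (inr false) ++ map inl z ++ nseq w (inr true).

(** For a fixed candidate colour of a cell: the direction of a link, the end of the link at which
    the cell lies, and the candidate it is confronted with at the other end. *)
Definition port : finType := (bool * bool * C)%type.
Definition nports := #|port|.
Definition rank (pi : port) : nat := enum_rank pi.

Lemma rank_inj : injective rank.
Proof. by move=> p q /val_inj /enum_rank_inj. Qed.

Lemma rank_lt pi : rank pi < nports. Proof. exact: ltn_ord. Qed.

Lemma rank_surj s : s < nports -> exists pi, rank pi = s.
Proof. by move=> sl; exists (enum_val (Ordinal sl)); rewrite /rank enum_valK. Qed.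

Lemma nports_gt0 : 0 < nports.
Proof. exact: leq_trans (rank_lt (false, false, c0)). Qed.

(* A word is a code together with a cell; the cell is relative to the current
   cell [c]: an increment added to 0, [c] or [c + w]. *)
Definition rword : eqType := (nat * (nat * option bool))%type.
Definition aword : eqType := (nat * nat)%type.

Definition base (w c : nat) (b : option bool) : nat :=
  match b with None => 0 | Some false => c | Some true => c + w end.

Definition absw (w c : nat) (r : rword) : aword := (r.1, r.2.1 + base w c r.2.2).

Definition own : nat * option bool := (0, Some false).
Definition nbr (d : bool) : nat * option bool :=
  if d then (0, Some true) else (1, Some false).

(* The word [lam c i s] links the ports of rank [s - 1] and [s] of the
   candidate colour [i] of the cell [c]. *)
Definition lam (c : nat) (i : C) (s : nat) : aword := ((pickle (i, s)).+1, c).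
Definition rlam (sh : nat * option bool) (i : C) (s : nat) : rword :=
  ((pickle (i, s)).+1, sh).
Definition rdummy : rword := (0, (0, None)).

Lemma absw_lam w c i s : absw w c (rlam own i s) = lam c i s.
Proof. by rewrite /absw /= add0n. Qed.

Lemma absw_nbr w c d i s : absw w c (rlam (nbr d) i s) = lam (c + shift w d) i s.
Proof. by case: d => //; rewrite /absw /lam /= add1n addn1. Qed.

Lemma lam_inj c i s c' i' s' : lam c i s = lam c' i' s' -> [/\ c = c', i = i' & s = s'].
Proof. by case=> /(pcan_inj pickleK) [-> ->] ->. Qed.

Variables (k : nat) (k_gt2 : 2 < k).

(** Every level needs an entry to skip. Where nothing is to be decided it is a word that stays
    covered in the group of a padding cell. *)
Definition dummies j0 : block rword := [seq (j, rdummy) | j <- iota j0 (k.-1 - j0)].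

(** Level 0 offers exactly the allowed colours, so its skip picks one. Entries of level 1 are spare
    occurrences, not meant to be skipped: the first words of colours that cannot be picked, and the
    ends of all chains. A padding cell constrains nothing, as all its words have a spare occurrence;
    of its two dummies of level 0 one is always left. *)
Definition group_head (x : kind) : block rword :=
  match x with
  | inl z => [seq (0, rlam own i 0) | i <- enum C & allowed z i] ++
      [seq (1, rlam own i 0) | i <- enum C & ~~ allowed z i] ++
      [seq (1, rlam own i nports) | i <- enum C]
  | inr _ => [:: (0, rdummy); (0, rdummy)] ++
      [seq (1, rlam own i s) | i <- enum C, s <- iota 0 nports.+1]
  end.

Definition group (x : kind) := group_head x ++ dummies 1.

(** An active port skips its outgoing word, an inactive one its ingoing word. The outgoing words
    stand in the order of their levels for an allowed pair and in the opposite order for a forbidden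
    one. Ingoing words are outermost, so a link with an inactive port is always in order. *)
Definition in_pos (side : bool) := if side then 3 else 0.
Definition out_pos (r side : bool) := if r == side then 2 else 1.

Definition link (d : bool) (i j : C) : block rword :=
  let v := rank (d, false, j) in let v' := rank (d, true, i) in
  (if R d i j then [:: (0, rlam own i v); (0, rlam own i v.+1);
      (1, rlam (nbr d) j v'.+1); (1, rlam (nbr d) j v')]
   else [:: (0, rlam own i v); (1, rlam (nbr d) j v'.+1);
      (0, rlam own i v.+1); (1, rlam (nbr d) j v')]) ++ dummies 2.

Definition label : eqType := option (bool * C * C)%type.

Definition rblock (x : kind) (l : label) : block rword :=
  if l is Some (d, i, j) then link d i j else group x.

(** The cells before the row have links, because these contain ports of the first cells of the row;
    the cells after it occur in links only as neighbours. *)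
Definition rlabels (x : kind) : seq label :=
  None :: if x is inr true then [::] else [seq Some y | y <- enum {: bool * C * C}].

Definition abs_block w c (b : block rword) : block aword :=
  [seq (e.1, absw w c e.2) | e <- b].

Definition cell_blocks (x : kind) : seq (block rword) := map (rblock x) (rlabels x).

Definition all_blocks (w : nat) (zz : seq kind) : seq (block aword) :=
  flatten (mkseq (fun c => map (abs_block w c) (cell_blocks (nth (inr true) zz c))) (size zz)).

Section Instance.

Variables (z : seq Z) (w : nat).
Hypothesis w_gt0 : 0 < w.
Let zz := padded z w.
Let N := size z.
Let kd c := nth (inr true) zz c.

Lemma size_zz : size zz = w + N + w.
Proof. by rewrite !size_cat !size_nseq size_map addnA. Qed.

Lemma kd_left c : c < w -> kd c = inr false.
Proof. by move=> cw; rewrite /kd nth_cat size_nseq cw nth_nseq cw. Qed.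

Lemma kd_real c : w <= c < w + N ->
  exists2 x, kd c = inl x & onth z (c - w) = Some x.
Proof.
move=> /andP[wc cN]; have cl : c - w < size z by rewrite ltn_subLR.
case E : (onth z (c - w)) => [x|]; last by have := onthTE z (c - w); rewrite E cl.
exists x => //; rewrite /kd nth_cat size_nseq ltnNge wc /= nth_cat size_map cl.
by rewrite (nth_map x) // (onth_nth _ _ _ _ E).
Qed.

Lemma kd_right c : w + N <= c -> kd c = inr true.
Proof.
move=> wc; rewrite /kd nth_cat size_nseq ltnNge (leq_trans (leq_addr N w) wc) /=.
rewrite nth_cat size_map ltnNge leq_subRL ?(leq_trans (leq_addr N w)) // wc /=.
by rewrite nth_nseq if_same.
Qed.

Lemma kd_links c : c < w + N -> kd c != inr true.
Proof.
move=> cl; have [cw|wc] := ltnP c w; first by rewrite kd_left.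
by have [|x -> _] := @kd_real c; rewrite ?wc.
Qed.

Definition labels : seq (nat * label) :=
  [seq (c, l) | c <- iota 0 (size zz), l <- rlabels (kd c)].

Definition lblock (cl : nat * label) : block aword :=
  abs_block w cl.1 (rblock (kd cl.1) cl.2).

Lemma all_blocksE : all_blocks w zz = map lblock labels.
Proof.
rewrite /all_blocks /labels map_allpairs /mkseq /allpairs_dep; congr flatten.
by apply: eq_map => c; rewrite /cell_blocks -map_comp.
Qed.

Lemma labels_uniq : uniq labels.
Proof.
apply: allpairs_uniq_dep; first exact: iota_uniq.
- move=> c _; rewrite /rlabels /=; case: (kd c) => [x|[]] //=;
  by rewrite map_inj_uniq ?enum_uniq ?andbT => [|? ? []] //; apply/mapP => - [].
- by move=> [c l] [c' l'] _ _ /= [-> ->].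
Qed.

Lemma group_label c : c < size zz -> (c, None) \in labels.
Proof.
by move=> cl; apply/allpairsPdep; exists c, None; rewrite mem_iota /rlabels inE eqxx.
Qed.

Lemma link_label c e : ((c, Some e) \in labels) = (c < w + N).
Proof.
apply/allpairsPdep/idP => [[c' [l []]]|cl].
  rewrite mem_iota => _ /[swap] [[<- <-]]; rewrite /rlabels inE /= ltnNge.
  by case E: (w + N <= c) => //; rewrite kd_right.
exists c, (Some e); split=> //.
  by rewrite mem_iota size_zz (leq_trans cl) // leq_addr.
have := kd_links cl; rewrite /rlabels inE /=.
case: (kd c) => [x|[]] // _; exact: map_f (mem_enum _ _).
Qed.

Lemma label_lt c l : (c, l) \in labels -> c < size zz.
Proof. by case/allpairsPdep => c' [l' []]; rewrite mem_iota => /andP[_ ?] _ [-> _]. Qed.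

(* The block where port [pi] of the candidate [i] of the cell [c] sits. *)
Definition port_label c i (pi : port) : nat * label :=
  let: (d, side, j) := pi in
  if side then (c - shift w d, Some (d, j, i)) else (c, Some (d, i, j)).

Definition pside (pi : port) : bool := pi.1.2.
Definition pin (pi : port) := in_pos (pside pi).
Definition pout i (pi : port) :=
  let: (d, side, j) := pi in out_pos (if side then R d j i else R d i j) side.

Lemma pin_out i pi : pin pi <> pout i pi.
Proof. by case: pi => [[d []] j]; rewrite /pout /pin /out_pos /=; case: ifP. Qed.

Lemma shift_le d : shift w d <= w. Proof. by case: d. Qed.

Lemma port_in c i pi : w <= c ->
  onth (lblock (port_label c i pi)) (pin pi) = Some (pside pi : nat, lam c i (rank pi)).
Proof.
move=> wc; rewrite onth_map; case: pi => [[d []] j] /=; rewrite /link; case: (R _ _ _) => /=.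
all: by rewrite ?absw_nbr ?absw_lam ?subnK // (leq_trans (shift_le d)).
Qed.

Lemma port_out c i pi : w <= c ->
  onth (lblock (port_label c i pi)) (pout i pi)
  = Some (pside pi : nat, lam c i (rank pi).+1).
Proof.
move=> wc; rewrite onth_map; case: pi => [[d []] j] /=; rewrite /link; case: (R _ _ _) => /=.
all: by rewrite ?absw_nbr ?absw_lam ?subnK // (leq_trans (shift_le d)).
Qed.

Lemma onth_dummies j0 t lev wd :
  onth (dummies j0) t = Some (lev, wd) -> [/\ lev = j0 + t, lev < k.-1 & wd = rdummy].
Proof.
rewrite onth_map; case E : (onth _ _) => [j|] //= [<- <-].
have tl : t < k.-1 - j0 by rewrite -(size_iota j0 (k.-1 - j0)) -onthTE E.
have := onth_nth 0 _ _ _ E; rewrite nth_iota // => <-.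
by split=> //; lia.
Qed.

Lemma link_cases c d i j t lev wd :
  onth (lblock (c, Some (d, i, j))) t = Some (lev, wd) ->
  (exists cs is_ pi, [/\ port_label cs is_ pi = (c, Some (d, i, j)), c <= cs <= c + w,
      lev = pside pi & (t = pin pi /\ wd = lam cs is_ (rank pi)) \/
                  (t = pout is_ pi /\ wd = lam cs is_ (rank pi).+1)])
  \/ (2 <= lev /\ wd = (0, 0)).
Proof.
have sw := shift_le d; rewrite onth_map /= /link onth_cat.
rewrite (fun_if (@size _)) /= if_same; case: ltnP => t4; last first.
  case E : (onth _ _) => [[j' r]|] //= [<- <-]; right.
  by have [-> _ ->] := onth_dummies E.
case Er : (R d i j); case: t t4 => [|[|[|[|t]]]] // _ [<- <-]; left;
  [exists c, i, (d, false, j)|exists c, i, (d, false, j)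
  |exists (c + shift w d), j, (d, true, i)|exists (c + shift w d), j, (d, true, i)
  |exists c, i, (d, false, j)|exists (c + shift w d), j, (d, true, i)
  |exists c, i, (d, false, j)|exists (c + shift w d), j, (d, true, i)];
  rewrite ?absw_nbr ?absw_lam /port_label /pin /pout ?addnK ?Er /=; split=> //;
  by [lia|left|right].
Qed.

(** In a link the levels 0 and 1 have two entries each, both belonging to the same port. *)
Lemma port_choice a i pi sigma : w <= a ->
  choice_ok k sigma (lblock (port_label a i pi)) ->
  sigma (pside pi) = pin pi \/ sigma (pside pi) = pout i pi.
Proof.
move=> wa; case El : (port_label a i pi) => [c [[[d i'] j']|]]; last first.
  by case: pi El => [[d []] j].
move=> ok; have [|[wd Eo] _] := ok (pside pi); first by case: (pside pi); lia.
case: (link_cases Eo) => [[cs [is_ [pi' [El' _ Es H]]]]|[]]; last by case: (pside pi).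
have Ei : i = is_ /\ pi = pi' \/ pside pi <> pside pi'.
  case: pi pi' El El' {Eo Es H} => [[e []] j] [[e' []] j'']; rewrite /pside /=; try by right.
  - by case=> _ <- <- <- [_ -> -> ->]; left.
  - by case=> _ <- <- <- [_ -> -> ->]; left.
case: Ei => [[Ei Ep]|ne].
  by rewrite -Ep in H; rewrite Ei; case: H => [[-> _]|[-> _]]; [left|right].
by case: ne; case: (pside pi) (pside pi') Es => [] [].
Qed.

Lemma link_choice c d i j sigma :
  choice_ok k sigma (lblock (c, Some (d, i, j))) ->
  sigma 0 = out_pos (R d i j) false -> sigma 1 = out_pos (R d i j) true -> R d i j.
Proof.
move=> ok e0 e1; have k1 : 0 < k.-1 by lia. have k2 : 1 < k.-1 by lia.
have [_ /(_ k2)] := ok 0 k1; rewrite e0 e1 /out_pos.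
by case: (R d i j).
Qed.

Lemma rlam_inj sh i s sh' i' s' :
  rlam sh i s = rlam sh' i' s' -> [/\ sh = sh', i = i' & s = s'].
Proof. by case=> /(pcan_inj pickleK) [-> ->] ->. Qed.

Lemma head_uniq x : uniq [seq e.2 | e <- group_head (inl x)].
Proof.
have inj s : injective (fun i => rlam own i s) by move=> i i' /rlam_inj [].
have -> : [seq e.2 | e <- group_head (inl x)] =
    [seq rlam own i 0 | i <- enum C & allowed x i] ++
    [seq rlam own i 0 | i <- enum C & ~~ allowed x i] ++
    [seq rlam own i nports | i <- enum C] by rewrite !map_cat -!map_comp.
have eu := enum_uniq C.
rewrite !cat_uniq !(map_inj_uniq (inj _)) !filter_uniq ?eu ?andbT /=; try by rewrite -?enumT ?eu.
apply/andP; split; apply/hasPn => r.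
- rewrite mem_cat => /orP[] /mapP [i]; rewrite ?mem_filter => Hi ->;
    apply/negP => /mapP [i']; rewrite mem_filter => /andP[al _] /rlam_inj [_ Ei].
    by case/andP: Hi; rewrite Ei al.
  by have := nports_gt0; lia.
- case/mapP=> i _ ->; apply/negP => /mapP [i' _ /rlam_inj [_ _]].
  by have := nports_gt0; lia.
Qed.

(** A second occurrence in the group would cover the skipped word and stop the propagation before
    the first port. *)
Lemma group_unique c x t t' lev lev' i s : kd c = inl x ->
  onth (lblock (c, None)) t = Some (lev, lam c i s) ->
  onth (lblock (c, None)) t' = Some (lev', lam c i s) -> t = t'.
Proof.
move=> kc; rewrite !onth_map /= /group kc !(onth_cat (group_head (inl x))) => E E'.
have at_ t0 lev0 : omap (fun e : nat * rword => (e.1, absw w c e.2))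
      (if t0 < size (group_head (inl x)) then onth (group_head (inl x)) t0
       else onth (dummies 1) (t0 - size (group_head (inl x)))) = Some (lev0, lam c i s) ->
    t0 < size (group_head (inl x)) /\
    nth rdummy [seq e.2 | e <- group_head (inl x)] t0 = rlam own i s.
  case: ltnP => lt; last first.
    by case Ed : (onth _ _) => [[j r]|] //=; have [_ _ ->] := onth_dummies Ed; case.
  case Eo : (onth _ _) => [[j r]|] //= Es.
  have Er : absw w c r = lam c i s by case: Es => _; rewrite /absw /lam => -> ->.
  split=> //; rewrite (nth_map (0, rdummy)) // (onth_nth _ _ _ _ Eo) /=.
  have : (j, r) \in group_head (inl x) by apply/onthP; exists t0.
  rewrite !mem_cat => /orP[|/orP[]] /mapP [i' _ [_ E0]]; move: Er;
    by rewrite E0 absw_lam => /lam_inj [_ -> ->].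
have [lt E1] := at_ _ _ E; have [lt' E1'] := at_ _ _ E'.
by apply/eqP; rewrite -(nth_uniq rdummy _ _ (head_uniq x)) ?size_map // E1 E1'.
Qed.

(** In the group of a cell of the row only the two ends of a chain occur, so the words in between
    have to be covered in the links. *)
Lemma group_word c t lev c' i s : onth (lblock (c, None)) t = Some (lev, lam c' i s) ->
  c = c' /\ (kd c = inr false \/ kd c = inr true \/ s = 0 \/ s = nports).
Proof.
rewrite onth_map /= /group => E.
have [r Er rw] : exists2 r, (lev, r) \in group_head (kd c) ++ dummies 1 & absw w c r = lam c' i s.
  case Eo : (onth _ _) E => [[lev' r]|] //= Es; exists r.
    by apply/onthP; exists t; rewrite Eo; case: Es => ->.
  by case: Es => _; rewrite /absw /lam => -> ->.
move: Er; rewrite mem_cat => /orP[|/mapP [j _ [_ E0]]]; last by move: rw; rewrite E0.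
case: (kd c) => [x|b]; rewrite /group_head.
  rewrite !mem_cat => /orP[|/orP[]] /mapP [i' _ [_ E0]]; move: rw;
    rewrite E0 absw_lam => /lam_inj [-> _ <-]; split=> //; by do 2 right; auto.
rewrite mem_cat !inE -orbA => /or3P[/eqP [_ E0]|/eqP [_ E0]|];
  try by move: rw; rewrite E0.
case/allpairsPdep => i' [s' [_ _ [_ E0]]]; move: rw; rewrite E0 absw_lam => /lam_inj [-> _ _].
by split=> //; case: b; [right; left|left].
Qed.

(** * From choices to tilings *)

Section Sound.

Variable sigma : nat * label -> nat -> nat.
Hypothesis sigma_ok : {in labels, forall l, choice_ok k (sigma l) (lblock l)}.
Hypothesis sigma_cover : forall l t j wd, l \in labels -> onth (lblock l) t = Some (j, wd) ->
  exists l' t' j', [/\ l' \in labels, onth (lblock l') t' = Some (j', wd) & sigma l' j' <> t'].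

Lemma port_label_in a i pi : w <= a < w + N -> port_label a i pi \in labels.
Proof.
by move=> /andP[wa aN]; case: pi => [[d []] j]; rewrite link_label //= (leq_ltn_trans _ aN) // leq_subr.
Qed.

Lemma group_choice a x : w <= a < w + N -> kd a = inl x ->
  exists2 i, allowed x i & onth (lblock (a, None)) (sigma (a, None) 0) = Some (0, lam a i 0).
Proof.
move=> aN ka; have aL : (a, None) \in labels by apply: group_label; rewrite size_zz; lia.
have [|[wd Eo] _] := sigma_ok aL (_ : 0 < k.-1); first by lia.
have Eo2 := Eo; rewrite onth_map /= /group ka in Eo2; move: Eo2.
case E : (onth (_ ++ _) _) => [[lev r]|] //= [E0 Er].
have : (lev, r) \in group_head (inl x) ++ dummies 1.
  by apply/onthP; exists (sigma (a, None) 0).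
rewrite E0 !mem_cat => /orP[/orP[|/orP[]]|] /mapP [i Hi []] //.
  move=> Er'; exists i; first by move: Hi; rewrite mem_filter => /andP[].
  by rewrite Eo -Er Er' absw_lam.
by move: Hi; rewrite mem_iota => /andP[i0 _] Ei; rewrite -Ei in i0.
Qed.

(* The word at the ingoing position of the port of rank [s] also occurs only at the
   outgoing position of the port of rank [s - 1] (for [s = 0], in the group), so
   covering it propagates the choice from port to port. *)
Lemma active_links a x i : w <= a < w + N -> kd a = inl x ->
  onth (lblock (a, None)) (sigma (a, None) 0) = Some (0, lam a i 0) ->
  forall pi, sigma (port_label a i pi) (pside pi) = pout i pi.
Proof.
move=> aN ka Eg pi; have [s le] : exists s, rank pi < s by exists (rank pi).+1.
have wa : w <= a by case/andP: aN.
elim: s pi le => // s IH pi le.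
have pl := port_label_in i pi aN.
have [[c l] [t' [j' [ll Eo ne]]]] := sigma_cover pl (port_in i pi wa).
case: l ll Eo ne => [[[d i'] j]|] ll Eo ne; last first.
  have [Ec H] := group_word Eo; rewrite Ec in ll Eo ne H.
  have r0 : rank pi = 0.
    by move: H (rank_lt pi); rewrite ka; case=> // -[|[]] // ->; rewrite ltnn.
  rewrite r0 in Eo; have Et := group_unique ka Eg Eo.
  case: ne; rewrite -Et; congr (sigma _ _).
  by move: Eo; rewrite -Et Eg => - [].
case: (link_cases Eo) => [[cs [is_ [pi' [El _ Es H]]]]|[_]] //.
(* Either the unskipped occurrence is the ingoing word itself, and the outgoing one is skipped; or
   it is the outgoing word of the preceding port, which is skipped by induction. *)
case: H => [[Et /lam_inj [Ea Ei /rank_inj Ep]]|[Et /lam_inj [Ea Ei Ep]]].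
  rewrite -Ea -Ei -Ep in El Es Et *.
  have [E|//] := port_choice wa (sigma_ok pl).
  by case: ne; rewrite -El Es Et.
case: ne; rewrite -El Es Et -Ea -Ei; apply: IH; lia.
Qed.

Lemma choices_tileable : tileable z w.
Proof.
(* The colour is decoded from the word skipped in the group; on the cells of the row the decoding
   succeeds, and [c0] fills in elsewhere. *)
pose col c := if onth (lblock (c + w, None)) (sigma (c + w, None) 0) is Some (_, (x.+1, _))
  then if (unpickle x : option (C * nat)) is Some (i, _) then i else c0 else c0.
have colP c : c < N -> exists x, [/\ onth z c = Some x, allowed x (col c), kd (c + w) = inl x &
   onth (lblock (c + w, None)) (sigma (c + w, None) 0) = Some (0, lam (c + w) (col c) 0)].
  move=> cN; have aN : w <= c + w < w + N by lia.
  have [x ka Ex] := kd_real aN; have [i ai Eo] := group_choice aN ka.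
  have -> : col c = i by rewrite /col Eo /= pickleK.
  by exists x; split=> //; rewrite addnK in Ex.
exists col; split=> [c x Ex|d c cN].
  have cN : c < N by rewrite -(onthTE z) Ex.
  by have [y [Ey ay _ _]] := colP c cN; move: Ey; rewrite Ex => - [->].
have cN1 : c < N by apply: leq_trans cN; rewrite ltnS leq_addr.
have [x [_ _ kx Ex]] := colP _ cN1; have [y [_ _ ky Ey]] := colP _ cN.
have aN : w <= c + w < w + N by lia.
have bN : w <= c + shift w d + w < w + N by lia.
have H1 := active_links aN kx Ex (d, false, col (c + shift w d)).
have H2 := active_links bN ky Ey (d, true, col c).
rewrite /= addnAC addnK in H2.
apply: (@link_choice (c + w) d _ _ (sigma (c + w, Some (d, col c, col (c + shift w d))))).
- by apply: sigma_ok; rewrite link_label; lia.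
- exact: H1.
- exact: H2.
Qed.

End Sound.

(** * From tilings to choices *)

Section Complete.

Variable col : nat -> C.
Hypothesis col_allowed : forall c x, onth z c = Some x -> allowed x (col c).
Hypothesis col_R : forall d c, c + shift w d < N -> R d (col c) (col (c + shift w d)).

Definition active c i := (w <= c < w + N) && (col (c - w) == i).

Definition tile_choice (cl : nat * label) (j : nat) : nat :=
  let: (c, l) := cl in
  match l with
  | None => if j is j'.+1 then size (group_head (kd c)) + j' else
      if kd c is inl x then
        index (rlam own (col (c - w)) 0) [seq e.2 | e <- group_head (inl x)] else 0
  | Some (d, i, i') =>
      match j with
      | 0 => if active c i then out_pos (R d i i') false else in_pos false
      | 1 => if active (c + shift w d) i' then out_pos (R d i i') true else in_pos true
      | _ => j + 2
      end
  end.

Lemma onth_dummies_at j0 j : j0 <= j < k.-1 -> onth (dummies j0) (j - j0) = Some (j, rdummy).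
Proof.
move=> /andP[le lt]; rewrite onth_map.
case E : (onth _ _) => [j'|]; last first.
  by have := onthTE (iota j0 (k.-1 - j0)) (j - j0); rewrite E size_iota /=; lia.
by have := onth_nth 0 _ _ _ E; rewrite nth_iota ?subnKC => [<-|//|]; last lia.
Qed.

Lemma head_index x i : allowed x i ->
  onth (group_head (inl x)) (index (rlam own i 0) [seq e.2 | e <- group_head (inl x)])
  = Some (0, rlam own i 0).
Proof.
move=> al; set hd := group_head _; set t := index _ _.
have win : rlam own i 0 \in [seq e.2 | e <- hd].
  rewrite map_cat mem_cat -map_comp; apply/orP; left; apply/mapP; exists i => //.
  by rewrite mem_filter al mem_enum.
have tl : t < size hd by rewrite -(size_map snd) index_mem.
case E : (onth hd t) => [[lev r]|]; last by have := onthTE hd t; rewrite E tl.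
have Er : r = rlam own i 0.
  have := nth_index rdummy win; rewrite -/t (nth_map (0, rdummy)) //.
  by rewrite (onth_nth _ _ _ _ E).
have : (lev, r) \in hd by apply/onthP; exists t.
rewrite Er !mem_cat => /orP[|/orP[]] /mapP [i' Hi [-> /(pcan_inj pickleK) [Ei]]] //.
  by move: Hi; rewrite mem_filter -Ei al.
by have := nports_gt0; lia.
Qed.

Lemma real_kind c x : c < size zz -> kd c = inl x -> w <= c < w + N.
Proof.
move=> cl kc; apply/andP; split; rewrite leqNgt; apply/negP => le.
  by rewrite kd_left in kc.
by rewrite kd_right // -ltnS in kc.
Qed.

Lemma tile_choice_ok : {in labels, forall l, choice_ok k (tile_choice l) (lblock l)}.
Proof.
case=> c [[[d i] i']|] cL j jk.
- have out_mono : j.+1 < k.-1 -> tile_choice (c, Some (d, i, i')) j <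
      tile_choice (c, Some (d, i, i')) j.+1.
    case: j jk => [|[|j]] jk /= _; [|by case: (active _ _); case: (R _ _ _)|lia].
    case: (boolP (active c i)) => [/andP[cN /eqP ci]|_]; last first.
      by case: (active _ _); case: (R _ _ _).
    case: (boolP (active (c + shift w d) i')) => [/andP[cN' /eqP ci']|_]; last by case: (R _ _ _).
    have -> : R d i i' by rewrite -ci -ci' -addnBAC ?col_R //; lia.
    by [].
  split=> //; rewrite onth_map /= /link onth_cat (fun_if (@size _)) /= if_same.
  case: j jk {out_mono} => [|[|j]] jk /=.
  + by case: (active c i); case: (R d i i'); eexists.
  + by case: (active _ i'); case: (R d i i'); eexists.
  + rewrite addn2 /= (@onth_dummies_at 2 j.+2) ?subn2 /=; first by eexists.
    by lia.
- have cl := label_lt cL; split; last first.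
    case: j jk => [|j] jk jk1 /=; last by lia.
    case kc : (kd c) => [x|b]; last by rewrite addn0.
    have [y ky Ey] := kd_real (real_kind cl kc).
    have := head_index (col_allowed Ey).
    move: ky; rewrite kc => - [<-] E; rewrite addn0 -(size_map snd) index_mem.
    have := onthTE (group_head (inl x)) (index (rlam own (col (c - w)) 0)
      [seq e.2 | e <- group_head (inl x)]).
    by rewrite E -(size_map snd) index_mem => /esym.
  rewrite onth_map /=; case: j jk => [|j] jk.
    case kc : (kd c) => [x|b]; last by exists (0, 0).
    have [y ky Ey] := kd_real (real_kind cl kc).
    have E := head_index (col_allowed Ey).
    move: ky E; rewrite kc => - [<-] E; rewrite /group onth_cat.
    by rewrite ifT ?E -?onthTE ?E //; eexists.
  rewrite /group onth_cat ltnNge leq_addr /= addKn.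
  by have := @onth_dummies_at 1 j.+1 jk; rewrite subn1 => ->; eexists.
Qed.

Definition unchosen (wd : aword) := exists l t j,
  [/\ l \in labels, onth (lblock l) t = Some (j, wd) & tile_choice l j <> t].

Lemma unchosen_dummy : unchosen (0, 0).
Proof.
exists (0, None), 1, 0; rewrite group_label ?size_zz ?(leq_trans w_gt0) ?leq_addr //.
  by split=> //; [rewrite onth_map /= kd_left|rewrite /= kd_left].
by rewrite -addnA leq_addr.
Qed.

Lemma unchosen_head c t wd : c < size zz ->
  onth (group_head (kd c)) t = Some (1, wd) -> unchosen (absw w c wd).
Proof.
move=> cl E; have tl : t < size (group_head (kd c)) by rewrite -onthTE E.
exists (c, None), t, 1; rewrite group_label //; split=> //=; last by move=> Et; rewrite -Et addn0 ltnn in tl.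
by rewrite onth_map /= /group onth_cat tl E.
Qed.

Lemma port_tile_choice c i pi : w <= c ->
  tile_choice (port_label c i pi) (pside pi) = if active c i then pout i pi else pin pi.
Proof.
move=> wc; case: pi => [[d []] j] //=; rewrite subnK //.
exact: leq_trans (shift_le d) wc.
Qed.

(** An active candidate leaves all its ingoing words, an inactive one all its outgoing words. What
    remains are the end of an active chain, which has a spare occurrence, and the start of an
    inactive one, which the group skips only for the picked colour. *)
Lemma unchosen_lam c i s : c < size zz -> s <= nports -> unchosen (lam c i s).
Proof.
move=> cl sl.
have in_head r : (1, r) \in group_head (kd c) -> unchosen (absw w c r).
  by case/onthP => t; apply: unchosen_head.
case kc : (kd c) => [x|b]; last first.
  rewrite -(absw_lam w); apply: in_head; rewrite kc /group_head mem_cat; apply/orP; right.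
  by apply/allpairsPdep; exists i, s; rewrite mem_enum mem_iota.
have cN := real_kind cl kc; have wc : w <= c by case/andP: cN.
have [->|sn] := eqVneq s nports.
  rewrite -(absw_lam w); apply: in_head; rewrite kc !mem_cat; apply/orP; right.
  by apply/orP; right; apply/mapP; exists i; rewrite ?mem_enum.
have [ai|nai] := boolP (active c i).
  have [pi Ep] : exists pi, rank pi = s by apply: rank_surj; lia.
  exists (port_label c i pi), (pin pi), (pside pi).
  rewrite port_label_in // -Ep port_in // port_tile_choice // ai; split=> //.
  exact: nesym (@pin_out i pi).
case: s sl sn => [|s] sl sn; last first.
  have [pi Ep] : exists pi, rank pi = s by apply: rank_surj.
  exists (port_label c i pi), (pout i pi), (pside pi).
  rewrite port_label_in // -Ep port_out // port_tile_choice // (negbTE nai); split=> //.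
  exact: pin_out.
have [al|nal] := boolP (allowed x i); last first.
  rewrite -(absw_lam w); apply: in_head; rewrite kc !mem_cat; apply/orP; right.
  by apply/orP; left; apply/mapP; exists i => //; rewrite mem_filter nal mem_enum.
have E := head_index al; set t := index _ _ in E.
have tl : t < size (group_head (inl x)) by rewrite -onthTE E.
have Et : onth (lblock (c, None)) t = Some (0, lam c i 0).
  by rewrite onth_map /= /group kc onth_cat tl E /= absw_lam.
exists (c, None), t, 0; rewrite group_label //; split=> //= Ec.
have [y ky Ey] := kd_real cN.
have Ecol := head_index (col_allowed Ey); move: ky Ecol; rewrite kc => - [<-] Ecol.
move: Ec; rewrite kc => Ec; move: Ecol; rewrite Ec E => - [/(pcan_inj pickleK) [Ei]].
by move: nai; rewrite /active cN -Ei eqxx.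
Qed.

Lemma choices_of_tiling l t j wd : l \in labels -> onth (lblock l) t = Some (j, wd) ->
  unchosen wd.
Proof.
case: l => c [[[d i] i']|] lL.
- case/link_cases => [[cs [is_ [pi [El /andP[_ cs_le] _ H]]]]|[_ ->]]; last exact: unchosen_dummy.
  have cl : cs < size zz.
    by move: lL; rewrite link_label size_zz; lia.
  by case: H => [[_ ->]|[_ ->]]; apply: unchosen_lam => //; [apply: ltnW|]; apply: rank_lt.
- have cl := label_lt lL; rewrite onth_map /= => E.
  have [r Er ->] : exists2 r, (j, r) \in group (kd c) & wd = absw w c r.
    case Eo : (onth _ _) E => [[j' r]|] //= [<- <-]; exists r => //.
    by apply/onthP; exists t.
  move: Er; rewrite mem_cat => /orP[|/mapP [j' _ [_ ->]]]; last exact: unchosen_dummy.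
  case: (kd c) => [x|b]; rewrite /group_head.
    rewrite !mem_cat => /orP[|/orP[]] /mapP [i _ [_ ->]]; rewrite absw_lam;
      exact: unchosen_lam.
  rewrite mem_cat !inE -orbA => /or3P[/eqP [_ ->]|/eqP [_ ->]|];
    try exact: unchosen_dummy.
  case/allpairsPdep => i [s [_ sl [_ ->]]]; rewrite absw_lam; apply: unchosen_lam => //.
  by move: sl; rewrite mem_iota ltnS.
Qed.

End Complete.

Lemma tileable_choices :
  (exists sigma, (forall b, b < size (all_blocks w zz) ->
       choice_ok k (sigma b) (nth [::] (all_blocks w zz) b)) /\
     choices_cover (all_blocks w zz) sigma) <-> tileable z w.
Proof.
rewrite all_blocksE; apply: (iff_trans (labelled_choices _ _ labels_uniq)).
split=> [[sigma [ok cov]]|[col [al Rok]]]; first exact: choices_tileable ok cov.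
exists (tile_choice col); split; first exact: tile_choice_ok.
by move=> l t j wd lL E; have := choices_of_tiling al lL E.
Qed.

Lemma all_blocks_ok : all (@levels_ok k _) (all_blocks w zz).
Proof.
rewrite all_blocksE all_map; apply/allP => [[c l]] lL /=; rewrite /levels_ok all_map.
apply/allP => [[lev r]] /= H.
have dum j0 : (lev, r) \in dummies j0 -> lev < k.-1.
  by case/mapP => j; rewrite mem_iota => Hj [-> _]; lia.
case: l {lL} H => [[[d i] i']|] /=.
  rewrite mem_cat => /orP[|/dum //]; case: (R d i i'); rewrite !inE;
  by case/or4P => /eqP [-> _]; lia.
rewrite mem_cat => /orP[|/dum //]; case: (kd c) => [x|b]; rewrite /group_head.
  by rewrite !mem_cat => /orP[|/orP[]] /mapP [i _ [-> _]]; lia.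
rewrite mem_cat !inE -orbA => /or3P[/eqP [-> _]|/eqP [-> _]|]; [lia|lia|].
by case/allpairsPdep => i [s [_ _ [-> _]]]; lia.
Qed.

End Instance.

End Tiling.


(* A letter is written in a self-delimiting unary code, which is canonical as a
   binary word, so that a machine need not do any arithmetic to print it. *)
Definition letter_code (e c : nat) : seq bool := nseq e true ++ false :: nseq c.+1 true.

Definition letter (e c : nat) : nat := bval (letter_code e c).

Lemma binary_letter e c : binary (letter e c) = letter_code e c.
Proof.
apply: binary_bval; rewrite /canonical /letter_code last_cat /=.
by elim: c.
Qed.

Lemma letter_inj e c e' c' : letter e c = letter e' c' -> e = e' /\ c = c'.
Proof.
move/(congr1 binary); rewrite !binary_letter /letter_code.
elim: e e' => [|e IH] [|e'] //= [].
  by move/(congr1 size); rewrite /= !size_nseq => - [].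
by case/IH => -> ->.
Qed.

(** * Letters for tokens *)

Section Letters.

Variable k : nat.

(** [x * k + r] is a base [k] numeral, injective because [r < k]. The first component 0 is reserved
    for private letters, which are told apart by their position. *)
Definition name (i : nat) (t : token aword) : nat :=
  if t is Some ((x, c), r) then letter (1 + x * k + r) c else letter 0 i.

Fixpoint string_from (q : nat) (ts : seq (token aword)) : seq nat :=
  if ts is t :: ts' then name q t :: string_from q.+1 ts' else [::].

Lemma string_from_cat q ts ts' :
  string_from q (ts ++ ts') = string_from q ts ++ string_from (q + size ts) ts'.
Proof.
elim: ts q => [|t ts IH] q /=; first by rewrite addn0.
by rewrite IH addSnnS.
Qed.

Lemma size_string_from q ts : size (string_from q ts) = size ts.
Proof. by elim: ts q => //= t ts IH q; rewrite IH. Qed.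

Lemma nth_string_from q ts i : i < size ts ->
  nth 0 (string_from q ts) i = name (q + i) (nth None ts i).
Proof.
elim: ts q i => // t ts IH q [|i] il /=; first by rewrite addn0.
by rewrite IH // addSnnS.
Qed.

Definition offsets_ok (t : token aword) := if t is Some (_, r) then r < k else true.

Lemma string_realizes ts : all offsets_ok ts -> realizes 0 (string_from 0 ts) ts.
Proof.
move=> ok; split=> [|i j il jl]; first exact: size_string_from.
rewrite !nth_string_from // !add0n.
have /(all_nthP None) ok' := ok.
split=> [|[-> //|[<-]]]; last by case: (nth None ts i) => [[[x c] r]|].
have := ok' i il; have := ok' j jl; rewrite /name.
case: (nth None ts i) => [[[x c] r]|]; case: (nth None ts j) => [[[x' c'] r']|] /= rk rk'.
- case/letter_inj => E ->; right; split=> //.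
  by have [-> ->] : x = x' /\ r = r' by apply: (@row_inj k); lia.
- by case/letter_inj.
- by case/letter_inj.
- by case/letter_inj; left.
Qed.

Lemma block_tokens_ok ws : all offsets_ok (block_tokens k (ws : block aword)).
Proof.
apply/allP => t /mapP [y _ ->]; rewrite /block_token.
by case: (onth _ _) => [[j w]|] //; case: ifP => //= H; lia.
Qed.

Lemma tokens_ok bs : all offsets_ok (tokens k (bs : seq (block aword))).
Proof.
rewrite !all_cat !all_nseq !orbT andbT /=.
by elim: bs => //= ws bs IH; rewrite all_cat IH andbT; apply: block_tokens_ok.
Qed.

End Letters.

(** * The instance, split by cells *)

Section Instance.

Variables (C Z : finType) (c0 : C) (allowed : Z -> pred C) (R : bool -> rel C).
Variables (k : nat) (k_gt2 : 2 < k).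

Definition instance_blocks z w := all_blocks allowed R k w (padded z w).

Definition instance z w : seq (option bool) :=
  encode (string_from k 0 (tokens k (instance_blocks z w))) (budget (instance_blocks z w)).

Lemma instance_correct z w : 0 < w ->
  k_sharp_attractor k (instance z w) <-> tileable allowed R z w.
Proof.
move=> w0; rewrite -(tileable_choices c0 allowed R k_gt2 z w0).
have k1 : 1 < k by apply: ltnW.
have real := string_realizes (tokens_ok k (instance_blocks z w)).
rewrite -(block_attractor k1 (all_blocks_ok allowed R k_gt2 z w0) real).
rewrite -sharp_attractor_mask; last exact: ltnW.
split=> [[T [p [/encode_inj [-> ->]]]] //|H].
by exists (string_from k 0 (tokens k (instance_blocks z w))), (budget (instance_blocks z w)).
Qed.

(** The tokens of a cell are those of its kind with the cell number filled in, so they come from a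
    constant text. *)
Definition rel_token (w c : nat) (t : token rword) : token aword :=
  omap (fun e : rword * nat => (absw w c e.1, e.2)) t.

Lemma block_tokens_abs w c (b : block rword) :
  block_tokens k (abs_block w c b) = map (rel_token w c) (block_tokens k b).
Proof.
rewrite /block_tokens /block_len size_map /mkseq -map_comp; apply: eq_map => y /=.
rewrite /block_token onth_map; case: (onth _ _) => [[j r]|] //=.
by case: ifP.
Qed.

Definition cell_tokens (x : kind Z) : seq (token rword) :=
  flatten (map (@block_tokens k _) (cell_blocks allowed R k x)).

Definition cell_budget (x : kind Z) : nat :=
  \sum_(ws <- cell_blocks allowed R k x) 2 * size ws.

Lemma flatten_map_flatten (X Y : Type) (B : X -> seq Y) (g : nat -> seq X) h s :
  (forall c, flatten (map B (g c)) = h c) ->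
  flatten (map B (flatten (map g s))) = flatten (map h s).
Proof. by move=> E; elim: s => //= c s IH; rewrite map_cat flatten_cat IH E. Qed.

Lemma tokens_all_blocks w zz : tokens k (all_blocks allowed R k w zz) =
  nseq k.-1 None ++
  flatten (mkseq (fun c => map (rel_token w c) (cell_tokens (nth (inr true) zz c))) (size zz))
  ++ nseq k None.
Proof.
rewrite /tokens; congr (_ ++ (_ ++ _)); apply: flatten_map_flatten => c.
rewrite /cell_tokens map_flatten -!map_comp; congr flatten.
by apply: eq_map => b /=; rewrite block_tokens_abs.
Qed.

Lemma budget_all_blocks w zz : budget (all_blocks allowed R k w zz) =
  (\sum_(x <- zz) cell_budget x).+1.
Proof.
rewrite /budget /all_blocks big_flatten /mkseq big_map; congr _.+1.
rewrite -[in RHS](mkseq_nth (inr true) zz) /mkseq big_map; apply: eq_bigr => c _.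
by rewrite big_map; apply: eq_bigr => b _; rewrite size_map.
Qed.

End Instance.


(** * Computations as tilings *)

(* The cell seen at column [J] when the head is kept fixed at column [h], so that
   the tape moves instead of the head. *)
Definition column (G : Type) (h : nat) (t : tape G) (J : nat) : option G :=
  if J < h then nth None (tape_left t) (h.-1 - J)
  else nth None (tape_cur t :: tape_right t) (J - h).

Lemma column_head (G : Type) h (t : tape G) : column h t h = tape_cur t.
Proof. by rewrite /column ltnn subnn. Qed.

Lemma column_write (G : Type) h c (t : tape G) J :
  column h (tape_write c t) J = if J == h then c else column h t J.
Proof.
rewrite /column /=; case: ltngtP => [//|lt|->]; last by rewrite subnn.
by case E : (J - h) => //; lia.
Qed.

Lemma column_move (G : Type) h mv (t : tape G) J : 0 < h -> 0 < J ->
  column h (tape_move mv t) J =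
  column h t (match mv with MoveLeft => J.-1 | Stay => J | MoveRight => J.+1 end).
Proof.
move=> h0 J0; case: t => l c r; case: mv => //; rewrite /column /=.
- have -> : (J.-1 < h) = (J <= h) by lia.
  case: (ltngtP J h) => [lt|lt|->].
  + by rewrite nth_behead; congr nth; lia.
  + by case E : (J - h) => [|d] /=; [lia|congr nth; lia].
  + by rewrite subnn subnn -nth0; case: l.
- case: (ltngtP J h) => [lt|lt|->].
  + case: (ltnP J.+1 h) => le.
      by have -> : h.-1 - J = (h.-1 - J.+1).+1 by lia.
    have E : J.+1 = h by lia.
    by rewrite -E subnn /= subnn.
  + rewrite ltnNge (leq_trans (ltnW lt)) //= subSn ?(ltnW lt) //=.
    by case E : (J - h) => [|d] /=; [lia|rewrite nth_behead].
  + by rewrite ltnNge leqnSn subnn subSnn /=; case: r.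
Qed.

Section Tableau.

Variables (A : finType) (M : turing_machine (A + bool)%type bool).

Let Q := tm_state M.
Let content : finType := {ffun tm_tape M -> option (tm_sym M)}.

(* Contents of a cell of every tape, is it at the head, is it the first of a row. *)
Let cell : finType := (content * (bool * bool))%type.
Definition at_head (c : cell) := c.2.1.
Definition at_border (c : cell) := c.2.2.

(* A colour broadcasts the state and the scanned symbols along the row, and
   overlaps with both neighbours; the last flag marks a cell of the certificate
   in the first row. *)
Record colour_rec := Colour {
  c_state : Q; c_scan : content; c_left : cell; c_mid : cell; c_right : cell;
  c_cert : bool }.

Definition colour : finType := (Q * content * (cell * cell * cell) * bool)%type.
Definition mk (x : colour_rec) : colour :=
  (c_state x, c_scan x, (c_left x, c_mid x, c_right x), c_cert x).
Definition un (x : colour) : colour_rec :=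
  let: (q, s, (l, m, r), b) := x in Colour q s l m r b.

Lemma mkK x : un (mk x) = x. Proof. by case: x. Qed.

Definition blank : content := [ffun=> None].

(* First row: head flag, border flag, and the symbol of the input tape: a
   letter of the instance, a letter of the certificate ([Some None]), or a blank.
   Then [inr false] for the inner rows and [inr true] for the last one. *)
Definition tkind : finType := ((bool * bool * option (option A)) + bool)%type.

Definition spec_ok (sp : option (option A)) (v : content) : bool :=
  [forall i, if i == tm_in M then
     match sp with
     | Some (Some a) => v i == Some (tm_of_input M (inl a))
     | Some None => (v i == None) || [exists b, v i == Some (tm_of_input M (inr b))]
     | None => v i == None
     end else v i == None].

(** On the helix the cell to the left of a border is the last one of the previous row. Demanding
    blank contents and no head there makes it look like an empty part of the tape. *)
Definition coherent (x : colour_rec) : bool :=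
  (at_head (c_mid x) ==> (c_scan x == (c_mid x).1)) &&
  (at_border (c_mid x) ==>
     [&& (c_mid x).1 == blank, (c_left x).1 == blank & ~~ at_head (c_left x)]).

(** The blank after the answer rules out longer outputs. *)
Definition accepting (out1 out2 : option (tm_sym M)) :=
  (out1 == Some (tm_of_output M true)) && (out2 == None).

Definition tallowed (k : tkind) (y : colour) : bool :=
  let x := un y in
  coherent x && match k with
    | inl (h, b, sp) => [&& at_head (c_mid x) == h, at_border (c_mid x) == b,
         c_state x == tm_start M, c_cert x == (sp == Some None) & spec_ok sp (c_mid x).1]
    | inr false => true
    | inr true => at_head (c_mid x) ==>
        accepting ((c_mid x).1 (tm_out M)) ((c_right x).1 (tm_out M))
    end.

Definition next_state (q : Q) (s : content) : Q :=
  if tm_halt q then q else (tm_delta q s).1.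

Definition next_content (q : Q) (s : content) (l m r : cell) : content :=
  if tm_halt q then m.1 else
  [ffun i => let a := (tm_delta q s).2 i in
     let written (c : cell) := if at_head c then a.1 else c.1 i in
     match a.2 with MoveLeft => written l | Stay => written m | MoveRight => written r end].

(** Along a row only the scanned symbols are compared: the state then agrees in all columns by
    induction on rows, each column computing it from the same scan. The last clause makes the
    certificate a word, since a blank can only be followed by blanks. *)
Definition trel (d : bool) (y y' : colour) : bool :=
  let x := un y in let x' := un y' in
  if d then
    [&& (c_mid x').2 == (c_mid x).2, c_state x' == next_state (c_state x) (c_scan x)
      & (c_mid x').1 == next_content (c_state x) (c_scan x) (c_left x) (c_mid x) (c_right x)]
  else
    [&& c_right x == c_mid x', c_mid x == c_left x',
      ~~ at_border (c_mid x') ==> (c_scan x == c_scan x')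
    & [&& c_cert x, c_cert x' & (c_mid x).1 (tm_in M) == None] ==>
      ((c_mid x').1 (tm_in M) == None)].

Section Fixed.

Variables (x : seq A) (P Tm : nat).
Let n := size x.
Let T := Tm.+1.
(** This equals [n + P + T + 1], a bound on what [T] steps can reach plus a margin: the columns
    below 2 and from [W] on stay blank, so the two ends of a row fit together. With [T = Tm + 1] the
    first and the last row differ even for [Tm = 0]. *)
Definition reach_len := n + P + Tm + 2.
Let h := reach_len.+1.
Definition width := (2 * reach_len).+1.
Let W := width.

Definition specs : seq (option (option A)) :=
  map (fun a => Some (Some a)) x ++ nseq P (Some None) ++ nseq (Tm + 3) None.

Definition first_row : seq tkind :=
  inl (false, true, None) :: nseq reach_len.-1 (inl (false, false, None)) ++
  (if specs is sp :: sps then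
     inl (true, false, sp) :: map (fun sp => inl (false, false, sp)) sps else [::]).

Definition rows : seq tkind :=
  first_row ++ nseq (W * Tm) (inr false) ++ nseq W (inr true).

Lemma size_specs : size specs = h.
Proof. by rewrite !size_cat !size_nseq size_map /h /reach_len -/n; lia. Qed.

Definition row_kind (t j : nat) : tkind :=
  if t == 0 then inl (j == reach_len, j == 0, if j < reach_len then None else nth None specs (j - reach_len))
  else inr (t == T).

Lemma size_first_row : size first_row = W.
Proof.
rewrite /first_row /= size_cat size_nseq.
have := size_specs; case: specs => [|sp sps] //= [E].
by rewrite size_map E /W /width /reach_len; lia.
Qed.

Lemma nth_first_row j : j < W -> nth (inr false) first_row j = row_kind 0 j.
Proof.
move=> jW; rewrite /first_row /row_kind /=.
have := size_specs; case: specs => [|sp sps] //= [E].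
have hp : 0 < reach_len by rewrite /reach_len; lia.
case: j jW => [|j] jW /=; first by rewrite hp; case: reach_len hp.
rewrite nth_cat size_nseq; case: (ltnP j reach_len.-1) => le.
  have -> : (j.+1 == reach_len) = false by apply/eqP; lia.
  by rewrite nth_nseq le ifT //; lia.
have -> : (j.+1 < reach_len) = false by apply/negbTE; lia.
have [Eh|ne] := eqVneq j.+1 reach_len.
  have -> : j - reach_len.-1 = 0 by lia.
  by have -> : j.+1 - reach_len = 0 by lia.
have -> : j - reach_len.-1 = (j - reach_len).+1 by lia.
have -> : j.+1 - reach_len = (j - reach_len).+1 by lia.
rewrite /= (nth_map None) //; rewrite E; move: jW; rewrite /W /width /h; lia.
Qed.

Lemma size_rows : size rows = W * T.+1.
Proof. by rewrite !size_cat !size_nseq size_first_row /T; lia. Qed.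

Lemma onth_rows t j : t <= T -> j < W -> onth rows (t * W + j) = Some (row_kind t j).
Proof.
move=> tT jW; have lt : t * W + j < size rows by rewrite size_rows; nia.
case E : (onth rows (t * W + j)) => [y|]; last by have := onthTE rows (t * W + j); rewrite E lt.
congr Some; rewrite -(onth_nth (inr false) _ _ _ E).
rewrite /rows nth_cat size_first_row; case: t tT {lt E} => [|t] tT.
  by rewrite mul0n add0n jW nth_first_row.
have -> : (t.+1 * W + j < W) = false by rewrite mulSn; lia.
have -> : t.+1 * W + j - W = t * W + j by rewrite mulSn; lia.
rewrite nth_cat size_nseq /row_kind /T eqSS -[t.+1 == 0]/false.
have [Et|ne] := eqVneq t Tm.
  have -> : (t * W + j < W * Tm) = false by rewrite Et mulnC; lia.
  have -> : t * W + j - W * Tm = j by rewrite Et mulnC; lia.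
  by rewrite nth_nseq jW.
have lt1 : t < Tm by rewrite ltn_neqAle ne -ltnS.
have lt2 : t * W + j < W * Tm.
  apply: (@leq_trans (t.+1 * W)); first by rewrite mulSn; lia.
  by rewrite mulnC leq_mul2l lt1 orbT.
by rewrite lt2 nth_nseq lt2.
Qed.

Lemma nth_specs i : nth None specs i =
  if onth x i is Some a then Some (Some a)
  else if i < n + P then Some None else None.
Proof.
rewrite /specs nth_cat size_map -/n; case: (ltnP i n) => ix.
  case E : (onth x i) => [a|]; last by have := onthTE x i; rewrite E ix.
  by rewrite (nth_map a) // (onth_nth _ _ _ _ E).
rewrite onth_default // nth_cat size_nseq -ltn_subLR // -/n.
by case: ltnP => le; rewrite nth_nseq ?le // if_same.
Qed.

Lemma reach_len_gt1 : 1 < reach_len. Proof. by rewrite /reach_len; lia. Qed.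

(** * From accepting runs to tilings *)

Section Run.

Variable u : seq bool.
Hypothesis u_size : size u <= P.
Let w : seq (A + bool) := map inl x ++ map inr u.
Definition cfg t := iter t (@step _ _ M) (@init_config _ _ M w).

Definition cont t J : content := [ffun i => column h (cfg_tapes (cfg t) i) J].

Lemma cfg_size t i : size (tape_left (cfg_tapes (cfg t) i)) <= t /\
  size (tape_right (cfg_tapes (cfg t) i)) <= n + P + t.
Proof.
elim: t => [|t [IHl IHr]].
  rewrite /= /tape_of_word /= size_map size_behead; split=> //.
  case: (i == _) => //; rewrite size_map size_cat !size_map -/n; lia.
rewrite /cfg /= -/(cfg t) /step; case: (tm_halt _) => /=; first by lia.
case: (tm_delta _ _) => q act /=; move: IHl IHr; case: (cfg_tapes _ i) => l c r /=.
by case: (act i).2 => /=; rewrite ?size_behead; lia.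
Qed.

Lemma cont_blank t J : t <= T -> J < 2 \/ W <= J -> cont t J = blank.
Proof.
move=> tT HJ; apply/ffunP => i; rewrite !ffunE /column.
have [ls rs] := cfg_size t i; have E : h = (n + P + Tm + 2).+1 by [].
case: HJ => HJ; first by rewrite ifT ?nth_default //; lia.
rewrite /W /width /reach_len in HJ; rewrite ifF ?nth_default //=; first by lia.
by apply/negbTE; lia.
Qed.

Lemma cont_next t J : 0 < J ->
  let q := cfg_state (cfg t) in let s := cont t h in
  cfg_state (cfg t.+1) = next_state q s /\
  forall l m r : cell, l.1 = cont t J.-1 -> m.1 = cont t J -> r.1 = cont t J.+1 ->
    at_head l = (J.-1 == h) -> at_head m = (J == h) -> at_head r = (J.+1 == h) ->
    cont t.+1 J = next_content q s l m r.
Proof.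
move=> J0 q s; have Es : s = [ffun i => tape_cur (cfg_tapes (cfg t) i)].
  by apply/ffunP => i; rewrite !ffunE column_head.
rewrite /next_state /next_content /cfg iterS -/(cfg t) /step -/q.
case: ifP => hq; first by split=> // l m r _ -> _ _ _ _; rewrite /cont /cfg iterS -/(cfg t) /step -/q hq.
rewrite -Es; case Ed : (tm_delta q s) => [q' act]; split=> // l m r El Em Er Hl Hm Hr.
apply/ffunP => i; rewrite !ffunE /cfg iterS -/(cfg t) /step -/q hq -Es Ed /=.
rewrite -[X in column h X J]/(tape_move (act i).2
  (tape_write (act i).1 (cfg_tapes (cfg t) i))).
rewrite column_move // Hl Hm Hr El Em Er !ffunE.
by case: (act i).2; rewrite column_write.
Qed.

Lemma nth_tape_of_word (G : Type) (v : seq G) i :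
  nth None (tape_cur (tape_of_word v) :: tape_right (tape_of_word v)) i = nth None (map Some v) i.
Proof. by case: v i => [|a v] [|i] //=; rewrite nth_nil. Qed.

Lemma cont_init J : 0 < J -> cont 0 J = [ffun i =>
  if (i == tm_in M) && (h <= J) then
    nth None (map Some (map (@tm_of_input _ _ M) w)) (J - h) else None].
Proof.
move=> J0; apply/ffunP => i; rewrite !ffunE /column /=.
case: ltnP => hJ; first by rewrite andbF nth_nil.
by rewrite nth_tape_of_word andbT; case: ifP => // _; rewrite nth_nil.
Qed.

Lemma onth_input i : onth (map (@tm_of_input _ _ M) w) i =
  if onth x i is Some a then Some (tm_of_input M (inl a))
  else if n <= i then omap (fun b => tm_of_input M (inr b)) (onth u (i - n)) else None.
Proof.
rewrite onth_map onth_cat size_map !onth_map -/n; case: ltnP => ix.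
  by have := onthTE x i; rewrite ix; case: (onth x i).
by rewrite (@onth_default _ i x) //; case: (onth u _).
Qed.

Definition run_accepts :=
  accepting (tape_cur (cfg_tapes (cfg T) (tm_out M)))
            (head None (tape_right (cfg_tapes (cfg T) (tm_out M)))).

Lemma run_acceptsE :
  run_accepts = accepting (cont T h (tm_out M)) (cont T h.+1 (tm_out M)).
Proof.
rewrite !ffunE column_head /column ltnNge leqnSn /= subSnn /=.
by rewrite /run_accepts; case: (tape_right _).
Qed.

(** Cell [j] of a row has column [j + 1] in its middle, so its overlaps never need a negative
    column. The border flag is periodic because column [W + 1] is also the first cell of the next
    row. *)
Definition true_cell t J : cell := (cont t J, (J == h, J %% W == 1)).

Definition true_colour t j : colour_rec :=
  Colour (cfg_state (cfg t)) (cont t h) (true_cell t j) (true_cell t j.+1)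
    (true_cell t j.+2) ((t == 0) && (reach_len + n <= j < reach_len + n + P)).

Lemma border_first j : j < W -> (j.+1 %% W == 1) = (j == 0).
Proof.
move=> jW; have hg := reach_len_gt1; move: jW; rewrite leq_eqVlt => /predU1P [E|jW].
  by rewrite E modnn; apply/esym/negbTE; move: E; rewrite /W /width; lia.
by rewrite modn_small.
Qed.

Lemma true_coherent t j : t <= T -> j < W -> coherent (true_colour t j).
Proof.
move=> tT jW; apply/andP; split; apply/implyP.
  by move=> /= /eqP [->]; rewrite eqxx.
rewrite /at_border /= border_first // => /eqP ->.
by rewrite !cont_blank ?eqxx //; left.
Qed.

Lemma true_first j : j < W ->
  tallowed (row_kind 0 j) (mk (true_colour 0 j)).
Proof.
move=> jW; rewrite /tallowed mkK true_coherent //= /at_head /at_border /=.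
rewrite border_first // eqSS !eqxx /=; apply/andP; split.
  apply/eqP; case: (ltnP j reach_len) => jh; first by rewrite -[RHS]/false; apply/negbTE; lia.
  rewrite nth_specs; have := onthTE x (j - reach_len); rewrite -/n.
  case: (onth x _) => [a|] /= E; first by rewrite -[RHS]/false; apply/negbTE; lia.
  case: (ltnP (j - reach_len) (n + P)) => le; last by rewrite -[RHS]/false; apply/negbTE; lia.
  by rewrite eqxx; lia.
apply/forallP => i; rewrite cont_init // ffunE; case: eqP => //= _.
rewrite ltnS subSS; case: (ltnP j reach_len) => jh //; rewrite -onthE onth_input nth_specs.
case E : (onth x _) => [a|]; first by [].
have := onthTE x (j - reach_len); rewrite E /= -/n => nj.
have -> : n <= j - reach_len by lia.
case: (ltnP (j - reach_len) (n + P)) => le.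
  case: (onth u _) => [b|] //=; apply/existsP; exists b; exact: eqxx.
by rewrite onth_default //; apply: leq_trans u_size _; lia.
Qed.

Lemma tiling_of_run : run_accepts -> tileable tallowed trel rows W.
Proof.
rewrite run_acceptsE => acc; have hg := reach_len_gt1.
have W0 : 0 < W by [].
exists (fun c => mk (true_colour (c %/ W) (c %% W))); split.
  move=> c y Ey; have cl : c < W * T.+1 by rewrite -size_rows -onthTE Ey.
  have tT : c %/ W <= T by rewrite -ltnS ltn_divLR // mulnC.
  have jW : c %% W < W by rewrite ltn_mod.
  move: Ey; rewrite {1}(divn_eq c W) onth_rows // => - [<-].
  move: tT jW; move: (c %/ W) (c %% W) => t j tT jW.
  case: t tT => [|t] tT; first exact: true_first.
  rewrite /tallowed mkK true_coherent // /row_kind /=; case: eqP => // ->.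
  by apply/implyP => /eqP [->].
have at_ t j : j < W -> ((t * W + j) %/ W = t) * ((t * W + j) %% W = j).
  by move=> jW; rewrite divnMDl // modnMDl divn_small // modn_small // addn0.
move=> d c; rewrite size_rows (divn_eq c W).
have jW : c %% W < W by rewrite ltn_mod.
move: jW; move: (c %/ W) (c %% W) => t j jW; rewrite !at_ //; case: d; rewrite /shift => cl.
  have tT : t < T by have := ltn_addl; rewrite -ltnS -(ltn_pmul2l W0); lia.
  rewrite addnAC -mulSnr !at_ // /trel !mkK /=.
  have [-> En] := @cont_next t j.+1 isT; rewrite !eqxx /=.
  by apply/eqP/En.
move: cl; rewrite /trel !mkK.
have [jW1|jW1] := ltnP j.+1 W => cl.
  rewrite -addnA addn1 !at_ //= !eqxx /= implybT /=.
  apply/implyP => /and3P[/andP[/eqP -> /andP[h1 h2]] _]; rewrite !cont_init // !ffunE eqxx /=.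
  have -> : h <= j.+1 by rewrite /h; lia. have -> : h <= j.+2 by rewrite /h; lia.
  rewrite !subSS -!onthE !onth_input => /eqP.
  rewrite !(@onth_default _ _ x); try (rewrite -/n; lia).
  have -> : n <= j - reach_len by lia. have -> : n <= j.+1 - reach_len by lia.
  case E : (onth u (j - reach_len - n)) => [b|] //= _.
  by rewrite onth_default //; have := onthTE u (j - reach_len - n); rewrite E /=; lia.
have Ej : j.+1 = W by lia.
rewrite -addnA addn1 Ej -mulSnr -[t.+1 * W]addn0 !at_ //=.
have tT : t.+1 <= T by have : t.+1 * W < W * T.+1 by [rewrite -Ej; nia]; rewrite mulnC ltn_pmul2l.
have tT' := ltnW tT.
have bl t' J : t' <= T -> J < 2 \/ W <= J -> cont t' J = blank by apply: cont_blank.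
(* The seam of the helix: the right overlap of the last cell is the first cell of the next row, and
   both are blank. *)
have -> : true_cell t j.+2 = true_cell t.+1 1.
  rewrite /true_cell !bl //; [|by left|by right; lia].
  rewrite -Ej; congr (_, (_, _)); first by apply/eqP/eqP; rewrite /h; move: Ej; rewrite /W /width; lia.
  by rewrite Ej -addn1 modnDl.
have -> : true_cell t j.+1 = true_cell t.+1 0.
  rewrite /true_cell !bl //; [|by left|by right; lia].
  rewrite Ej modnn mod0n; congr (_, (_, _)).
  by apply/eqP/eqP; rewrite /h /W /width; lia.
rewrite !eqxx andbF andbT /at_border /= modn_small //.
by rewrite /W /width; lia.
Qed.

End Run.

Lemma prefix_closed (X : Type) (s : seq (option X)) :
  (forall i, i.+1 < size s -> nth None s i = None -> nth None s i.+1 = None) ->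
  exists u, size u <= size s /\ forall i, nth None s i = onth u i.
Proof.
elim: s => [|[y|] s IH] H; first by exists [::]; split=> // i; rewrite nth_nil onth0n.
  have [|u [us E]] := IH; first by move=> i; exact: (H i.+1).
  by exists (y :: u); split=> // -[|i] //=.
exists [::]; split=> // i; rewrite onth0n; case: (ltnP i (size s).+1) => il.
  by elim: i il => // i IHi il; apply: H => //; apply: IHi; apply: ltnW.
by rewrite nth_default.
Qed.

(** * From tilings to accepting runs *)

Section OfTiling.

Variable col : nat -> colour.
Hypothesis col_ok : forall c y, onth rows c = Some y -> tallowed y (col c).
Hypothesis col_rel : forall d c, c + shift W d < size rows ->
  trel d (col c) (col (c + shift W d)).

Let cc t j := un (col (t * W + j)).

Lemma cc_ok t j : t <= T -> j < W -> tallowed (row_kind t j) (col (t * W + j)).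
Proof. by move=> tT jW; apply: col_ok; apply: onth_rows. Qed.

Lemma cc_coherent t j : t <= T -> j < W -> coherent (cc t j).
Proof. by move=> tT jW; have /andP[] := cc_ok tT jW. Qed.

Lemma cc_right t j : t <= T -> j.+1 < W -> trel false (col (t * W + j)) (col (t * W + j.+1)).
Proof.
move=> tT jW; have := @col_rel false (t * W + j).
by rewrite -[shift W false]/1 -addnA addn1 size_rows; apply; nia.
Qed.

Lemma cc_wrap t : t < T -> trel false (col (t * W + W.-1)) (col (t.+1 * W + 0)).
Proof.
move=> tT; have := @col_rel false (t * W + W.-1).
have -> : t * W + W.-1 + shift W false = t.+1 * W + 0 by rewrite mulSn /shift /W /width; lia.
by apply; rewrite size_rows addn0 mulnC ltn_pmul2l.
Qed.

Lemma cc_up t j : t < T -> j < W -> trel true (col (t * W + j)) (col (t.+1 * W + j)).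
Proof.
move=> tT jW; have := @col_rel true (t * W + j).
have -> : t * W + j + shift W true = t.+1 * W + j by rewrite mulSn /shift; lia.
by apply; rewrite size_rows mulnC; nia.
Qed.

Lemma cc_marks t j : t <= T -> j < W -> (c_mid (cc t j)).2 = (j == reach_len, j == 0).
Proof.
elim: t => [|t IH] tT jW; last first.
  by have /and3P[/eqP -> _ _] := cc_up tT jW; apply: IH => //; apply: ltnW.
have /andP[_ /= /and5P[/eqP <- /eqP <- _ _ _]] := cc_ok tT jW.
by rewrite /cc -surjective_pairing.
Qed.

(** The certificate is read off the [P] cells reserved for it; the horizontal rule makes its blanks
    trailing, so [prefix_closed] applies. *)
Lemma input_content : exists u, size u <= P /\
  forall j, j < W -> (c_mid (cc 0 j)).1 = cont u 0 j.+1.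
Proof.
pose v i := (c_mid (cc 0 (reach_len + n + i))).1 (tm_in M).
pose s := mkseq (fun i => [pick b | v i == Some (tm_of_input M (inr b))]) P.
have WE : W = (2 * reach_len).+1 by []. have hE : reach_len = n + P + Tm + 2 by [].
have spec j i : j < W -> (if i == tm_in M then
     match (if j < reach_len then None else nth None specs (j - reach_len)) with
     | Some (Some a) => (c_mid (cc 0 j)).1 i == Some (tm_of_input M (inl a))
     | Some None => ((c_mid (cc 0 j)).1 i == None) ||
         [exists b, (c_mid (cc 0 j)).1 i == Some (tm_of_input M (inr b))]
     | None => (c_mid (cc 0 j)).1 i == None
     end else (c_mid (cc 0 j)).1 i == None).
  by move=> jW; have /andP[_ /= /and5P[_ _ _ _ /forallP]] := cc_ok (leq0n T) jW.
have cert_spec i : i < P -> nth None specs (reach_len + n + i - reach_len) = Some None.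
  by move=> iP; rewrite -addnA addKn nth_specs onth_default ?ifT //; rewrite -/n; lia.
have vP i : i < P -> v i = None \/ exists b, v i = Some (tm_of_input M (inr b)).
  move=> iP; have := @spec (reach_len + n + i) (tm_in M); rewrite eqxx cert_spec //.
  rewrite ifF; last by apply/negbTE; lia.
  case/(_ _)/orP => [|/eqP E|/existsP [b /eqP E]]; [lia|by left|by right; exists b].
have sP i : i < P -> v i = omap (fun b => tm_of_input M (inr b)) (nth None s i).
  move=> iP; rewrite nth_mkseq //; case: pickP => [b /eqP -> //|no].
  by case: (vP i iP) => [-> //|[b E]]; have := no b; rewrite E eqxx.
have [|u []] := @prefix_closed _ s.
  rewrite size_mkseq => i iP Ei.
  have vi : v i = None by rewrite sP ?Ei // ltnW.
  have : v i.+1 = None.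
    have jW : (reach_len + n + i).+1 < W by lia.
    have /and4P[_ _ _ /implyP Hc] := cc_right (leq0n T) jW.
    have cert j : j < P -> c_cert (cc 0 (reach_len + n + j)).
      move=> jP; have jW' : reach_len + n + j < W by lia.
      have /andP[_ /= /and5P[_ _ _ /eqP Ec _]] := cc_ok (leq0n T) jW'.
      by rewrite /cc Ec ifF ?cert_spec //; apply/negbTE; lia.
    rewrite /v /cc addnS; apply/eqP/Hc/and3P; split; [exact: cert (ltnW iP)| |by apply/eqP].
    by have := cert _ iP; rewrite /cc addnS.
  by rewrite sP //; case: (nth None s i.+1).
rewrite size_mkseq => us Es; exists u; split=> // j jW.
apply/ffunP => i; rewrite cont_init // ffunE ltnS subSS.
have := spec j i jW; case: eqP => [->|_] /=; last by move/eqP.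
case: (ltnP j reach_len) => jh; first by move/eqP.
rewrite nth_specs -onthE onth_input; case E : (onth x _) => [a|]; first by move/eqP.
have := onthTE x (j - reach_len); rewrite E /= -/n => nj.
have le : n <= j - reach_len by lia.
rewrite le; case: (ltnP (j - reach_len) (n + P)) => jP; last first.
  by move/eqP ->; rewrite onth_default //; apply: leq_trans us _; lia.
have iP : j - reach_len - n < P by lia.
have Ej : reach_len + n + (j - reach_len - n) = j by lia.
by have := sP _ iP; rewrite /v Ej Es => ->.
Qed.

Lemma run_of_tiling : exists u, size u <= P /\ run_accepts u.
Proof.
have [u [us Hu]] := input_content; exists u; split=> //.
have hg := reach_len_gt1; have WE : W = (2 * reach_len).+1 by [].
have hW : reach_len < W by lia. have W0 : 0 < W by [].
have bd t : t <= T -> at_border (c_mid (cc t 0)) by move=> tT; rewrite /at_border cc_marks.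
have hd t : t <= T -> at_head (c_mid (cc t reach_len)).
  by move=> tT; rewrite /at_head cc_marks //= eqxx.
have inv t : t <= T -> forall j, j < W ->
    (c_mid (cc t j)).1 = cont u t j.+1 /\ c_state (cc t j) = cfg_state (cfg u t).
  elim: t => [|t IH] tT j jW.
    split; first exact: Hu.
    by have /andP[_ /= /and5P[_ _ /eqP -> _ _]] := cc_ok tT jW.
  have tT' := ltnW tT; have {}IH := IH tT'.
  (* The scan is constant along the row, and coherence fixes its value at the head. *)
  have scan_eq j' : j' < W -> c_scan (cc t j') = c_scan (cc t 0).
    elim: j' => // j' IHj jW'; rewrite -IHj ?(ltnW jW') //.
    have /and4P[_ _ /implyP H _] := cc_right tT' jW'; apply/esym/eqP/H.
    by rewrite /at_border -/(cc t j'.+1) cc_marks.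
  have scanE j' : j' < W -> c_scan (cc t j') = cont u t h.
    move=> jW'; rewrite scan_eq // -(scan_eq _ hW).
    have /andP[/implyP H _] := cc_coherent tT' hW.
    have /eqP -> := H (hd _ tT').
    by case: (IH _ hW).
  have /and3P[_ /eqP Es /eqP Em] := cc_up tT jW.
  have [Ns Nc] := @cont_next u t j.+1 isT.
  have [Ej Eq] := IH _ jW.
  rewrite /cc Es Em -!/(cc t j) scanE // Eq -Ns; split=> //.
  apply/esym/Nc => //=; rewrite /at_head ?cc_marks //.
  - case: j jW {Es Em Ej Eq Ns Nc} => [|j] jW.
      have /andP[_ /implyP H] := cc_coherent tT' jW.
      have /and3P[_ /eqP -> _] := H (bd _ tT').
      by rewrite cont_blank //; left.
    have /and4P[_ /eqP El _ _] := cc_right tT' jW.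
    by rewrite -El; case: (IH _ (ltnW jW)).
  - have [jW1|jW1] := ltnP j.+1 W.
      have /and4P[/eqP -> _ _ _] := cc_right tT' jW1.
      by case: (IH _ jW1).
    have Ej' : j = W.-1 by lia.
    have /and4P[/eqP Er _ _ _] := cc_wrap tT.
    rewrite Ej' Er -/(cc t.+1 0).
    have /andP[_ /implyP H] := cc_coherent tT W0.
    have /and3P[/eqP -> _ _] := H (bd _ tT).
    by rewrite cont_blank //; right; lia.
  - case: j jW {Es Em Ej Eq Ns Nc} => [|j] jW.
      have /andP[_ /implyP H] := cc_coherent tT' jW.
      have /and3P[_ _ /negbTE] := H (bd _ tT').
      by rewrite /at_head => ->.
    have /and4P[_ /eqP El _ _] := cc_right tT' jW.
    by rewrite -El cc_marks // ltnW.
  - have [jW1|jW1] := ltnP j.+1 W.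
      have /and4P[/eqP -> _ _ _] := cc_right tT' jW1.
      by rewrite -/(cc t j.+1) cc_marks.
    have Ej' : j = W.-1 by lia.
    have /and4P[/eqP Er _ _ _] := cc_wrap tT.
    rewrite Ej' Er -/(cc t.+1 0) cc_marks //=.
    have -> : (0 == reach_len) = false by apply/negbTE; lia.
    by apply/esym/negbTE; rewrite /h; lia.
have hW1 : reach_len.+1 < W by lia.
rewrite run_acceptsE; have /andP[_] := cc_ok (leqnn T) hW.
rewrite /row_kind /= eqxx => /implyP H.
have := H (hd T (leqnn T)); rewrite -/(cc T reach_len).
have /and4P[/eqP Er _ _ _] := cc_right (leqnn T) hW1.
rewrite Er; have [-> _] := inv T (leqnn T) _ hW; have [-> _] := inv T (leqnn T) _ hW1.
by [].
Qed.

End OfTiling.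

Theorem tableau : tileable tallowed trel rows W <->
  exists u, size u <= P /\ run_accepts u.
Proof.
split=> [[col [ok rel]]|[u [us acc]]]; first exact: run_of_tiling ok rel.
exact: tiling_of_run us acc.
Qed.

End Fixed.

End Tableau.


(** * Printing the instance *)

Notation "F1 ;; F2" := (seqf F1 F2) (at level 65, right associativity).

Lemma runs_seq_le (G : finType) m (F1 F2 : frag G m) S1 S2 S3 t1 t2 t :
  runs F1 S1 S2 t1 -> runs F2 S2 S3 t2 -> t1 + t2 <= t -> runs (F1 ;; F2) S1 S3 t.
Proof. by move=> H1 H2; apply: runs_le; apply: runs_seq H1 H2. Qed.

Lemma runs_foldr (G : finType) m (X : Type) (F : X -> frag G m) (St : seq X -> seq (seq G))
    (s : seq X) t :
    (forall d x r, s = d ++ x :: r -> runs (F x) (St d) (St (rcons d x)) t) ->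
  runs (foldr (fun x => seqf (F x)) skip s) (St [::]) (St s) (size s * t + 1).
Proof.
move=> H; suff : forall d r, s = d ++ r ->
    runs (foldr (fun x => seqf (F x)) skip r) (St d) (St s) (size r * t + 1).
  by move=> /(_ [::] s erefl).
move=> d r; elim: r d => [|x r IH] d E /=.
  by rewrite E cats0; exact: runs_skip.
apply: runs_seq_le; [exact: H E|by apply: IH; rewrite cat_rcons|lia].
Qed.

Lemma map_eq_cat_cons (X Y : Type) (f : X -> Y) s d g r : map f s = d ++ g :: r ->
  exists e x e', [/\ s = e ++ x :: e', d = map f e, g = f x & r = map f e'].
Proof.
elim: d s => [|y d IH] [|x s] //= []; first by move=> <- <-; exists [::], x, s.
by move=> <- /IH [e [x' [e' [-> -> -> ->]]]]; exists (x :: e), x', e'.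
Qed.

Section Printer.

Variables (A C Z : finType) (allowed : Z -> pred C) (R : bool -> rel C) (k : nat).

Definition gsym : finType := ((A + option bool) + kind Z)%type.
Definition gi (a : A) : gsym := inl (inl a).
Definition go (o : option bool) : gsym := inl (inr o).
Definition gk (x : kind Z) : gsym := inr x.
Definition gone : gsym := go None.

(* Registers: 0 input, 1 output, 2-6 numbers, 7 the list of kinds, 8-9 scratch,
   10 reversed output, 11 position, 12 cell, 13 cell + width, 14 budget,
   15 budget in binary, 16 always empty. *)
Definition nreg := 17.
Notation prog := (frag gsym nreg).
Notation unary n := (nseq n gone).

Definition fill (i j : nat) (g : gsym) : prog := copyf (fun _ => g) i j 8.

Lemma runs_fill i j g c S : i < nreg -> j < nreg -> uniq [:: i; j; 8] ->
    nth [::] S 8 = [::] -> nth [::] S i = unary c ->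
  runs (fill i j g) S (set_nth [::] S j (nseq c g ++ nth [::] S j)) (12 * c + 2).
Proof.
move=> im jm U S8 Si; have := runs_copyf (fun _ => g) im jm (isT : 8 < nreg) U S8.
by rewrite Si size_nseq map_nseq.
Qed.

Definition out_of (n : nat) : seq gsym := map go (rcons (map Some (binary n)) None).

Definition outs (ns : seq nat) : seq gsym := map go (enc ns).

Lemma outs_cat ns ns' : outs (ns ++ ns') = outs ns ++ outs ns'.
Proof. by rewrite /outs /enc map_cat flatten_cat map_cat. Qed.

Lemma outs1 n : outs [:: n] = out_of n.
Proof. by rewrite /outs /enc /= cats0. Qed.

Section State.

Variables (n2 n3 n4 n5 n6 : nat).

Definition st z s q c cw pb bin : seq (seq gsym) :=
  [:: [::]; [::]; unary n2; unary n3; unary n4; unary n5; unary n6; z; [::]; [::]; s;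
      unary q; unary c; unary cw; unary pb; bin; [::]].

(** Symbols are pushed in reading order, so register 10 holds the output reversed. The last [push]
    advances the position that numbers the private letters. *)
Definition emit_letter (e ex reg : nat) : prog :=
  repf e (push 10 (go (Some true))) ;; push 10 (go (Some false)) ;;
  repf ex.+1 (push 10 (go (Some true))) ;; fill reg 10 (go (Some true)) ;;
  push 10 (go None) ;; push 11 gone.

(** The empty register 16 stands for the base 0 of an absolute cell. *)
Definition reg_of (b : option bool) : nat :=
  match b with None => 16 | Some false => 12 | Some true => 13 end.

Definition emit (t : token rword) : prog :=
  if t is Some ((x, (ex, b)), r) then emit_letter (1 + x * k + r) ex (reg_of b)
  else emit_letter 0 0 11.

Definition emit_weight (t : token rword) : nat :=
  if t is Some ((x, (ex, b)), r) then 2 * (1 + x * k + r) + 2 * ex else 0.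

Lemma emit_letterP e ex reg c z s q cc cw pb bin : reg \in [:: 11; 12; 13; 16] ->
    nth [::] (st z s q cc cw pb bin) reg = unary c ->
  runs (emit_letter e ex reg) (st z s q cc cw pb bin)
    (st z (rev (out_of (letter e (ex + c))) ++ s) q.+1 cc cw pb bin)
    (2 * e + 2 * ex + 12 * c + 12).
Proof.
move=> Hr Hc; have U : uniq [:: reg; 10; 8].
  by move: Hr; rewrite !inE => /or4P[] /eqP ->.
have rm : reg < nreg by move: Hr; rewrite !inE => /or4P[] /eqP ->.
set T := go (Some true); set F := go (Some false).
pose s1 := nseq e T ++ s; pose s2 := F :: s1; pose s3 := nseq ex.+1 T ++ s2.
pose s4 := nseq c T ++ s3.
have st_reg s' : nth [::] (st z s' q cc cw pb bin) reg = unary c.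
  by move: Hr Hc; rewrite !inE => /or4P[] /eqP ->.
have -> : rev (out_of (letter e (ex + c))) ++ s = go None :: s4.
  rewrite /out_of binary_letter /letter_code map_rcons rev_rcons cat_cons; congr (_ :: _).
  rewrite -map_comp map_cat rev_cat map_nseq rev_nseq map_cons map_nseq rev_cons rev_nseq.
  rewrite (_ : (ex + c).+1 = c + ex.+1) ?nseqD; last by lia.
  by rewrite -cats1 -!catA.
apply: (@runs_le _ _ _ _ _
  ((2 * e + 1) + (2 + ((2 * ex.+1 + 1) + ((12 * c + 2) + (2 + 2)))))); last by lia.
apply: (runs_seq (S2 := st z s1 q cc cw pb bin)); first exact: runs_pushes.
apply: (runs_seq (S2 := st z s2 q cc cw pb bin)); first exact: runs_push.
apply: (runs_seq (S2 := st z s3 q cc cw pb bin)); first exact: runs_pushes.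
apply: (runs_seq (S2 := st z s4 q cc cw pb bin)).
  exact: (@runs_fill reg 10 T c (st z s3 q cc cw pb bin)).
apply: runs_seq; [exact: runs_push|exact: runs_push].
Qed.

Lemma emitP w t z s q c pb bin B : q <= B -> c + w <= B ->
  runs (emit t) (st z s q c (c + w) pb bin)
    (st z (rev (out_of (name k q (rel_token w c t))) ++ s) q.+1 c (c + w) pb bin)
    (emit_weight t + 12 * B + 12).
Proof.
move=> qB cB; case: t => [[[x [ex b]] r]|] /=; last first.
  apply: runs_le; first by apply: (@emit_letterP 0 0 11 q).
  by lia.
apply: runs_le; first by apply: (@emit_letterP _ ex (reg_of b) (base w c b)); case: b => [[]|].
by case: b => [[]|] /=; lia.
Qed.

Definition emits (ts : seq (token rword)) : prog :=
  foldr (fun t => seqf (emit t)) skip ts.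

Definition emits_time ts B := size ts * (sumn (map emit_weight ts) + 12 * B + 12) + 1.

Lemma emitsP w ts z s q c pb bin B : q + size ts <= B -> c + w <= B ->
  runs (emits ts) (st z s q c (c + w) pb bin)
    (st z (rev (outs (string_from k q (map (rel_token w c) ts))) ++ s)
       (q + size ts) c (c + w) pb bin)
    (emits_time ts B).
Proof.
move=> qB cB.
pose St (d : seq (token rword)) :=
  st z (rev (outs (string_from k q (map (rel_token w c) d))) ++ s) (q + size d) c (c + w) pb bin.
have H d t r : ts = d ++ t :: r -> runs (emit t) (St d) (St (rcons d t))
    (sumn (map emit_weight ts) + 12 * B + 12).
  move=> E; have qB' : q + size d <= B by move: qB; rewrite E size_cat /=; lia.
  apply: (runs_to (@emitP w t z _ (q + size d) c pb bin B qB' cB)) => [i|].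
    rewrite /St -cats1 map_cat string_from_cat outs_cat rev_cat size_cat addnA addn1 size_map.
    by rewrite /= outs1 catA.
  by rewrite E map_cat sumn_cat /=; lia.
have := runs_foldr H; rewrite /St /= addn0.
by [].
Qed.

Notation cells x := (cell_tokens allowed R k x).

Definition print_cell (g : gsym) : prog :=
  if g is inr x then
    emits (cells x) ;; push 12 gone ;; push 13 gone ;;
    repf (cell_budget allowed R k x) (push 14 gone)
  else skip.

Definition prefix_tokens (w : nat) (zz : seq (kind Z)) : seq (token aword) :=
  nseq k.-1 None ++
  flatten (mkseq (fun c => map (rel_token w c) (cells (nth (inr true) zz c))) (size zz)).

Lemma prefix_tokens_rcons w zz x : prefix_tokens w (rcons zz x) =
  prefix_tokens w zz ++ map (rel_token w (size zz)) (cells x).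
Proof.
rewrite /prefix_tokens size_rcons mkseqS -cats1 flatten_cat /= cats0 -catA.
rewrite nth_rcons ltnn eqxx; congr (_ ++ (flatten _ ++ _)).
rewrite /mkseq; apply/eq_in_map => c; rewrite mem_iota => /andP[_ cz].
by rewrite nth_rcons cz.
Qed.

Definition max_tokens := \max_(x : kind Z) size (cells x).
Definition max_weight := \max_(x : kind Z) sumn (map emit_weight (cells x)).
Definition max_budget := \max_(x : kind Z) cell_budget allowed R k x.

Lemma size_prefix_tokens w zz : size (prefix_tokens w zz) <= k + max_tokens * size zz.
Proof.
elim/last_ind: zz => [|zz x IH]; first by rewrite /prefix_tokens /= cats0 size_nseq; lia.
rewrite prefix_tokens_rcons size_cat size_map size_rcons.
have := @leq_bigmax _ (fun x : kind Z => size (cells x)) x; rewrite -/max_tokens; lia.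
Qed.

Definition print_time (w N : nat) : nat :=
  let B := k + max_tokens * N + k + N + w in
  N * (max_tokens * (max_weight + 12 * B + 12) + 1 + 4 + 2 * max_budget + 1 + 3) + 1.

Lemma print_cells w zz bin :
  runs (forf 7 print_cell)
    (st (map gk zz) (rev (outs (string_from k 0 (prefix_tokens w [::])))) k.-1 0 w 0 bin)
    (st [::] (rev (outs (string_from k 0 (prefix_tokens w zz)))) (size (prefix_tokens w zz))
       (size zz) (size zz + w) (\sum_(x <- zz) cell_budget allowed R k x) bin)
    (print_time w (size zz)).
Proof.
pose Inv (d r : seq gsym) :=
  let e := pmap (fun g : gsym => if g is inr x then Some x else None) d in
  st r (rev (outs (string_from k 0 (prefix_tokens w e)))) (size (prefix_tokens w e))
       (size e) (size e + w) (\sum_(x <- e) cell_budget allowed R k x) bin.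
have gkK e : pmap (fun g : gsym => if g is inr x then Some x else None) (map gk e) = e.
  by elim: e => //= x e ->.
pose B := k + max_tokens * size zz + k + size zz + w.
pose tb := max_tokens * (max_weight + 12 * B + 12) + 1 + 4 + 2 * max_budget + 1.
have H1 d r : map gk zz = d ++ r -> nth [::] (Inv d r) 7 = r by [].
have H2 d g r : map gk zz = d ++ g :: r ->
    runs (print_cell g) (set_nth [::] (Inv d (g :: r)) 7 r) (Inv (rcons d g) r) tb.
  move=> E; have [e [x [e' [Ez -> -> _]]]] := map_eq_cat_cons E.
  rewrite /Inv -map_rcons !gkK [set_nth _ _ _ _]/= /print_cell /gk.
  have se : size e < size zz by rewrite Ez size_cat /=; lia.
  have mt := @leq_bigmax _ (fun x : kind Z => size (cells x)) x.
  have mw := @leq_bigmax _ (fun x : kind Z => sumn (map emit_weight (cells x))) x.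
  have mb := @leq_bigmax _ (fun x : kind Z => cell_budget allowed R k x) x.
  rewrite -/max_tokens -/max_weight -/max_budget in mt mw mb.
  have qB : size (prefix_tokens w e) + size (cells x) <= B.
    by have := size_prefix_tokens w e; rewrite /B; nia.
  have cB : size e + w <= B by rewrite /B; lia.
  apply: (@runs_le _ _ _ _ _ (emits_time (cells x) B +
      (2 + (2 + (2 * cell_budget allowed R k x + 1))))); last first.
    have : size (cells x) * (sumn (map emit_weight (cells x)) + 12 * B + 12) <=
      max_tokens * (max_weight + 12 * B + 12) by apply: leq_mul => //; lia.
    by rewrite /tb /emits_time; lia.
  apply: runs_seq; first exact: (@emitsP w (cells x) r _ (size (prefix_tokens w e)) (size e) _ bin B qB cB).
  apply: runs_seq; first exact: runs_push.
  apply: runs_seq; first exact: runs_push.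
  apply: (runs_to (@runs_pushes _ _ _ _ _ _)) => // i.
  rewrite prefix_tokens_rcons string_from_cat add0n outs_cat rev_cat size_cat size_map.
  rewrite size_rcons -cats1 big_cat big_seq1 /st /=; congr nth; do ![congr (_ :: _)].
  by rewrite -nseqD addnC.
have := runs_for (isT : 7 < nreg) H1 H2.
rewrite /Inv gkK size_map /= big_nil => H.
have E : size (prefix_tokens w [::]) = k.-1 by rewrite /prefix_tokens /= cats0 size_nseq.
by rewrite -E; apply: runs_le H _; rewrite /print_time -/B -/tb.
Qed.

Definition letter_bound (B : nat) := 2 * max_weight + B + 5.

Lemma size_out_name B w zz q t : size zz + w <= B -> q <= B ->
  t \in prefix_tokens w zz -> size (out_of (name k q t)) <= letter_bound B.
Proof.
move=> zB qB; have so e c : size (out_of (letter e c)) = e + c + 3.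
  rewrite /out_of binary_letter size_map size_rcons size_map size_cat /= !size_nseq; lia.
have none : size (out_of (name k q None)) <= letter_bound B.
  by rewrite /name so /letter_bound; lia.
rewrite mem_cat => /orP[/nseqP [-> _] //|/flattenP [ts /mapP [c]]].
rewrite mem_iota => /andP[_ cz] -> /mapP [t' t'x ->].
set x := nth _ zz c in t'x; case: t' t'x => [[[y [ex b]] r]|] // t'x.
rewrite /name [rel_token _ _ _]/= so.
have h1 : emit_weight (Some ((y, (ex, b)), r)) <= max_weight.
  apply: leq_trans (@leq_bigmax _ (fun x : kind Z => sumn (map emit_weight (cells x))) x).
  elim: (cells x) t'x => // t0 ts' IH; rewrite inE => /predU1P [<-|/IH le].
    exact: leq_addr.
  exact: leq_trans le (leq_addl _ _).
have h2 : base w c b <= B by case: b {t'x h1} => [[]|] /=; lia.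
by move: h1; rewrite /letter_bound /=; lia.
Qed.

Lemma size_outs_prefix B w zz : size zz + w <= B -> size (prefix_tokens w zz) <= B ->
  size (outs (string_from k 0 (prefix_tokens w zz))) <= letter_bound B * B.
Proof.
move=> zB pB; suff H ts q : q + size ts <= B -> {subset ts <= prefix_tokens w zz} ->
    size (outs (string_from k q ts)) <= letter_bound B * size ts.
  by apply: leq_trans (H _ 0 _ _) _ => //; rewrite leq_mul2l pB orbT.
elim: ts q => [|t ts IH] q qB sub //=.
rewrite -cat1s outs_cat outs1 size_cat mulnS leq_add //.
  by apply: size_out_name (sub t (mem_head _ _)) => //; rewrite /= in qB; lia.
apply: IH; first by rewrite addSnnS.
by move=> t' t'ts; apply: sub; rewrite inE t'ts orbT.
Qed.

Lemma size_binary n : size (binary n) <= n.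
Proof.
rewrite size_map size_iota up_log_min //; exact: ltn_expl.
Qed.

Definition bit (b : bool) : gsym := go (Some b).

Lemma bit_inj : injective bit. Proof. by move=> x y []. Qed.

(** The budget is the only number not written in the letter code: it is counted in unary and turned
    into binary by repeated increments. The two last moves put its digits in front of the string, in
    the right order. *)
Definition print_instance : prog :=
  emits (nseq k.-1 None) ;; forf 7 print_cell ;; emits (nseq k None) ;;
  push 14 gone ;; mov 10 1 ;; forf 14 (fun _ => incf bit 15 8) ;;
  push 1 (go None) ;; mov 15 8 ;; mov 8 1.

Definition print_bound (w N : nat) := k + max_tokens * N + k + N + w.

Definition print_instance_time (w N : nat) : nat :=
  let B := print_bound w N in
  let pb := (N * max_budget).+1 in
  (k * (12 * B + 12) + 1) + (print_time w N + ((k * (12 * B + 12) + 1) +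
  (2 + ((5 * (letter_bound B * B + k * (B + 3)) + 1) + ((pb * (9 * pb + 10 + 3) + 1) +
  (2 + ((5 * pb + 1) + (5 * pb + 1)))))))).

Lemma sum_budget zz : \sum_(x <- zz) cell_budget allowed R k x <= size zz * max_budget.
Proof.
elim: zz => [|x zz IH]; first by rewrite big_nil.
rewrite big_cons mulSn leq_add //.
exact: (@leq_bigmax _ (fun x : kind Z => cell_budget allowed R k x)).
Qed.

Lemma print_instanceP w zz : exists S',
  runs print_instance (st (map gk zz) [::] 0 0 w 0 [::]) S'
    (print_instance_time w (size zz)) /\
  nth [::] S' 1 = map go (encode (string_from k 0 (tokens k (all_blocks allowed R k w zz)))
    (budget (all_blocks allowed R k w zz))).
Proof.
set N := size zz; set B := print_bound w N; set pb := (N * max_budget).+1.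
set toks := tokens k _; set bud := budget _.
have Etok : toks = prefix_tokens w zz ++ nseq k None.
  by rewrite /toks tokens_all_blocks /prefix_tokens catA.
have Ebud : bud = (\sum_(x <- zz) cell_budget allowed R k x).+1 by exact: budget_all_blocks.
have pre0 : prefix_tokens w [::] = nseq k.-1 None by rewrite /prefix_tokens /= cats0.
have rel0 c n : map (rel_token w c) (nseq n None) = nseq n None by rewrite map_nseq.
have wt0 n : sumn (map emit_weight (nseq n None)) = 0.
  by rewrite map_nseq; elim: n.
have sp := size_prefix_tokens w zz; rewrite -/N in sp.
set S3 := rev (outs (string_from k 0 toks)).
have R1 : runs (emits (nseq k.-1 None)) (st (map gk zz) [::] 0 0 w 0 [::])
   (st (map gk zz) (rev (outs (string_from k 0 (prefix_tokens w [::])))) k.-1 0 w 0 [::])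
   (k * (12 * B + 12) + 1).
  have := @emitsP w (nseq k.-1 None) (map gk zz) [::] 0 0 0 [::] B.
  rewrite rel0 cats0 size_nseq pre0 /emits_time wt0 size_nseq => H.
  have le1 : k.-1 * (0 + 12 * B + 12) <= k * (12 * B + 12) by apply: leq_mul; lia.
  by apply: runs_le (H _ _) _; [rewrite /B /print_bound; lia..|lia].
have R2 := @print_cells w zz [::].
have R3 : runs (emits (nseq k None))
   (st [::] (rev (outs (string_from k 0 (prefix_tokens w zz)))) (size (prefix_tokens w zz))
       N (N + w) bud.-1 [::])
   (st [::] S3 (size toks) N (N + w) bud.-1 [::]) (k * (12 * B + 12) + 1).
  have := @emitsP w (nseq k None) [::] (rev (outs (string_from k 0 (prefix_tokens w zz))))
    (size (prefix_tokens w zz)) N bud.-1 [::] B.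
  rewrite rel0 size_nseq /emits_time wt0 size_nseq /S3 Etok string_from_cat add0n.
  rewrite outs_cat rev_cat size_cat size_nseq => H.
  by apply: runs_le (H _ _) _; rewrite /B /print_bound; lia.
have R4 := @runs_push _ nreg 14 gone (st [::] S3 (size toks) N (N + w) bud.-1 [::]).
pose stz out s pbs bin t8 : seq (seq gsym) :=
  [:: [::]; out; unary n2; unary n3; unary n4; unary n5; unary n6; [::]; t8; [::]; s;
     unary (size toks); unary N; unary (N + w); pbs; bin; [::]].
have R5 : runs (mov 10 1 : prog) (stz [::] S3 (unary bud) [::] [::])
    (stz (outs (string_from k 0 toks)) [::] (unary bud) [::] [::])
    (5 * (letter_bound B * B + k * (B + 3)) + 1).
  apply: runs_to; first by apply: (@runs_mov _ nreg 10 1).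
    by move=> i; congr nth; rewrite /= /S3 revK cats0.
  rewrite /= /S3 size_rev Etok string_from_cat outs_cat size_cat add0n.
  have h1 := @size_outs_prefix B w zz.
  have h2 : forall n q, q + n <= B -> size (outs (string_from k q (nseq n None))) <= n * (B + 3).
    elim=> // n IH q qB; rewrite /= -cat1s outs_cat outs1 size_cat mulSn leq_add ?IH //; last by lia.
    by rewrite /out_of binary_letter size_map size_rcons size_map size_cat /= size_nseq; lia.
  rewrite leq_add2r leq_mul2l /= leq_add ?h1 ?h2 //; rewrite /B /print_bound; lia.
have R6 : runs (forf 14 (fun _ => incf bit 15 8) : prog)
    (stz (outs (string_from k 0 toks)) [::] (unary bud) [::] [::])
    (stz (outs (string_from k 0 toks)) [::] [::] (map bit (binary bud)) [::])
    (pb * (9 * pb + 10 + 3) + 1).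
  pose Inv (d r : seq gsym) :=
    stz (outs (string_from k 0 toks)) [::] r (map bit (binary (size d))) [::].
  have bp : bud <= pb by rewrite Ebud /pb ltnS sum_budget.
  have H2 d g r : unary bud = d ++ g :: r -> runs (incf bit 15 8 : prog)
      (set_nth [::] (Inv d (g :: r)) 14 r) (Inv (rcons d g) r) (9 * pb + 10).
    move/(congr1 size); rewrite size_nseq size_cat /= => E.
    apply: runs_to; first by apply: (@runs_inc _ nreg _ bit_inj 15 8 _ (binary (size d))).
      by move=> i; rewrite /Inv size_rcons binary_succ.
    rewrite leq_add2r leq_mul2l /=; apply: leq_trans (size_binary _) _.
    by apply: leq_trans bp; rewrite E leq_addr.
  have H1 d r : unary bud = d ++ r -> nth [::] (Inv d r) 14 = r by [].
  have := runs_for (isT : 14 < nreg) H1 H2.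
  rewrite /Inv size_nseq => H; apply: runs_le H _.
  by rewrite leq_add2r leq_mul2r bp orbT.
have R7 := @runs_push _ nreg 1 (go None)
  (stz (outs (string_from k 0 toks)) [::] [::] (map bit (binary bud)) [::]).
pose out8 := go None :: outs (string_from k 0 toks).
have bp : size (binary bud) <= pb.
  by rewrite (leq_trans (size_binary _)) // Ebud /pb ltnS sum_budget.
have R8 : runs (mov 15 8 : prog) (stz out8 [::] [::] (map bit (binary bud)) [::])
    (stz out8 [::] [::] [::] (rev (map bit (binary bud)))) (5 * pb + 1).
  apply: runs_to; first by apply: (@runs_mov _ nreg 15 8).
    by move=> i; congr nth; rewrite /= cats0.
  by rewrite /= size_map; lia.
have R9 : runs (mov 8 1 : prog) (stz out8 [::] [::] [::] (rev (map bit (binary bud))))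
    (stz (map bit (binary bud) ++ out8) [::] [::] [::] [::]) (5 * pb + 1).
  apply: runs_to; first by apply: (@runs_mov _ nreg 8 1).
    by move=> i; congr nth; rewrite /= revK.
  by rewrite /= size_rev size_map; lia.
exists (stz (map bit (binary bud) ++ out8) [::] [::] [::] [::]); split.
  apply: runs_seq R1 _; apply: runs_seq R2 _.
  have Eb : \sum_(x <- zz) cell_budget allowed R k x = bud.-1 by rewrite Ebud.
  rewrite Eb; apply: runs_seq R3 _; apply: runs_seq R4 _.
  rewrite [set_nth _ _ _ _]/=.
  have -> : gone :: unary bud.-1 = unary bud by rewrite Ebud.
  by apply: runs_seq R5 _; apply: runs_seq R6 _; apply: runs_seq R7 _; apply: runs_seq R8 _.
rewrite [nth _ _ _]/= /out8 encodeE enc_cons map_cat /= /outs -map_comp.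
by [].
Qed.

End State.

End Printer.


(** * The reduction as a program *)

Section Reduction.

Variables (A : finType) (M : turing_machine (A + bool)%type bool) (p q : {poly nat}) (k : nat).

Notation G := (gsym A (tkind A)).
Notation prog := (frag G nreg).
Notation gone := (gone A (tkind A)).
Notation unary n := (nseq n gone).
Notation gk := (@gk A (tkind A)).
Notation gi := (@gi A (tkind A)).

Definition first_kind (h b : bool) (sp : option (option A)) : kind (tkind A) :=
  inl (inl (h, b, sp)).

Definition setup_numbers : prog :=
  forf 0 (fun g => push 8 g ;; push 2 gone) ;; mov 8 0 ;;
  hornerf gone p 3 2 8 9 ;; copy 3 2 8 ;; hornerf gone q 4 2 8 9 ;;
  copy 2 5 8 ;; copy 4 5 8 ;; push 5 gone ;; push 5 gone ;;
  copy 5 6 8 ;; copy 5 6 8 ;; push 6 gone ;; copy 6 13 8.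

Definition mark_head : prog :=
  casef 7 (fun o => match o with
    | Some (inr (inl (inl (_, _, sp)))) => pop 7 ;; push 7 (gk (first_kind true false sp))
    | _ => skip end).

Definition letter_kind (g : G) : prog :=
  if g is inl (inl a) then push 7 (gk (first_kind false false (Some (Some a)))) else skip.

(** The list is a stack, so it is built from its end: right padding, last row, inner rows, then the
    first row from right to left. The cell of the head is on top once the input is placed, and is
    flagged by rewriting the top. The late [pop] gives the place of one blank to the border cell. *)
Definition setup_kinds : prog :=
  let blank := gk (first_kind false false None) in
  fill 6 7 (gk (inr true)) ;; fill 6 7 (gk (inl (inr true))) ;;
  copy 4 9 8 ;; forf 9 (fun _ => fill 6 7 (gk (inl (inr false)))) ;;
  fill 4 7 blank ;; repf 3 (push 7 blank) ;;
  fill 3 7 (gk (first_kind false false (Some None))) ;;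
  mov 0 8 ;; forf 8 letter_kind ;; mark_head ;;
  fill 5 7 blank ;; pop 7 ;; push 7 (gk (first_kind false true None)) ;;
  fill 6 7 (gk (inr false)).

Definition lst x0 n2 n3 n4 n5 n6 z x8 x9 n13 : seq (seq G) :=
  [:: x0; [::]; unary n2; unary n3; unary n4; unary n5; unary n6; z; x8; x9;
      [::]; [::]; [::]; unary n13; [::]; [::]; [::]].

Definition cert_len n := p.[n]%R : nat.
(** The time bound at the largest input of the verifier; polynomials over [nat] are monotone, so it
    also serves shorter certificates. *)
Definition run_len n := q.[cert_len n + n]%R : nat.
Definition half_of n := n + cert_len n + run_len n + 2.
Definition width_of n := (2 * half_of n).+1.

Definition numbers_time n :=
  let P := cert_len n in let T := run_len n in let H := half_of n in
  (n * 7 + 1) + ((5 * n + 1) + (hornert p n + ((12 * P + 2) + (hornert q (P + n) +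
  ((12 * (P + n) + 2) + ((12 * T + 2) + (2 + (2 +
  ((12 * H + 2) + ((12 * H + 2) + (2 + (12 * width_of n + 2)))))))))))).

Lemma copy_unary i j a b S S' : i < nreg -> j < nreg -> uniq [:: i; j; 8] ->
    nth [::] S 8 = [::] -> nth [::] S i = unary a -> nth [::] S j = unary b ->
    set_nth [::] S j (unary (a + b)) = S' ->
  runs (copy i j 8 : prog) S S' (12 * a + 2).
Proof.
move=> im jm U S8 Si Sj <-; have := runs_copy im jm (isT : 8 < nreg) U S8.
by rewrite Si Sj -nseqD size_nseq.
Qed.

Lemma push_to i a S S' :
  set_nth [::] S i (a :: nth [::] S i) = S' -> runs (push i a : prog) S S' 2.
Proof. by move=> <-; apply: runs_push. Qed.

Lemma setup_numbersP x : let n := size x in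
  runs setup_numbers (lst (map gi x) 0 0 0 0 0 [::] [::] [::] 0)
    (lst (map gi x) (cert_len n + n) (cert_len n) (run_len n) (half_of n) (width_of n)
       [::] [::] [::] (width_of n))
    (numbers_time n).
Proof.
move=> n; set P := cert_len n; set T := run_len n; set H := half_of n.
have R1 : runs (forf 0 (fun g => push 8 g ;; push 2 gone) : prog)
    (lst (map gi x) 0 0 0 0 0 [::] [::] [::] 0)
    (lst [::] n 0 0 0 0 [::] (rev (map gi x)) [::] 0) (n * 7 + 1).
  pose Inv (d r : seq G) := lst r (size d) 0 0 0 0 [::] (rev d) [::] 0.
  have H1 d r : map gi x = d ++ r -> nth [::] (Inv d r) 0 = r by [].
  have H2 d g r : map gi x = d ++ g :: r ->
      runs (push 8 g ;; push 2 gone : prog) (set_nth [::] (Inv d (g :: r)) 0 r)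
        (Inv (rcons d g) r) (2 + 2).
    move=> _; apply: runs_seq; first exact: runs_push.
    by apply: push_to; rewrite /Inv size_rcons rev_rcons.
  by have := runs_for (isT : 0 < nreg) H1 H2; rewrite /Inv size_map.
have R2 : runs (mov 8 0 : prog) (lst [::] n 0 0 0 0 [::] (rev (map gi x)) [::] 0)
    (lst (map gi x) n 0 0 0 0 [::] [::] [::] 0) (5 * n + 1).
  apply: runs_to; first by apply: (@runs_mov _ nreg 8 0).
    by move=> i; congr nth; rewrite /= revK cats0.
  by rewrite /= size_rev size_map.
have R3 := @runs_horner _ nreg gone p 3 2 8 9 (lst (map gi x) n 0 0 0 0 [::] [::] [::] 0) n
  isT isT isT isT isT erefl erefl erefl erefl.
have R4 : runs (copy 3 2 8 : prog) (lst (map gi x) n P 0 0 0 [::] [::] [::] 0)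
    (lst (map gi x) (P + n) P 0 0 0 [::] [::] [::] 0) (12 * P + 2).
  exact: (@copy_unary 3 2 P n).
have R5 := @runs_horner _ nreg gone q 4 2 8 9
  (lst (map gi x) (P + n) P 0 0 0 [::] [::] [::] 0) (P + n)
  isT isT isT isT isT erefl erefl erefl erefl.
rewrite /setup_numbers /numbers_time -/P -/T -/H.
apply: runs_seq R1 _; apply: runs_seq R2 _; apply: runs_seq R3 _; apply: runs_seq R4 _.
apply: runs_seq R5 _.
have EH : (T + (P + n + 0)).+2 = H by rewrite /H /half_of -/P -/T; lia.
have EW : (H + (H + 0)).+1 = width_of n by rewrite /width_of -/H; lia.
apply: (runs_seq (S2 := lst (map gi x) (P + n) P T (P + n + 0) 0 [::] [::] [::] 0)).
  exact: (@copy_unary 2 5 (P + n) 0).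
apply: (runs_seq (S2 := lst (map gi x) (P + n) P T (T + (P + n + 0)) 0 [::] [::] [::] 0)).
  exact: (@copy_unary 4 5 T (P + n + 0)).
apply: (runs_seq (S2 := lst (map gi x) (P + n) P T (T + (P + n + 0)).+1 0 [::] [::] [::] 0)).
  exact: push_to.
apply: (runs_seq (S2 := lst (map gi x) (P + n) P T H 0 [::] [::] [::] 0)).
  by apply: push_to; rewrite -EH.
apply: (runs_seq (S2 := lst (map gi x) (P + n) P T H (H + 0) [::] [::] [::] 0)).
  exact: (@copy_unary 5 6 H 0).
apply: (runs_seq (S2 := lst (map gi x) (P + n) P T H (H + (H + 0)) [::] [::] [::] 0)).
  exact: (@copy_unary 5 6 H (H + 0)).
apply: (runs_seq (S2 := lst (map gi x) (P + n) P T H (width_of n) [::] [::] [::] 0)).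
  by apply: push_to; rewrite -EW.
by apply: (@copy_unary 6 13 (width_of n) 0) => //; rewrite addn0.
Qed.

Definition kinds_time n :=
  let P := cert_len n in let T := run_len n in let H := half_of n in let W := width_of n in
  (12 * W + 2) + ((12 * W + 2) + ((12 * T + 2) + ((T * (12 * W + 2 + 3) + 1) +
  ((12 * T + 2) + ((2 * 3 + 1) + ((12 * P + 2) + ((5 * n + 1) + ((n * 5 + 1) +
  (4 + ((12 * H + 2) + (1 + (2 + (12 * W + 2))))))))))))).

Lemma fill_kinds i c (y : kind (tkind A)) L S S' : i \in [:: 3; 4; 5; 6] ->
    nth [::] S 8 = [::] -> nth [::] S i = unary c -> nth [::] S 7 = map gk L ->
    set_nth [::] S 7 (map gk (nseq c y ++ L)) = S' ->
  runs (fill i 7 (gk y) : prog) S S' (12 * c + 2).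
Proof.
move=> Hi S8 Si S7 <-; have U : uniq [:: i; 7; 8].
  by move: Hi; rewrite !inE => /or4P[] /eqP ->.
have im : i < nreg by move: Hi; rewrite !inE => /or4P[] /eqP ->.
have := @runs_fill _ _ i 7 (gk y) c S im isT U S8 Si.
by rewrite S7 map_cat map_nseq.
Qed.

Lemma setup_kindsP x : let n := size x in
  let zz := padded (rows x (cert_len n) (run_len n)) (width x (cert_len n) (run_len n)) in
  runs setup_kinds
    (lst (map gi x) (cert_len n + n) (cert_len n) (run_len n) (half_of n) (width_of n)
       [::] [::] [::] (width_of n))
    (lst [::] (cert_len n + n) (cert_len n) (run_len n) (half_of n) (width_of n)
       (map gk zz) [::] [::] (width_of n))
    (kinds_time n).
Proof.
move=> n; set P := cert_len n; set T := run_len n; set H := half_of n.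
set W := width_of n; move=> zz.
pose L x0 z x8 x9 := lst x0 (P + n) P T H W (map gk z) x8 x9 W.
rewrite -/(L _ [::] _ _) -/(L _ zz _ _) /setup_kinds /kinds_time -/P -/T -/H -/W.
pose z1 := nseq W (inr true : kind (tkind A)).
pose z2 := nseq W (inl (inr true)) ++ z1.
pose z3 := nseq (T * W) (inl (inr false)) ++ z2.
pose bl := first_kind false false None.
pose z4 := nseq T bl ++ z3.
pose z5 := nseq 3 bl ++ z4.
pose z6 := nseq P (first_kind false false (Some None)) ++ z5.
pose z7 := map (fun a => first_kind false false (Some (Some a))) x ++ z6.
have [sp [sps Esp]] : exists sp sps, specs x P T = sp :: sps.
  by have := size_specs x P T; case: (specs _ _ _) => // sp sps _; exists sp, sps.
have Ez7 : z7 = map (first_kind false false) (specs x P T) ++ z3.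
  by rewrite /z7 /z6 /z5 /z4 /specs !map_cat !map_nseq -map_comp addnC nseqD -!catA.
pose z8 := first_kind true false sp :: map (first_kind false false) sps ++ z3.
pose z9 := nseq H bl ++ z8.
pose z10 := nseq H.-1 bl ++ z8.
pose z11 := first_kind false true None :: z10.
have Ezz : zz = nseq W (inr false) ++ z11.
  have EH : reach_len x P T = H by [].
  have EW : width x P T = W by [].
  rewrite /zz /padded /rows /first_row EW EH Esp /z11 /z10 /z8 /z3 /z2 /z1 mulnC.
  move: (W) (T) (H) => w t h; rewrite !map_cat map_cons map_cat map_cons.
  by rewrite !map_nseq -map_comp -!catA /= -!catA.
apply: (runs_seq (S2 := L (map gi x) z1 [::] [::])).
  by apply: (@fill_kinds 6 W _ [::]) => //; rewrite cats0.
apply: (runs_seq (S2 := L (map gi x) z2 [::] [::])).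
  exact: (@fill_kinds 6 W _ z1).
apply: (runs_seq (S2 := L (map gi x) z2 [::] (unary (T + 0)))).
  exact: (@copy_unary 4 9 T 0).
apply: (runs_seq (S2 := L (map gi x) z3 [::] [::])).
  pose Inv (d r : seq G) := L (map gi x) (nseq (size d * W) (inl (inr false)) ++ z2) [::] r.
  have H1 d r : unary (T + 0) = d ++ r -> nth [::] (Inv d r) 9 = r by [].
  have H2 d g r : unary (T + 0) = d ++ g :: r ->
      runs (fill 6 7 (gk (inl (inr false))) : prog)
        (set_nth [::] (Inv d (g :: r)) 9 r) (Inv (rcons d g) r) (12 * W + 2).
    move=> _; apply: (@fill_kinds 6 W _ (nseq (size d * W) (inl (inr false)) ++ z2)) => //.
    by rewrite /Inv size_rcons mulSn nseqD -catA.
  by have := runs_for (isT : 9 < nreg) H1 H2; rewrite /Inv size_nseq addn0.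
apply: (runs_seq (S2 := L (map gi x) z4 [::] [::])).
  exact: (@fill_kinds 4 T _ z3).
apply: (runs_seq (S2 := L (map gi x) z5 [::] [::])).
  exact: runs_pushes.
apply: (runs_seq (S2 := L (map gi x) z6 [::] [::])).
  exact: (@fill_kinds 3 P _ z5).
apply: (runs_seq (S2 := L [::] z6 (rev (map gi x)) [::])).
  apply: runs_to; first by apply: (@runs_mov _ nreg 0 8).
    by move=> i; congr nth; rewrite /= cats0.
  by rewrite /= size_map.
apply: (runs_seq (S2 := L [::] z7 [::] [::])).
  pose Inv (d r : seq G) := L [::] (map (fun a => first_kind false false (Some (Some a)))
     (rev (pmap (fun g : G => if g is inl (inl a) then Some a else None) d)) ++ z6) r [::].
  have giK e : pmap (fun g : G => if g is inl (inl a) then Some a else None) (map gi e) = e.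
    by elim: e => //= a e ->.
  have H1 d r : map gi (rev x) = d ++ r -> nth [::] (Inv d r) 8 = r by [].
  have H2 d g r : map gi (rev x) = d ++ g :: r ->
      runs (letter_kind g) (set_nth [::] (Inv d (g :: r)) 8 r) (Inv (rcons d g) r) 2.
    move=> E; have [e [a [e' [_ -> -> _]]]] := map_eq_cat_cons E.
    by apply: push_to; rewrite /Inv -map_rcons !giK rev_rcons.
  have := runs_for (isT : 8 < nreg) H1 H2.
  by rewrite /Inv giK revK -map_rev size_map size_rev.
apply: (runs_seq (S2 := L [::] z8 [::] [::])).
  rewrite /mark_head; apply: runs_case => //; rewrite Ez7 Esp /=.
  by apply: (@runs_seq _ _ _ _ _ _ _ 1 2); [exact: runs_pop|exact: runs_push].
apply: (runs_seq (S2 := L [::] z9 [::] [::])).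
  exact: (@fill_kinds 5 H _ z8).
apply: (runs_seq (S2 := L [::] z10 [::] [::])).
  apply: runs_to; [exact: runs_pop| |exact: leqnn] => i; congr nth.
  have [h' Eh] : exists h', H = h'.+1 by exists H.-1; rewrite /H /half_of addn2.
  by rewrite /L /z9 /z10 Eh.
apply: (runs_seq (S2 := L [::] z11 [::] [::])); first exact: runs_push.
by rewrite Ezz; apply: (@fill_kinds 6 W _ z11).
Qed.

Definition reduction (x : seq A) : seq (option bool) :=
  let P := cert_len (size x) in let T := run_len (size x) in
  instance (@tallowed A M) (@trel A M) k (rows x P T) (width x P T).

Definition reduction_time n :=
  let W := width_of n in
  numbers_time n + (kinds_time n +
    print_instance_time (@tallowed A M) (@trel A M) k W (W + W * (run_len n).+2 + W)).

Lemma gi_inj : injective gi. Proof. by move=> a b []. Qed.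
Lemma go_inj : injective (@go A (tkind A)). Proof. by move=> a b []. Qed.

Lemma reduction_polytime : polytime reduction.
Proof.
have [t Ht] : ispoly reduction_time.
  have hp : ispoly cert_len by exact: ispoly_horner ispoly_id.
  have hq : ispoly run_len by apply: ispoly_horner; apply: ispoly_add hp ispoly_id.
  have hh : ispoly half_of.
    by do ![apply: ispoly_add|exact: ispoly_id|exact: ispoly_const|exact: hp|exact: hq].
  have hw : ispoly width_of.
    by apply: ispoly_succ; apply: ispoly_mul hh; apply: ispoly_const.
  rewrite /reduction_time /numbers_time /kinds_time /print_instance_time /print_time
    /print_bound /letter_bound.
  by do ![exact: ispoly_const|exact: ispoly_id|exact: hp|exact: hq|exact: hh|exact: hw
     |apply: ispoly_hornert|apply: ispoly_succ|apply: ispoly_mul|apply: ispoly_add].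
apply: (@polytime_of_frag A (option bool) G nreg gi (@go A (tkind A)) gi_inj go_inj
   (@Ordinal nreg 0 isT) (@Ordinal nreg 1 isT)
   (setup_numbers ;; setup_kinds ;; print_instance A (@tallowed A M) (@trel A M) k) _ t) => x.
set n := size x; set P := cert_len n; set T := run_len n.
pose zz := padded (rows x P T) (width x P T).
have [S' [RS ES]] := print_instanceP A (@tallowed A M) (@trel A M) k
  (P + n) P T (half_of n) (width_of n) (width_of n) zz.
have szz : size zz = width_of n + width_of n * T.+2 + width_of n.
  by rewrite /zz size_zz size_rows.
rewrite szz in RS.
exists (lst (map gi x) 0 0 0 0 0 [::] [::] [::] 0), S', (reduction_time n).
split; last 1 first.
- exact: ES.
- by case=> -[|i] //= i17; do 16?[case: i i17 => [|i] //= i17].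
- exact: (runs_seq (@setup_numbersP x) (runs_seq (@setup_kindsP x) RS)).
- by rewrite -Ht.
Qed.

End Reduction.

Lemma iter_halted (A B : finType) (M : turing_machine A B) n (c : config M) :
  tm_halt (cfg_state c) -> iter n (@step _ _ M) c = c.
Proof. by move=> h; elim: n => //= n ->; rewrite /step h. Qed.

Lemma run_acceptsP (A : finType) (M : turing_machine (A + bool)%type bool)
    (x : seq A) Tm (u : seq bool) (b : bool) t :
  outputs_within M (map inl x ++ map inr u) [:: b] t -> t <= Tm.+1 ->
  run_accepts M x Tm u = b.
Proof.
rewrite /outputs_within /run_accepts /cfg => -[hh hw] tT.
rewrite -(subnK tT) iterD iter_halted //; move: hw; rewrite /word_of_tape.
case: (cfg_tapes _ _) => l [g|] //= r [-> Er]; rewrite /accepting.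
have -> : head None r = None by case: r Er => [|[y|] r].
rewrite andbT (inj_eq Some_inj) (inj_eq (@tm_of_output_inj _ _ M)).
by case: b {Er hh}.
Qed.

Theorem sharp_attractor_NP_hard k : 2 < k -> NP_hard (k_sharp_attractor k).
Proof.
move=> k2 A L [p [V [[M [q HM]] HL]]].
exists (reduction M p q k); split; first exact: reduction_polytime.
move=> x; set n := size x; set P := cert_len p n; set T := run_len p q n.
pose b0 := (blank M, (false, false)).
pose c0 := mk (Colour (tm_start M) (blank M) b0 b0 b0 false).
have W0 : 0 < width x P T by [].
rewrite (iff_trans (instance_correct c0 (@tallowed A M) (@trel A M) k2 _ W0) (tableau M x P T)) HL.
have acc u : size u <= P -> run_accepts M x T u = V (map inl x ++ map inr u).
  move=> us; apply: run_acceptsP (HM _) _; apply: leqW; apply: horner_leq.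
  by rewrite size_cat !size_map addnC leq_add2r.
split=> [[u [us Vu]]|[u [us au]]]; exists u; split=> //; first by rewrite acc.
by rewrite -acc.
Qed.


(** * Verifying an attractor *)

Fixpoint decode (w : seq (option bool)) : seq nat :=
  match w with
  | [::] => [::]
  | None :: w' => 0 :: decode w'
  | Some x :: w' => if decode w' is n :: ns then (x + n.*2) :: ns else [::]
  end.

Lemma decode_enc b ns : decode (map Some b ++ None :: enc ns) = bval b :: ns.
Proof.
elim: ns b => [|n ns IHn] b; elim: b => [|x b IH] //=; rewrite ?IH //.
by rewrite enc_cons IHn bval_binary.
Qed.

Section Spec.

Variable k : nat.

Definition covers (T : seq nat) (u : seq bool) (i i' : nat) : bool :=
  prefix (enc (take k (drop i T))) (enc (drop i' T)) && has id (take k (drop i' u)).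

Definition uncovered T u i : bool :=
  (i + k <= size T) && ~~ has (covers T u i) (iota 0 (size T)).

Definition check (w : seq (option bool)) (u : seq bool) : bool :=
  wellformed w &&
  if decode w is p :: T then
    (count id u <= p) && ~~ has (uncovered T u) (iota 0 (size T))
  else false.

Lemma prefix_digits x y (s t : seq (option bool)) :
  prefix (map Some x ++ None :: s) (map Some y ++ None :: t) = (x == y) && prefix s t.
Proof. by elim: x y => [|a x IH] [|b y] //=; rewrite IH eqseq_cons andbA. Qed.

(** [None] ends each number and occurs nowhere else in its code, so the program may compare symbols
    without decoding letters. *)
Lemma prefix_enc s t : prefix (enc s) (enc t) = prefix s t.
Proof.
have binj : injective binary := can_inj bval_binary.
elim: s t => [|a s IH] [|b t]; rewrite ?enc_cons ?prefix0s //.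
  by case: (binary a).
by rewrite prefix_digits IH (inj_eq binj).
Qed.

Lemma hit_has u i : hit k u i <-> has id (take k (drop i u)).
Proof.
split=> [[j ij uj]|/(has_nthP false) [j]].
  have ju : j < size u by rewrite ltnNge; apply: contraTN uj => le; rewrite nth_default.
  apply/(has_nthP false); exists (j - i); first by rewrite size_take_min size_drop; lia.
  have jk : j - i < k by lia. have ij' : i <= j by lia.
  by rewrite nth_take // nth_drop subnKC.
rewrite size_take_min size_drop => jl; have jk : j < k by lia.
by rewrite nth_take // nth_drop => uj; exists (i + j) => //; lia.
Qed.

(** That the occurrence fits into the string needs no separate test: a suffix with the whole window
    as a prefix is long enough. *)
Lemma coversP T u i i' : 0 < k -> i + k <= size T -> reflect
  [/\ i' + k <= size T, take k (drop i' T) = take k (drop i T) & hit k u i'] (covers T u i i').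
Proof.
move=> k0 ik; rewrite /covers prefix_enc prefixE.
have sz : size (take k (drop i T)) = k by rewrite size_takel // size_drop; lia.
rewrite sz; apply: (iffP andP) => [[/eqP E /hit_has h]|[i'k -> /hit_has h]] //.
split=> //; move: (congr1 size E); rewrite sz size_take_min size_drop => /minn_idPl le.
by have le' : k <= size T - i' := le; lia.
Qed.

Lemma check_encode T p u : 0 < k ->
  check (encode T p) u <-> count id u <= p /\ mask_attractor k T u.
Proof.
move=> k0; rewrite /check encodeE wellformed_enc enc_cons decode_enc bval_binary /=.
split=> [/andP[-> /hasPn H]|[-> H]]; last first.
  apply/hasPn => i _; rewrite negb_and negbK -implybE; apply/implyP => ik.
  have [i' Hi'] := H i ik; apply/hasP; exists i'; last by apply/coversP.
  by rewrite mem_iota; case: Hi' => ? _ _; lia.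
split=> // i ik; have iT : i \in iota 0 (size T) by rewrite mem_iota; lia.
have := H i iT; rewrite /uncovered ik /= negbK => /hasP [i' _ /coversP Hi'].
by exists i'; apply: Hi'.
Qed.

Lemma check_wellformed w u : check w u -> exists T p, w = encode T p.
Proof.
move=> /andP[wf]; case: w wf => [|g w] wf; first by [].
by move=> _; apply/wellformed_encode; rewrite wf.
Qed.

Definition verify (z : seq (option bool + bool)) : bool :=
  check (pmap (fun g => if g is inl x then Some x else None) z)
        (pmap (fun g => if g is inr x then Some x else None) z).

Lemma verify_cat w u : verify (map inl w ++ map inr u) = check w u.
Proof.
rewrite /verify !pmap_cat; congr check.
  have -> : pmap (fun g : option bool + bool => if g is inl x then Some x else None)
    (map inr u) = [::] by elim: u.
  by rewrite cats0; elim: w => //= x w ->.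
have -> : pmap (fun g : option bool + bool => if g is inr x then Some x else None)
    (map inl w) = [::] by elim: w.
by elim: u => //= x u ->.
Qed.

End Spec.

(** * The verifier as a program *)

Section Verifier.

Variable k : nat.

Let G : finType := (option bool + bool)%type.
Definition vreg := 21.
Notation prog := (frag G vreg).
Let vone : G := inr true.
Notation unary n := (nseq n vone).

Let dig (b : bool) : G := inl (Some b).
Let stop : G := inl None.

Definition toks (T : seq nat) : seq G := map inl (enc T).

Lemma toks_cons n T : toks (n :: T) = map dig (binary n) ++ stop :: toks T.
Proof. by rewrite /toks enc_cons map_cat -map_comp. Qed.

Lemma toks_cat T T' : toks (T ++ T') = toks T ++ toks T'.
Proof. by rewrite /toks /enc map_cat flatten_cat map_cat. Qed.

Definition is_digit (o : option G) : bool := if o is Some (inl (Some _)) then true else false.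

Definition move_digits i j : prog :=
  whilef i is_digit (casef i (fun o => if o is Some g then pop i ;; push j g else skip)).

Lemma move_digitsP i j S b r : i < vreg -> i <> j ->
    nth [::] S i = map dig b ++ stop :: r ->
  runs (move_digits i j) S
    (set_nth [::] (set_nth [::] S j (rev (map dig b) ++ nth [::] S j)) i (stop :: r))
    (5 * size b + 1).
Proof.
move=> im ij; elim: b S => [|x b IH] S Si /=.
  apply: runs_to; first by apply: runs_while_end => //; rewrite Si.
    by move=> y; stacks.
  by [].
apply: (@runs_le _ _ _ _ _ ((1 + 2).+1 + (5 * size b + 1)).+1); last by lia.
apply: runs_while_step => //; first by rewrite Si.
  apply: runs_case => //; rewrite Si; apply: runs_seq; [exact: runs_pop|exact: runs_push].
rewrite Si /=; set S1 := set_nth _ (set_nth _ _ _ _) j _.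
have E1 : nth [::] S1 i = map dig b ++ stop :: r by rewrite /S1; stacks.
apply: (runs_to (IH _ E1)) => // y; rewrite /S1 rev_cons; stacks.
by rewrite cat_rcons.
Qed.

Definition drop_letter i : prog := whilef i is_digit (pop i) ;; pop i.

Lemma drop_letterP i S n T : i < vreg -> nth [::] S i = toks (n :: T) ->
  runs (drop_letter i) S (set_nth [::] S i (toks T)) (2 * size (toks (n :: T)) + 2).
Proof.
move=> im; rewrite toks_cons size_cat size_map => Si.
have H b S0 : nth [::] S0 i = map dig b ++ stop :: toks T ->
    runs (whilef i is_digit (pop i) : prog) S0 (set_nth [::] S0 i (stop :: toks T))
      (2 * size b + 1).
  elim: b S0 => [|x b IH] S0 S0i.
    apply: runs_to; first by apply: runs_while_end => //; rewrite S0i.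
      by move=> y; stacks.
    by [].
  apply: (@runs_le _ _ _ _ _ (1 + (2 * size b + 1)).+1); last by rewrite /=; lia.
  apply: runs_while_step => //; first by rewrite S0i.
    exact: runs_pop.
  rewrite S0i /=; set S1 := set_nth _ _ i _.
  have E1 : nth [::] S1 i = map dig b ++ stop :: toks T by rewrite /S1; stacks.
  by apply: (runs_to (IH _ E1)) => // y; rewrite /S1; stacks.
apply: (@runs_le _ _ _ _ _ ((2 * size (binary n) + 1) + 1)); last by rewrite /=; lia.
apply: runs_seq (H _ _ Si) _.
by apply: (runs_to (@runs_pop _ _ _ _)) => // y; stacks.
Qed.

Definition clear i : prog := forf i (fun _ => skip).

Lemma clearP i S : i < vreg ->
  runs (clear i) S (set_nth [::] S i [::]) (4 * size (nth [::] S i) + 1).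
Proof.
move=> im; have := @runs_for_store _ vreg i (fun _ => skip) S (fun _ => S) 1 im.
move=> H; apply: runs_le (H _ _) _; [by move=> x; stacks| |by lia].
by move=> d g r _; apply: runs_skip.
Qed.

Lemma runs_repf (F : prog) (St : nat -> seq (seq G)) n t :
  (forall i, i < n -> runs F (St i) (St i.+1) t) -> runs (repf n F) (St 0) (St n) (n * t + 1).
Proof.
elim: n St => [|n IH] St H /=; first exact: runs_skip.
apply: (@runs_le _ _ _ _ _ (t + (n * t + 1))); last by lia.
apply: runs_seq; first exact: H.
by apply: (IH (fun i => St i.+1)) => i il; apply: H.
Qed.

Lemma runs_while_list (X : Type) i (F : prog) (Inv : seq X -> seq X -> seq (seq G)) s t :
    i < vreg ->
    (forall d r, s = d ++ r -> isSome (ohead (nth [::] (Inv d r) i)) = (size r != 0)) ->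
    (forall d x r, s = d ++ x :: r -> runs F (Inv d (x :: r)) (Inv (rcons d x) r) t) ->
  runs (whilef i isSome F) (Inv [::] s) (Inv s [::]) (size s * t.+1 + 1).
Proof.
move=> im H1 H2; suff : forall d r, s = d ++ r ->
    runs (whilef i isSome F) (Inv d r) (Inv s [::]) (size r * t.+1 + 1).
  by move=> /(_ [::] s erefl).
move=> d r; elim: r d => [|x r IH] d E.
  rewrite cats0 in E; rewrite -E; apply: runs_while_end => //.
  by rewrite H1 ?cats0.
apply: (@runs_le _ _ _ _ _ (t + (size r * t.+1 + 1)).+1); last by rewrite /=; lia.
apply: runs_while_step => //; [by rewrite H1|exact: H2 E|].
by apply: IH; rewrite cat_rcons.
Qed.

Lemma toks_head T : isSome (ohead (toks T)) = (size T != 0).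
Proof. by case: T => // n T; rewrite toks_cons; case: (binary n). Qed.

(** On a mismatch the other word is not consumed. Later comparisons may then be out of step, but one
    failure already decides. *)
Definition compare : prog :=
  forf 12 (fun g => casef 13 (fun o => if o == Some g then pop 13 else push 15 vone)).

Definition cmp_step (yn : seq G * nat) (g : G) :=
  if ohead yn.1 == Some g then (behead yn.1, yn.2) else (yn.1, yn.2.+1).

Lemma cmp_foldP s y n : ((foldl cmp_step (y, n) s).2 == 0) = (n == 0) && prefix s y.
Proof.
elim: s y n => [|g s IH] y n /=; first by rewrite prefix0s andbT.
rewrite [cmp_step _ _]/cmp_step; case: y => [|g' y]; first by rewrite /= IH andbF.
rewrite [ohead _]/= (inj_eq Some_inj) [prefix _ _]/= [g == g']eq_sym.
by case: (g' =P g) => [->|_]; rewrite IH //= andbF.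
Qed.

Lemma cmp_fold_size s y n : size (foldl cmp_step (y, n) s).1 <= size y /\
  (foldl cmp_step (y, n) s).2 <= n + size s.
Proof.
elim: s y n => [|g s IH] y n /=; first by rewrite addn0.
rewrite [cmp_step _ _]/cmp_step; case: ifP => _ /=.
  have [h1 h2] := IH (behead y) n; rewrite size_behead in h1.
  by split; [apply: leq_trans h1 (leq_pred _)|rewrite addnS ltnW].
by have [h1 h2] := IH y n.+1; rewrite addnS -addSn.
Qed.

Section Main.

Variables (T : seq nat) (u : seq bool) (x5 : seq G) (B : nat).
Hypotheses (B_T : size (toks T) <= B) (B_u : size u <= B).

(* Registers: 0 input, 1 output, 2 scratch, 3 the letters from the current window on,
   4 scratch, 5 digits of the bound, 6 certificate, 7 string, 8 failures, 9 and 10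
   suffixes of string and certificate at the candidate occurrence, 11-16 work space,
   17 current window, 18 occurrences found, 19 always empty, 20 nonempty when the
   window is incomplete. *)
Definition vst x3 e x9 x10 x11 x12 x13 x14 bad ht x17 fd sh : seq (seq G) :=
  [:: [::]; [::]; [::]; x3; [::]; x5; map inr u; toks T; unary e; x9; x10; x11; x12;
      x13; x14; unary bad; unary ht; x17; unary fd; [::]; unary sh].

Definition take_letter : prog :=
  casef 12 (fun o => if o is Some _ then move_digits 12 11 ;; pop 12 ;; push 11 stop
                     else push 20 vone).

Definition window : prog :=
  copy 3 12 4 ;; repf k take_letter ;; clear 12 ;; mov 11 17.

Lemma windowP A e : size (toks A) <= B ->
  runs window (vst (toks A) e [::] [::] [::] [::] [::] [::] 0 0 [::] 0 0)
    (vst (toks A) e [::] [::] [::] [::] [::] [::] 0 0 (toks (take k A)) 0 (k - size A))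
    ((12 * B + 2) + ((k * (5 * B + 5) + 1) + ((4 * B + 1) + (5 * B + 1)))).
Proof.
move=> AB; pose St i := vst (toks A) e [::] [::] (rev (toks (take i A))) (toks (drop i A))
  [::] [::] 0 0 [::] 0 (i - size A).
have sub i : size (toks (drop i A)) <= B /\ size (toks (take i A)) <= B.
  by move: AB; rewrite -{1}(cat_take_drop i A) toks_cat size_cat; lia.
apply: (runs_seq (S2 := St 0)).
  apply: runs_to; first by apply: (@runs_copy _ vreg 3 12 4).
    by move=> i; congr nth; rewrite /St take0 drop0 sub0n /= cats0.
  by rewrite /= leq_add2r leq_mul2l AB orbT.
apply: (runs_seq (S2 := St k)).
  apply: runs_repf => i ik; have [h1 h2] := sub i.
  apply: (@runs_le _ _ _ _ _ ((5 * B + 4).+1)); last by lia.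
  apply: runs_case => //; case: (ltnP i (size A)) => iA; last first.
    rewrite [nth _ _ _]/= (drop_oversize iA) /=.
    apply: runs_to; [exact: runs_push| |by lia] => y; congr nth.
    rewrite /St !take_oversize ?drop_oversize //; try lia.
    by rewrite subSn.
  have Ed := drop_nth 0 iA; rewrite [nth _ _ _]/= Ed.
  have -> : ohead (toks (nth 0 A i :: drop i.+1 A)) =
      Some (head stop (toks (nth 0 A i :: drop i.+1 A))).
    by rewrite toks_cons; case: (binary _).
  rewrite Ed toks_cons size_cat size_map in h1.
  apply: (@runs_le _ _ _ _ _ ((5 * size (binary (nth 0 A i)) + 1) + (1 + 2))); last by lia.
  apply: runs_seq.
    apply: (@move_digitsP 12 11 _ (binary (nth 0 A i)) (toks (drop i.+1 A))) => //.
    by rewrite /= Ed toks_cons.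
  apply: runs_seq; first exact: runs_pop.
  apply: (runs_to (@runs_push _ _ _ _ _)) => // y; congr nth.
  rewrite /St (take_nth 0 iA) -cats1 toks_cat rev_cat toks_cons rev_cat /=.
  have -> : i.+1 - size A = 0 by lia.
  by have -> : i - size A = 0 by lia.
apply: (runs_seq (S2 := vst (toks A) e [::] [::] (rev (toks (take k A))) [::] [::] [::] 0 0
   [::] 0 (k - size A))).
  apply: runs_to; [exact: clearP|by []|].
  by have [h1 h2] := sub k; rewrite leq_add2r leq_mul2l h1 orbT.
apply: runs_to; first by apply: (@runs_mov _ vreg 11 17).
  by move=> i; congr nth; rewrite /= revK cats0.
by have [h1 h2] := sub k; rewrite [nth _ _ _]/= size_rev leq_add2r leq_mul2l h2 orbT.
Qed.

Lemma compareP x3 e x9 x10 x11 x12 x13 x14 n ht x17 fd sh :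
  let r := foldl cmp_step (x13, n) x12 in
  runs compare (vst x3 e x9 x10 x11 x12 x13 x14 n ht x17 fd sh)
    (vst x3 e x9 x10 x11 [::] r.1 x14 r.2 ht x17 fd sh) (size x12 * (3 + 3) + 1).
Proof.
pose Inv (d r : seq G) := let z := foldl cmp_step (x13, n) d in
  vst x3 e x9 x10 x11 r z.1 x14 z.2 ht x17 fd sh.
apply: (@runs_for _ vreg 12 _ Inv x12 3) => // d g r _.
apply: runs_case => //; rewrite /Inv foldl_rcons; case: (foldl _ _ _) => y c.
rewrite [nth _ _ _]/= /cmp_step /=; case: eqP => h.
  by apply: runs_to; [exact: runs_pop| |].
by apply: runs_to; [exact: runs_push| |].
Qed.

Definition look : prog :=
  casef 14 (fun o => if o == Some vone then push 16 vone else skip) ;; pop 14.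

Lemma looksP x3 e x9 x10 x11 x12 x13 (v : seq bool) bad x17 fd sh :
  runs (repf k look) (vst x3 e x9 x10 x11 x12 x13 (map inr v) bad 0 x17 fd sh)
    (vst x3 e x9 x10 x11 x12 x13 (map inr (drop k v)) bad (count id (take k v)) x17 fd sh)
    (k * 4 + 1).
Proof.
pose St i := vst x3 e x9 x10 x11 x12 x13 (map inr (drop i v)) bad (count id (take i v)) x17 fd sh.
suff : runs (repf k look) (St 0) (St k) (k * 4 + 1) by rewrite /St drop0 take0.
apply: runs_repf => i ik.
apply: (@runs_le _ _ _ _ _ (2.+1 + 1)) => //.
apply: (runs_seq (S2 := vst x3 e x9 x10 x11 x12 x13 (map inr (drop i v)) bad
  (count id (take i.+1 v)) x17 fd sh)).
  apply: runs_case => //; rewrite /St [nth _ _ _]/=.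
  case: (ltnP i (size v)) => iv; last first.
    rewrite !take_oversize ?drop_oversize //; last exact: leqW.
    by apply: runs_le (@runs_skip _ _ _) _.
  rewrite (take_nth false iv) -cats1 count_cat (drop_nth false iv) [ohead _]/=.
  case: (nth false v i) => /=.
    by apply: runs_to; [exact: runs_push|rewrite addn1|].
  by rewrite !addn0; apply: runs_le (@runs_skip _ _ _) _.
by apply: runs_to; [exact: runs_pop|rewrite /= -drop1 -map_drop drop_drop add1n|].
Qed.

Definition verdict : prog :=
  casef 15 (fun o => if o is Some _ then skip else
    casef 16 (fun o => if o is Some _ then push 18 vone else skip)).

Lemma verdictP x3 e x9 x10 x11 x12 x13 x14 bad ht x17 fd sh :
  runs verdict (vst x3 e x9 x10 x11 x12 x13 x14 bad ht x17 fd sh)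
    (vst x3 e x9 x10 x11 x12 x13 x14 bad ht x17 (((bad == 0) && (0 < ht)) + fd) sh) 4.
Proof.
apply: runs_case => //; case: bad => [|bad] /=; last exact: runs_le (@runs_skip _ _ _) _.
apply: runs_case => //; case: ht => [|ht] /=; first exact: runs_le (@runs_skip _ _ _) _.
exact: runs_push.
Qed.

Definition inner : prog :=
  copy 17 12 4 ;; copy 9 13 4 ;; copy 10 14 4 ;; compare ;; repf k look ;; verdict ;;
  clear 13 ;; clear 14 ;; clear 15 ;; clear 16 ;; drop_letter 9 ;; pop 10.

Definition inner_time := 12 * (12 * B + 4 * k + 4).

Lemma innerP x3 e A x r (v : seq bool) fd sh :
    size (toks A) <= B -> size (toks (x :: r)) <= B -> size v <= B ->
  runs inner (vst x3 e (toks (x :: r)) (map inr v) [::] [::] [::] [::] 0 0 (toks A) fd sh)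
    (vst x3 e (toks r) (map inr (behead v)) [::] [::] [::] [::] 0 0 (toks A)
      ((prefix (enc A) (enc (x :: r)) && has id (take k v)) + fd) sh) inner_time.
Proof.
move=> AB rB vB; pose c := 12 * B + 4 * k + 4.
have cB n t : n <= B -> t <= 4 -> 12 * n + t <= c.
  by move=> h1 h2; rewrite /c; lia.
have eA : size (map inl (enc A) : seq G) <= B by exact: AB.
apply: (@runs_le _ _ _ _ _ (c + (c + (c + (c + (c + (c + (c + (c + (c + (c + (c + c))))))))))));
  last by rewrite /inner_time -/c; lia.
pose R := toks (x :: r).
apply: (runs_seq (S2 := vst x3 e R (map inr v) [::] (toks A) [::] [::] 0 0 (toks A) fd sh)).
  apply: runs_to; [by apply: (@runs_copy _ vreg 17 12 4)| |exact: cB].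
  by move=> y; rewrite /= cats0.
apply: (runs_seq (S2 := vst x3 e R (map inr v) [::] (toks A) R [::] 0 0 (toks A) fd sh)).
  apply: runs_to; [by apply: (@runs_copy _ vreg 9 13 4)| |exact: cB].
  by move=> y; rewrite [nth _ _ 9]/= [nth _ _ 13]/= cats0.
apply: (runs_seq (S2 := vst x3 e R (map inr v) [::] (toks A) R (map inr v) 0 0 (toks A) fd sh)).
  apply: runs_to; [by apply: (@runs_copy _ vreg 10 14 4)| |].
    by move=> y; rewrite [nth _ _ 10]/= [nth _ _ 14]/= cats0.
  by rewrite [nth _ _ 10]/= size_map; apply: cB.
have [z1 z2] := cmp_fold_size (toks A) R 0; have z3 := cmp_foldP (toks A) R 0.
rewrite add0n in z2.
pose fo := foldl cmp_step (R, 0) (toks A); rewrite -/fo in z1 z2 z3.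
have pfx : (fo.2 == 0) = prefix (enc A) (enc (x :: r)).
  rewrite z3 /R /toks andTb; have ij : injective (@inl (option bool) bool) by move=> ? ? [].
  elim: (enc A) (enc (x :: r)) => [|a s IH] [|b t] //=; rewrite ?prefix0s //.
  by rewrite IH (inj_eq ij).
apply: (runs_seq (S2 := vst x3 e R (map inr v) [::] [::] fo.1 (map inr v) fo.2 0 (toks A) fd sh)).
  apply: runs_le; first exact: compareP.
  by apply: (@leq_trans (12 * size (toks A) + 1)); [lia|apply: cB].
apply: (runs_seq (S2 := vst x3 e R (map inr v) [::] [::] fo.1 (map inr (drop k v)) fo.2
    (count id (take k v)) (toks A) fd sh)).
  apply: runs_le; first exact: looksP.
  by rewrite /c; lia.
rewrite has_count -pfx; set ht := count id _; set fd' := _ + fd.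
have htk : ht <= k by apply: leq_trans (count_size _ _) _; rewrite size_take_min geq_minl.
apply: (runs_seq (S2 := vst x3 e R (map inr v) [::] [::] fo.1 (map inr (drop k v)) fo.2
    ht (toks A) fd' sh)).
  apply: runs_le; first exact: verdictP.
  by rewrite /c; lia.
have cl n : n <= B -> 4 * n + 1 <= c.
  by move=> h1; rewrite /c; lia.
apply: (runs_seq (S2 := vst x3 e R (map inr v) [::] [::] [::] (map inr (drop k v)) fo.2
    ht (toks A) fd' sh)).
  apply: runs_to; [exact: clearP|by []|].
  by apply: cl; apply: leq_trans z1 _.
apply: (runs_seq (S2 := vst x3 e R (map inr v) [::] [::] [::] [::] fo.2 ht (toks A) fd' sh)).
  apply: runs_to; [exact: clearP|by []|].
  by apply: cl; rewrite [nth _ _ _]/= size_map size_drop; lia.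
apply: (runs_seq (S2 := vst x3 e R (map inr v) [::] [::] [::] [::] 0 ht (toks A) fd' sh)).
  apply: runs_to; [exact: clearP|by []|].
  by apply: cl; rewrite [nth _ _ _]/= size_nseq; apply: leq_trans z2 _.
apply: (runs_seq (S2 := vst x3 e R (map inr v) [::] [::] [::] [::] 0 0 (toks A) fd' sh)).
  apply: runs_to; [exact: clearP|by []|].
  by rewrite [nth _ _ _]/= size_nseq /c; lia.
apply: (runs_seq (S2 := vst x3 e (toks r) (map inr v) [::] [::] [::] [::] 0 0 (toks A) fd' sh)).
  apply: runs_to; [by apply: (@drop_letterP 9 _ x r)|by []|].
  by rewrite /c; move: (size _) rB => ? ?; lia.
apply: runs_to; [exact: runs_pop|by rewrite /= -behead_map|by rewrite /c; lia].
Qed.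

Lemma size_toks (s : seq nat) : size s <= size (toks s).
Proof. by elim: s => // n s IH; rewrite toks_cons size_cat /= addnS ltnS (leq_trans IH) ?leq_addl. Qed.

Lemma toks_drop i : size (toks (drop i T)) <= B.
Proof. by apply: leq_trans B_T; rewrite -{2}(cat_take_drop i T) toks_cat size_cat leq_addl. Qed.

Lemma innersP x3 e A sh : size (toks A) <= B ->
  runs (whilef 9 isSome inner)
    (vst x3 e (toks T) (map inr u) [::] [::] [::] [::] 0 0 (toks A) 0 sh)
    (vst x3 e [::] (map inr (drop (size T) u)) [::] [::] [::] [::] 0 0 (toks A)
      (count (fun i => prefix (enc A) (enc (drop i T)) && has id (take k (drop i u)))
        (iota 0 (size T))) sh)
    (B * inner_time.+1 + 1).
Proof.
move=> AB; pose Inv (d r : seq nat) :=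
  vst x3 e (toks r) (map inr (drop (size d) u)) [::] [::] [::] [::] 0 0 (toks A)
    (count (fun i => prefix (enc A) (enc (drop i T)) && has id (take k (drop i u)))
        (iota 0 (size d))) sh.
suff : runs (whilef 9 isSome inner) (Inv [::] T) (Inv T [::]) (B * inner_time.+1 + 1).
  by rewrite /Inv drop0.
apply: runs_le (@runs_while_list _ 9 inner Inv T inner_time isT _ _) _.
- by move=> d r _; exact: toks_head.
- move=> d x r E; have dr : drop (size d) T = x :: r by rewrite E drop_size_cat.
  apply: runs_to; [apply: innerP => //| |by []].
  + by rewrite -dr toks_drop.
  + by rewrite size_drop; lia.
  move=> y; rewrite /Inv size_rcons -addn1 iotaD count_cat add0n [iota (size d) 1]/= /= addn0 dr.
  by rewrite addnC -drop1 drop_drop add1n addn1.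
- by rewrite leq_add2r leq_mul2r (leq_trans (size_toks T)) ?orbT.
Qed.

Definition judge : prog :=
  casef 18 (fun o => if o is Some _ then skip else
    casef 20 (fun o => if o is Some _ then skip else push 8 vone)).

Lemma judgeP x3 e x9 x10 x11 x12 x13 x14 bad ht x17 fd sh :
  runs judge (vst x3 e x9 x10 x11 x12 x13 x14 bad ht x17 fd sh)
    (vst x3 (((sh == 0) && (fd == 0)) + e) x9 x10 x11 x12 x13 x14 bad ht x17 fd sh) 4.
Proof.
apply: runs_case => //; case: fd => [|fd] /=; last first.
  by rewrite andbF; apply: runs_le (@runs_skip _ _ _) _.
apply: runs_case => //; case: sh => [|sh] /=; last exact: runs_le (@runs_skip _ _ _) _.
exact: runs_push.
Qed.

Definition outer : prog :=
  window ;; copy 7 9 4 ;; copy 6 10 4 ;; whilef 9 isSome inner ;; judge ;;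
  clear 18 ;; clear 20 ;; clear 17 ;; clear 10 ;; drop_letter 3.

Definition window_time := (12 * B + 2) + ((k * (5 * B + 5) + 1) + ((4 * B + 1) + (5 * B + 1))).
Definition outer_time := 10 * (window_time + B * inner_time.+1 + 12 * B + 4 * k + 4).

Lemma outerP d x r e : T = d ++ x :: r ->
  runs outer (vst (toks (x :: r)) e [::] [::] [::] [::] [::] [::] 0 0 [::] 0 0)
    (vst (toks r) (uncovered k T u (size d) + e) [::] [::] [::] [::] [::] [::] 0 0 [::] 0 0)
    outer_time.
Proof.
move=> E; have dr : drop (size d) T = x :: r by rewrite E drop_size_cat.
have rB : size (toks (x :: r)) <= B by rewrite -dr toks_drop.
have TB : size T <= B := leq_trans (size_toks T) B_T.
pose A := take k (x :: r); have AB : size (toks A) <= B.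
  by move: rB; rewrite -{1}(cat_take_drop k (x :: r)) toks_cat size_cat; apply/leq_trans/leq_addr.
pose c := window_time + B * inner_time.+1 + 12 * B + 4 * k + 4.
have cB n t : n <= B -> t <= 4 -> 12 * n + t <= c.
  by move=> h1 h2; rewrite /c; lia.
have cl n : n <= B -> 4 * n + 1 <= c.
  by move=> h1; rewrite /c; lia.
apply: (@runs_le _ _ _ _ _ (c + (c + (c + (c + (c + (c + (c + (c + (c + c))))))))));
  last by rewrite /outer_time -/c; lia.
pose R := toks (x :: r); pose sh := k - size (x :: r).
apply: (runs_seq (S2 := vst R e [::] [::] [::] [::] [::] [::] 0 0 (toks A) 0 sh)).
  by apply: runs_le; [exact: windowP|rewrite /c /window_time; lia].
apply: (runs_seq (S2 := vst R e (toks T) [::] [::] [::] [::] [::] 0 0 (toks A) 0 sh)).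
  apply: runs_to; [by apply: (@runs_copy _ vreg 7 9 4)| |exact: cB].
  by move=> y; rewrite [nth _ _ 7]/= [nth _ _ 9]/= cats0.
apply: (runs_seq (S2 := vst R e (toks T) (map inr u) [::] [::] [::] [::] 0 0 (toks A) 0 sh)).
  apply: runs_to; [by apply: (@runs_copy _ vreg 6 10 4)| |].
    by move=> y; rewrite [nth _ _ 6]/= [nth _ _ 10]/= cats0.
  by rewrite [nth _ _ 6]/= size_map; apply: cB.
set u' := drop (size T) u; set fd := count (covers k T u (size d)) (iota 0 (size T)).
apply: (runs_seq (S2 := vst R e [::] (map inr u') [::] [::] [::] [::] 0 0 (toks A) fd sh)).
  apply: runs_to; [exact: innersP| |by rewrite /c; lia].
  by move=> y; rewrite /fd /covers dr.
have -> : uncovered k T u (size d) = (sh == 0) && (fd == 0).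
  rewrite /uncovered has_count -leqNgt leqn0 subn_eq0; congr (_ && _).
  by rewrite E size_cat leq_add2l.
apply: (runs_seq (S2 := vst R (((sh == 0) && (fd == 0)) + e) [::] (map inr u') [::] [::] [::] [::]
    0 0 (toks A) fd sh)).
  by apply: runs_le; [exact: judgeP|rewrite /c; lia].
set e' := _ + e.
apply: (runs_seq (S2 := vst R e' [::] (map inr u') [::] [::] [::] [::] 0 0 (toks A) 0 sh)).
  apply: runs_to; [exact: clearP|by []|].
  rewrite [nth _ _ _]/= size_nseq; apply: cl; apply: leq_trans TB.
  by apply: leq_trans (count_size _ _) _; rewrite size_iota.
apply: (runs_seq (S2 := vst R e' [::] (map inr u') [::] [::] [::] [::] 0 0 (toks A) 0 0)).
  apply: runs_to; [exact: clearP|by []|].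
  by rewrite [nth _ _ _]/= size_nseq /c /sh; lia.
apply: (runs_seq (S2 := vst R e' [::] (map inr u') [::] [::] [::] [::] 0 0 [::] 0 0)).
  by apply: runs_to; [exact: clearP|by []|exact: cl].
apply: (runs_seq (S2 := vst R e' [::] [::] [::] [::] [::] [::] 0 0 [::] 0 0)).
  apply: runs_to; [exact: clearP|by []|].
  by rewrite [nth _ _ _]/= size_map; apply: cl; rewrite size_drop; lia.
apply: runs_to; [by apply: (@drop_letterP 3 _ x r)|by []|].
by rewrite /c; move: (size _) rB => ? ?; lia.
Qed.

Lemma outersP e :
  runs (whilef 3 isSome outer)
    (vst (toks T) e [::] [::] [::] [::] [::] [::] 0 0 [::] 0 0)
    (vst [::] (count (uncovered k T u) (iota 0 (size T)) + e)
       [::] [::] [::] [::] [::] [::] 0 0 [::] 0 0)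
    (B * outer_time.+1 + 1).
Proof.
pose Inv (d r : seq nat) := vst (toks r) (count (uncovered k T u) (iota 0 (size d)) + e)
   [::] [::] [::] [::] [::] [::] 0 0 [::] 0 0.
apply: runs_le (@runs_while_list _ 3 outer Inv T outer_time isT _ _) _.
- by move=> d r _; exact: toks_head.
- move=> d x r E; apply: runs_to; [exact: outerP E| |by []].
  move=> y; rewrite /Inv size_rcons -addn1 iotaD count_cat add0n [iota (size d) 1]/= /= addn0.
  by rewrite addnA [_ + count _ _]addnC.
- by rewrite leq_add2r leq_mul2r (leq_trans (size_toks T)) ?orbT.
Qed.

End Main.

Definition ust x0 x1 x2 x3 x4 x5 x6 x7 e x19 : seq (seq G) :=
  [:: x0; x1; x2; x3; x4; x5; x6; x7; unary e; [::]; [::]; [::]; [::]; [::]; [::]; [::];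
      [::]; [::]; [::]; x19; [::]].

Definition letters (z : seq G) := pmap (fun g => if g is inl x then Some x else None) z.
Definition cert_bits (z : seq G) := pmap (fun g => if g is inr x then Some x else None) z.

Definition separate : prog := forf 0 (fun g => if g is inl _ then push 19 g else push 2 g).

Lemma separateP z :
  runs separate (ust z [::] [::] [::] [::] [::] [::] [::] 0 [::])
    (ust [::] [::] (rev (map inr (cert_bits z))) [::] [::] [::] [::] [::] 0 (rev (map inl (letters z))))
    (size z * (2 + 3) + 1).
Proof.
pose Inv (d r : seq G) := ust r [::] (rev (map inr (cert_bits d))) [::] [::] [::] [::] [::] 0
  (rev (map inl (letters d))).
apply: (@runs_for _ vreg 0 _ Inv z 2) => // d g r _.
rewrite /Inv /cert_bits /letters -cats1 !pmap_cat !map_cat !rev_cat.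
by case: g => g; apply: runs_to; [exact: runs_push|by []|by []|exact: runs_push|by []|by []].
Qed.

(** The local test of [wellformed] with [o] as the symbol after [g]. The word is scanned from its
    end, so [o] is the top of the part already checked. *)
Definition malformed (o : option G) (g : G) : bool :=
  match o with
  | None => g != stop
  | Some (inl None) => g == dig false
  | _ => false
  end.

Fixpoint malformations (s : seq G) : nat :=
  if s is g :: s' then malformed (ohead s') g + malformations s' else 0.

Lemma malformations_eq0 w : (malformations (map inl w) == 0) = wellformed w.
Proof.
elim: w => // g w IH; rewrite wellformed_cons -IH /= addn_eq0 andbC; congr (_ && _).
by case: w {IH} => [|[x|] w] //=; case: g => [[]|].
Qed.

Definition check_words : prog :=
  forf 19 (fun g =>
    casef 3 (fun o => if malformed o g then push 8 vone else skip) ;; push 3 g).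

Lemma check_wordsP x2 s :
  runs check_words (ust [::] [::] x2 [::] [::] [::] [::] [::] 0 s)
    (ust [::] [::] x2 (rev s) [::] [::] [::] [::] (malformations (rev s)) [::])
    (size s * (5 + 3) + 1).
Proof.
pose Inv (d r : seq G) := ust [::] [::] x2 (rev d) [::] [::] [::] [::] (malformations (rev d)) r.
apply: (@runs_for _ vreg 19 _ Inv s 5) => // d g r _.
rewrite /Inv rev_rcons [malformations (g :: _)]/=.
apply: (@runs_le _ _ _ _ _ (3 + 2)) => //.
apply: (runs_seq (S2 := ust [::] [::] x2 (rev d) [::] [::] [::] [::]
  (malformed (ohead (rev d)) g + malformations (rev d)) r)).
  apply: runs_case => //; rewrite [nth _ _ _]/=; case: malformed.
    by apply: runs_to; [exact: runs_push|by []|by []].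
  by apply: runs_to; [exact: runs_skip|by []|by []].
by apply: runs_to; [exact: runs_push|by []|by []].
Qed.

Definition dec_step (be : seq bool * nat) (g : G) :=
  if g == vone then (decb be.1, all (pred1 false) be.1 + be.2) else be.

Lemma size_carry x b : size (carry x [::] b) = size b.
Proof. by elim: b => //= y b IH; case: ifP => //= _; rewrite IH. Qed.

(** The bound is decremented once for each set bit. After an underflow the counter is meaningless,
    but the recorded failure stays. *)
Lemma dec_foldP s b e :
  size (foldl dec_step (b, e) s).1 = size b /\
  ((foldl dec_step (b, e) s).2 == 0) = (e == 0) && (count (pred1 vone) s <= bval b).
Proof.
elim: s b e => [|g s IH] b e /=; first by rewrite andbT.
rewrite /dec_step /=; case: (g == vone) => /=; last exact: IH.
have [-> ->] := IH (decb b) (all (pred1 false) b + e); rewrite size_carry; split=> //.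
rewrite -bval_eq0 addn_eq0; have := bval_dec b; case: (bval b) => [|n]; first by rewrite andbF.
by case=> // ->.
Qed.

Definition count_cert : prog :=
  forf 2 (fun g => push 6 g ;; if g == vone then decf vone dig 5 4 8 else skip).

Lemma count_certP x3 b s B : size b <= B -> size s <= B ->
  let r := foldl dec_step (b, 0) s in
  runs count_cert (ust [::] [::] s x3 [::] (map dig b) [::] [::] 0 [::])
    (ust [::] [::] [::] x3 [::] (map dig r.1) (rev s) [::] r.2 [::])
    (B * (9 * B + 15) + 1).
Proof.
move=> bB sB; pose Inv (d r : seq G) := let z := foldl dec_step (b, 0) d in
  ust [::] [::] r x3 [::] (map dig z.1) (rev d) [::] z.2 [::].
apply: (@runs_le _ _ _ _ _ (size s * ((9 * B + 12) + 3) + 1)); last first.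
  by rewrite leq_add2r -addnA leq_mul2r sB orbT.
apply: (@runs_for _ vreg 2 _ Inv s (9 * B + 12)) => // d g r _.
rewrite /Inv foldl_rcons rev_rcons; have [sz _] := dec_foldP d b 0.
case: (foldl _ _ _) sz => c e /= sz.
apply: (@runs_le _ _ _ _ _ (2 + (9 * size c + 10))); last by lia.
apply: (runs_seq (S2 := ust [::] [::] r x3 [::] (map dig c) (g :: rev d) [::] e [::])).
  by apply: runs_to; [exact: runs_push|by []|by []].
rewrite /dec_step /=; case: ifP => _; last first.
  by apply: runs_le (@runs_skip _ _ _) _; lia.
have dinj : injective dig by move=> ? ? [].
apply: runs_to; [by apply: (@runs_dec _ vreg vone dig dinj 5 4 8 _ c)| |by []].
by move=> y; rewrite /ust [(_, _).2]/= nseqD.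
Qed.

Definition answer : prog :=
  casef 8 (fun o => push 1 (if o is Some _ then inr false else inr true)).

Definition main : prog :=
  move_digits 3 4 ;; pop 3 ;; mov 4 5 ;; count_cert ;; copy 3 7 4 ;;
  whilef 3 isSome outer ;; answer.

Definition main_time B :=
  (5 * B + 1) + (1 + ((5 * B + 1) + ((B * (9 * B + 15) + 1) + ((12 * B + 2) +
    ((B * (outer_time B).+1 + 1) + 3))))).

Lemma mainP p T (u : seq bool) B : size (toks (p :: T)) <= B -> size u <= B -> exists2 S',
  runs main (ust [::] [::] (rev (map inr u)) (toks (p :: T)) [::] [::] [::] [::] 0 [::]) S'
    (main_time B)
  & nth [::] S' 1 = [:: inr ((count id u <= p) && ~~ has (uncovered k T u) (iota 0 (size T)))].
Proof.
rewrite toks_cons => TB uB; set b := binary p in TB *.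
have bB : size b <= B by move: TB; rewrite size_cat size_map; apply/leq_trans/leq_addr.
have TB' : size (toks T) <= B.
  by move: TB; rewrite size_cat /= addnS; apply: leq_trans; apply/leqW/leq_addl.
have [_] := dec_foldP (rev (map inr u)) b 0; have := @count_certP (toks T) b (rev (map inr u)) B bB.
rewrite size_rev size_map revK => /(_ uB); set r := foldl _ _ _ => CM.
rewrite bval_binary eqxx andTb count_rev count_map (eq_count (a2 := id)); last by case.
move=> <-; set n := count (uncovered k T u) (iota 0 (size T)).
exists (set_nth [::] (ust [::] [::] [::] [::] [::] (map dig r.1) (map inr u) (toks T) (n + r.2) [::]) 1
  [:: inr (n + r.2 == 0)]); last by rewrite /= has_count -/n addn_eq0 lt0n negbK andbC.
apply: runs_seq.
  apply: runs_le; first by apply: (@move_digitsP 3 4 _ b (toks T)).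
  by rewrite leq_add2r leq_mul2l bB.
apply: runs_seq; first exact: runs_pop.
apply: (runs_seq (S2 := ust [::] [::] (rev (map inr u)) (toks T) [::] (map dig b) [::] [::] 0 [::])).
  apply: runs_to; [by apply: (@runs_mov _ vreg 4 5)| |].
    by move=> y; rewrite /= !cats0 revK.
  by rewrite /= cats0 size_rev size_map leq_add2r leq_mul2l bB.
apply: (runs_seq CM).
apply: (runs_seq (S2 := ust [::] [::] [::] (toks T) [::] (map dig r.1) (map inr u) (toks T) r.2 [::])).
  apply: runs_to; [by apply: (@runs_copy _ vreg 3 7 4)| |].
    by move=> y; rewrite [nth _ _ 3]/= [nth _ _ 7]/= cats0.
  by rewrite leq_add2r leq_mul2l TB' orbT.
apply: runs_seq; first exact: (@outersP T u (map dig r.1) B TB' uB r.2).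
apply: runs_case => //; apply: runs_to; [exact: runs_push| |by []] => y.
by rewrite [nth _ _ 8]/=; case: (_ + _).
Qed.

(** The empty word has no malformation and yet encodes nothing, hence the separate test on register
    3. *)
Definition verifier : prog :=
  separate ;; check_words ;; casef 3 (fun o => if o is Some _ then skip else push 8 vone) ;;
  casef 8 (fun o => if o is Some _ then push 1 (inr false) else main).

Definition verifier_time B := (5 * B + 1) + ((8 * B + 1) + (3 + (main_time B + 2).+1)).

Lemma verifierP z : exists2 S',
  runs verifier (ust z [::] [::] [::] [::] [::] [::] [::] 0 [::]) S' (verifier_time (size z))
  & nth [::] S' 1 = [:: inr (verify k z)].
Proof.
set B := size z; rewrite /verify -/(letters z) -/(cert_bits z).
have wB : size (letters z) <= B.
  by rewrite /letters size_pmap (leq_trans (count_size _ _)).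
have uB : size (cert_bits z) <= B.
  by rewrite /cert_bits size_pmap (leq_trans (count_size _ _)).
set w := letters z in wB *; set u := cert_bits z in uB *.
pose bad := (w == [::]) + malformations (map inl w).
have bad0 : (bad == 0) = wellformed w && (w != [::]).
  by rewrite addn_eq0 malformations_eq0 andbC; case: (w).
suff [S' R E] : exists2 S',
    runs (casef 8 (fun o => if o is Some _ then push 1 (inr false) else main))
      (ust [::] [::] (rev (map inr u)) (map inl w) [::] [::] [::] [::] bad [::]) S'
      (main_time B + 2).+1
    & nth [::] S' 1 = [:: inr (check k w u)].
  exists S' => //; apply: runs_seq.
    by apply: runs_le; [exact: separateP|rewrite -/B; lia].
  apply: runs_seq.
    by apply: runs_le; [exact: check_wordsP|rewrite size_rev size_map mulnC leq_add2r leq_mul2l wB orbT].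
  apply: runs_seq R; rewrite revK -/w -/u; apply: runs_case => //.
  rewrite /bad; case: (w) => [|x w'].
    by apply: runs_to; [exact: runs_push|by []|by []].
  by apply: runs_to; [exact: runs_skip|by []|by []].
case: (posnP bad) => [b0|bad_gt0].
  have /andP[wf nw] : wellformed w && (w != [::]) by rewrite -bad0 b0.
  have [T [p E]] : exists T p, w = encode T p by apply/wellformed_encode; rewrite wf.
  have tB : size (toks (p :: T)) <= B by rewrite size_map -[enc _]/(encode T p) -E.
  have [S' R ES] := mainP tB uB; exists S'.
    apply: runs_case => //; rewrite b0 E; apply: runs_le R _; exact: leq_addr.
  by rewrite ES /check wf E encodeE enc_cons decode_enc bval_binary.
exists (set_nth [::] (ust [::] [::] (rev (map inr u)) (map inl w) [::] [::] [::] [::] bad [::]) 1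
  [:: inr false]).
  apply: runs_case => //; case: (bad) bad_gt0 => // n _.
  by apply: runs_to; [exact: runs_push|by []|exact: leq_addl].
have : ~~ (wellformed w && (w != [::])) by rewrite -bad0 -lt0n.
by rewrite /= /check; case: (wellformed w) => //=; case: (w).
Qed.

Lemma verify_polytime : polytime_pred (verify k).
Proof.
have [t Ht] : ispoly verifier_time.
  rewrite /verifier_time /main_time /outer_time /window_time /inner_time.
  by do ![exact: ispoly_const|exact: ispoly_id|apply: ispoly_succ|apply: ispoly_mul
    |apply: ispoly_add].
have ij : injective (@inr (option bool) bool) by move=> ? ? [].
apply: (@polytime_of_frag G bool G vreg id inr (@inj_id _) ij (@Ordinal vreg 0 isT)
  (@Ordinal vreg 1 isT) verifier _ t) => z.
have [S' R E] := verifierP z.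
exists (ust z [::] [::] [::] [::] [::] [::] [::] 0 [::]), S', (verifier_time (size z)).
split=> //; last by rewrite Ht.
by case=> -[|i] //= im; rewrite ?map_id //; do 20?[case: i im => [|i] //= im].
Qed.

End Verifier.

(** Each letter has a nonempty code, so a mask is no longer than the input and ['X] bounds the
    certificate. A longer accepted mask is truncated to the string, as only hits inside its windows
    count. *)
Lemma sharp_attractor_in_NP k : 0 < k -> in_NP (k_sharp_attractor k).
Proof.
move=> k0; exists 'X%R, (verify k); split; first exact: verify_polytime.
move=> w; rewrite hornerX; split=> [[T [p [-> /(sharp_attractor_mask _ _ k0) H]]]|[u [_]]].
  case: H => u [uT le H]; exists u; rewrite verify_cat; split; last exact/check_encode.
  by apply: leq_trans uT _; have := size_toks (p :: T); rewrite size_map; apply: ltnW.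
rewrite verify_cat => ck; have [T [p E]] := check_wellformed ck; exists T, p; split=> //.
move: ck; rewrite E => /(check_encode _ _ _ k0) [le H].
apply/sharp_attractor_mask => //; exists (take (size T) u); split.
- by rewrite size_take_min geq_minl.
- by apply: leq_trans le; rewrite -{2}(cat_take_drop (size T) u) count_cat leq_addr.
move=> i ik; have [i' [i'k eq [j ij uj]]] := H i ik; exists i'; split=> //; exists j => //.
by rewrite nth_take //; lia.
Qed.

Theorem theorem34 (k : nat) (hk : 3 <= k) : NP_complete (k_sharp_attractor k).
Proof.
by split; [apply: sharp_attractor_in_NP; apply: ltnW (ltnW hk)|apply: sharp_attractor_NP_hard].
Qed.
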